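(* Consider the Gaussian-texture quotient family $p_{\beta,\mu}$, $\mu\ge0$, defined in the context, with parameters $d>0$ and $c=e^{\beta}\Delta t/2>0$, and set $s=e^{-2c}\in(0,1)$. For every fixed $d>0$ and $c>0$, the Gaussian curvature of the Fisher metric of $(\beta,\mu)\mapsto p_{\beta,\mu}$ admits at the boundary $\mu=0$ the one-sided value $$K_F(s)=-\frac{45s^6+534s^5+1887s^4+3172s^3+2075s^2+422s+57}{4(1+s)^2(3+s)^2(1+3s)^2}.$$ Consequently $K_F(s)<0$ for every $0<s<1$. Moreover $$\lim_{c\to0}K_F=-2,\qquad\lim_{c\to\infty}K_F=-\frac{19}{12}.$$ In particular, the boundary curvature is independent of $d$.
   Context: Fix $A>0$ and a sampling interval $\Delta t>0$; put $d=A\Delta t$. For $\beta\in\mathbb R$ let $B_0=e^\beta$, $c=c(\beta)=B_0\Delta t/2$, $\rho=e^{-c}$, and let $p_\beta$ be the density on $\mathbb C^2$ of the centered circular complex Gaussian pair $(Y_0,Y_1)$ with $\mathbb E|Y_0|^2=\mathbb E|Y_1|^2=1$ and $\mathbb E[Y_1\overline{Y_0}]=\rho$. Let $Z$ be the stationary centered Gaussian Ornstein–Uhlenbeck process with $\mathbb E[Z_sZ_t]=e^{-A|t-s|}$ and, for $\lambda\in\mathbb R$, $$\delta_\lambda=\log\left(\frac1{\Delta t}\int_0^{\Delta t}e^{\lambda Z_s-\lambda^2/2}\,ds\right),\qquad p_{\beta,\lambda}=\mathbb E_Z[p_{\beta+\delta_\lambda}].$$ This is the observed stationary two-time law of the limiting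 model; it is even in $\lambda$ and is reparametrized by $\mu=\lambda^2/2\ge0$, giving the quotient family $p_{\beta,\mu}$. The Fisher metric is $g_{ij}=\mathbb E[\partial_i\log p\,\partial_j\log p]$ in the coordinates $(\beta,\mu)$ (both are parameters; $\beta$ is not eliminated). It is non-degenerate up to $\mu=0$; derivatives in $\mu$ at $\mu=0$ are one-sided. *)

(* Defs.v *)
From HB Require Import structures.
From mathcomp Require Import all_boot all_order all_algebra.
From mathcomp Require Import complex.
From mathcomp Require Import all_classical all_reals all_analysis.

Set Implicit Arguments.
Unset Strict Implicit.
Unset Printing Implicit Defensive.

Import Order.TTheory GRing.Theory Num.Theory.
Import numFieldNormedType.Exports.

Local Open Scope classical_set_scope.
Local Open Scope ring_scope.

(* Parameters are points (beta, mu) : R * R; every derivative is taken within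
   the closed half-plane mu >= 0. *)
Section half_plane_calculus.
Context {R : realType}.

Definition half_plane : set (R * R) := [set t | 0 <= t.2].

Definition coord_dir (i : 'I_2) : R * R := if i == 0 then (1, 0) else (0, 1).

Definition diff_quot (i : 'I_2) (f : R * R -> R) (t : R * R) (h : R) : R :=
  h^-1 * (f (t + h *: coord_dir i) - f t).

(* Increments h <> 0 that keep the point inside the half-plane: two-sided in
   direction beta and at interior points, one-sided (h > 0) in direction mu
   when t.2 = 0. *)
Definition increments (i : 'I_2) (t : R * R) : set_system R :=
  within [set h | half_plane (t + h *: coord_dir i)] 0^'.

Definition has_partial (i : 'I_2) (f : R * R -> R) (t : R * R) : Prop :=
  cvg (diff_quot i f t @ increments i t).

Definition partial (i : 'I_2) (f : R * R -> R) (t : R * R) : R :=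
  lim (diff_quot i f t @ increments i t).

End half_plane_calculus.

Section gaussian_curvature.
Context {R : realType}.
Implicit Types (g : R * R -> 'M[R]_2) (t : R * R) (i j k l : 'I_2).

(* Gamma^k_{ij} of the Levi-Civita connection *)
Definition christoffel g k i j t : R :=
  2^-1 * \sum_(l < 2) invmx (g t) k l *
    (partial i (fun u => g u j l) t + partial j (fun u => g u i l) t
     - partial l (fun u => g u i j) t).

(* R^l_{kij}, where R(d_i, d_j) d_k = \sum_l R^l_{kij} d_l and
   R(X, Y) = [nabla_X, nabla_Y] - nabla_[X, Y] *)
Definition riemann g l k i j t : R :=
  partial i (christoffel g l j k) t - partial j (christoffel g l i k) t
  + \sum_(m < 2) (christoffel g l i m t * christoffel g m j k t
                  - christoffel g l j m t * christoffel g m i k t).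

(* g(R(d_0, d_1) d_1, d_0) / det g *)
Definition gauss_curvature g t : R :=
  (\sum_(l < 2) g t 0 l * riemann g l 1 0 1 t) / \det (g t).

(* [partial] is total; this says that all the derivatives occurring in
   [gauss_curvature g t] exist and that the metric is nondegenerate. *)
Definition has_gauss_curvature g t : Prop :=
  (\forall u \near within half_plane (nbhs t),
     g u \in unitmx /\
     forall i j k, has_partial i (fun v => g v j k) u)
  /\ forall l, has_partial 0 (christoffel g l 1 1) t
            /\ has_partial 1 (christoffel g l 0 1) t.

End gaussian_curvature.

Section fisher_metric.
Context {R : realType} d (Y : measurableType d).
Variables (nu : {measure set Y -> \bar R}) (p : R * R -> Y -> R).
Implicit Types (t : R * R) (i j : 'I_2) (y : Y).

Definition score i t y : R := partial i (fun u => ln (p u y)) t.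

Definition fisher_metric t : 'M[R]_2 :=
  \matrix_(i, j) (\int[nu]_y (score i t y * score j t y * p t y)).

Definition has_fisher_metric t : Prop :=
  [/\ forall y, 0 < p t y,
      forall i y, has_partial i (fun u => ln (p u y)) t &
      forall i j, nu.-integrable [set: Y]
        (fun y => (score i t y * score j t y * p t y)%:E)].

End fisher_metric.

(* C^2 as R^4: the point (((a, b), c), d) stands for (a + i b, c + i d). *)
Definition C2 (R : realType) : Type :=
  (measurableTypeR R * measurableTypeR R * measurableTypeR R
   * measurableTypeR R)%type.

Section complex_gaussian.
Context {R : realType}.

(* Density of the centered circular complex Gaussian vector Y in C^n with
   covariance matrix C i j = E[Y_i * conj (Y_j)], with respect to Lebesgue
   measure on R^(2n): exp (- v^* C^-1 v) / (pi^n det C). *)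
Definition circular_gaussian_pdf n (C : 'M[R[i]]_n) (v : 'cV[R[i]]_n) : R :=
  expR (- complex.Re (((map_mx conjc v)^T *m invmx C *m v) 0 0))
  / (pi ^+ n * complex.Re (\det C)).

Definition C2_lebesgue : {measure set (C2 R) -> \bar R} :=
  (lebesgue_measure \x lebesgue_measure \x lebesgue_measure
   \x lebesgue_measure)%E.

Definition C2_vec (y : C2 R) : 'cV[R[i]]_2 :=
  \col_k (if k == 0 then Complex (y.1.1.1 : R) (y.1.1.2 : R)
          else Complex (y.1.2 : R) (y.2 : R)).

Definition pair_covariance (rho : R) : 'M[R[i]]_2 :=
  \matrix_(i, j) (if i == j then 1 else Complex rho 0).

End complex_gaussian.

Section ornstein_uhlenbeck.
Context {R : realType} d (Omega : measurableType d) (P : probability Omega R).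

(* [normal_prob m 0] is not the Dirac mass at m, whence the case split. *)
Definition gaussian_rv (X : Omega -> R) : Prop :=
  exists m s : R, forall B : set R, measurable B ->
    P (X @^-1` B) = if s == 0 then \d_m B else normal_prob m s B.

Definition gaussian_process (Z : R -> {RV P >-> R}) : Prop :=
  forall (n : nat) (t a : 'I_n -> R),
    gaussian_rv (fun w => \sum_(k < n) a k * Z (t k) w).

Definition stationary_OU (A : R) (Z : R -> {RV P >-> R}) : Prop :=
  [/\ gaussian_process Z,
      forall t, ('E_P[Z t] = 0)%E,
      forall s t, ('E_P[(fun w => Z s w * Z t w)%R] = (expR (- A * `|t - s|)%R)%:E)%E &
      forall w, continuous (fun t => Z t w)].

End ornstein_uhlenbeck.

Section texture_model.
Context {R : realType} d (Omega : measurableType d) (P : probability Omega R).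
Variables (Dt : R) (Z : R -> {RV P >-> R}).

Definition rate (beta : R) : R := expR beta * Dt / 2.

Definition base_pdf (beta : R) (y : C2 R) : R :=
  circular_gaussian_pdf (pair_covariance (expR (- rate beta))) (C2_vec y).

Definition log_clock (lambda : R) (w : Omega) : R :=
  ln (Dt^-1 * \int[lebesgue_measure]_(s in `[0, Dt])
                expR (lambda * Z s w - lambda ^+ 2 / 2)).

Definition texture_pdf (beta lambda : R) (y : C2 R) : R :=
  fine ('E_P[(fun w => base_pdf (beta + log_clock lambda w) y)%R])%E.

(* t = (beta, mu) with mu = lambda^2/2; [texture_pdf] is even in lambda, so
   the nonnegative root is taken. *)
Definition quotient_pdf (t : R * R) : C2 R -> R :=
  texture_pdf t.1 (Num.sqrt (2 * t.2)).

Definition texture_metric : R * R -> 'M[R]_2 :=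
  fisher_metric C2_lebesgue quotient_pdf.

Definition boundary_curvature (beta : R) : R :=
  gauss_curvature texture_metric (beta, 0).

End texture_model.

Definition KF {R : realType} (s : R) : R :=
  - (45 * s ^+ 6 + 534 * s ^+ 5 + 1887 * s ^+ 4 + 3172 * s ^+ 3
     + 2075 * s ^+ 2 + 422 * s + 57)
  / (4 * (1 + s) ^+ 2 * (3 + s) ^+ 2 * (1 + 3 * s) ^+ 2).

(* Main.v *)
(* The mixture density q(beta, lambda, y) = E f(beta + delta_lambda, y) is smooth
   and even in lambda, so the analysis is done in lambda and mu = lambda^2/2 is
   substituted only at the end. The metric coefficients are
   g_00 = J(s10^2), g_01 = J(s10 s01)/lambda, g_11 = J(s01^2)/lambda^2, where
   s_ij = (d_beta^i d_lambda^j q)/q and J(e) is the integral of e q; since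
   d_mu = lambda^-1 d_lambda, a one-sided mu-derivative at 0 of phi/lambda^k with
   phi even or odd is a Taylor coefficient of phi. Derivatives pass under the
   integrals because, by Cauchy-Schwarz under the law of the clock tilted by the
   density, every polynomial in the s_ij times q is dominated, locally uniformly
   in the parameters, by a multiple of exp(- |y|^2/4).
   At lambda = 0 the clock satisfies d_lambda delta = m_1 := mean of Z over the
   sampling interval, and with phi_k = (d_beta^k f)/f one finds s_i0 = phi_i,
   s_i1 = s_i3 = 0, s_i2 = v (phi_{i+2} - phi_{i+1}), v = E m_1^2 > 0, while s_i4
   is a combination of phi_{i+1}, ..., phi_{i+4} whose coefficients cancel in the
   curvature. Under f, |Y_0 + Y_1|^2 and |Y_0 - Y_1|^2 are independent
   exponential variables with means 2(1 + rho) and 2(1 - rho), so Brioschi's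
   formula becomes an explicit rational function of rho, even in rho and free of
   v, c and d. *)
Require Import Defs.
From HB Require Import structures.
From mathcomp Require Import all_boot all_order all_algebra.
From mathcomp Require Import complex ring lra.
From mathcomp Require Import all_classical all_reals all_analysis.
From mathcomp Require Import measurable_realfun ssrZ.
From Stdlib Require BinInt Pnat.

Set Implicit Arguments.
Unset Strict Implicit.
Unset Printing Implicit Defensive.

Import Order.TTheory GRing.Theory Num.Theory.
Import numFieldNormedType.Exports.

Local Open Scope classical_set_scope.
Local Open Scope ring_scope.

(** * Polynomial expressions and differentiation under the integral *)

(** The curvature needs many derivatives under two nested expectations, each of a different
    integrand. All integrands are polynomials in quantities closed under differentiation, times one
    positive weight, so they are kept as syntax: a derivation becomes a map on [expr], and one
    domination statement quantified over all expressions justifies every derivative at once. Such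
    domination follows from bounds on the variables as soon as the bounding functions are closed
    under squaring. This closure is the delicate point for the ratios s_ij: their denominator q
    mixes Gaussians of random width and has no lower bound matching the bounds of the numerators.
    Read as conditional means over the path given the observation, the ratios have bounds that
    square well, and multiplying by q undoes the conditioning. The same syntax serves at the end,
    where the identity behind the curvature, in eleven variables, is decided by evaluation into
    sparse integer polynomials. The process enters only through bounded paths, exponential moments
    uniform in time, and joint moments of order at most three at fixed times. *)

Inductive expr (V : Type) :=
  | ECst of nat | EVar of V | EOpp of expr V
  | EAdd of expr V & expr V | EMul of expr V & expr V.
Arguments ECst {V}.

Section expressions.
Context {R : realType} {V : Type}.
Implicit Types (x : V -> R) (e k : expr V) (dv : V -> expr V).

Fixpoint ev x e : R :=
  match e with
  | ECst n => n%:R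
  | EVar v => x v
  | EOpp e1 => - ev x e1
  | EAdd e1 e2 => ev x e1 + ev x e2
  | EMul e1 e2 => ev x e1 * ev x e2
  end.

Fixpoint der dv e : expr V :=
  match e with
  | ECst n => ECst 0
  | EVar v => dv v
  | EOpp e1 => EOpp (der dv e1)
  | EAdd e1 e2 => EAdd (der dv e1) (der dv e2)
  | EMul e1 e2 => EAdd (EMul (der dv e1) e2) (EMul e1 (der dv e2))
  end.

(* If [w' = k w], then [(e w)' = (wder dv k e) w]. *)
Definition wder dv k e := EAdd (der dv e) (EMul k e).

(** A chain rule along a curve run at speed [h]: the one derivation [c d/dc] of the base density
    then serves for beta, where [h] is 1, and for lambda, where [h] is the derivative of the
    log-clock. *)
Lemma is_derive_ev (x : R -> V -> R) dv (h t : R) :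
  (forall v, is_derive t 1 (x^~ v) (h * ev (x t) (dv v))) ->
  forall e, is_derive t 1 (fun u => ev (x u) e) (h * ev (x t) (der dv e)).
Proof.
move=> dx; elim => [n|v|e IH|e1 IH1 e2 IH2|e1 IH1 e2 IH2] //=.
- by rewrite mulr0; exact: is_derive_cst.
- rewrite mulrN; exact: is_deriveN.
- rewrite mulrDr; exact: is_deriveD.
- by apply: (is_derive_eq (is_deriveM IH1 IH2)); rewrite /GRing.scale /=; ring.
Qed.

Lemma is_derive_wev (x : R -> V -> R) (w : R -> R) dv k (h t : R) :
  (forall v, is_derive t 1 (x^~ v) (h * ev (x t) (dv v))) ->
  is_derive t 1 w (h * ev (x t) k * w t) ->
  forall e, is_derive t 1 (fun u => ev (x u) e * w u)
    (h * ev (x t) (wder dv k e) * w t).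
Proof.
move=> dx dw e; have de := is_derive_ev dx e.
by apply: (is_derive_eq (is_deriveM de dw)); rewrite /GRing.scale /=; ring.
Qed.

Definition eqv e1 e2 := forall x, ev x e1 = ev x e2.

(* [der dv e] is the derivative of [e] along the line directed by [dv]. *)
Lemma eqv_der dv e1 e2 : eqv e1 e2 -> eqv (der dv e1) (der dv e2).
Proof.
move=> e12 x.
pose y (t : R) v : R := x v + t * ev x (dv v).
have y0 : y 0 = x by apply/funext => v; rewrite /y mul0r addr0.
have dy v : is_derive (0 : R) 1 (y^~ v) (1 * ev (y 0) (dv v)).
  rewrite y0 /y; apply: (is_derive_eq (is_deriveD (is_derive_cst (x v) _ _)
    (is_deriveM (is_derive_id _ _) (is_derive_cst (ev x (dv v)) _ _)))).
  by rewrite /GRing.scale /= mulr0 !add0r mul1r mulr1.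
have d1 := is_derive_ev dy e1; have d2 := is_derive_ev dy e2.
have E : (fun u => ev (y u) e1) = (fun u => ev (y u) e2).
  by apply/funext => u; exact: e12.
move: (@derive_val _ _ _ _ _ _ _ d1) (@derive_val _ _ _ _ _ _ _ d2).
by rewrite E y0 !mul1r => -> .
Qed.

Lemma eqv_wder dv k e1 e2 : eqv e1 e2 -> eqv (wder dv k e1) (wder dv k e2).
Proof. by move=> e12 x /=; rewrite (eqv_der dv e12) e12. Qed.

Section commuting_derivations.
Variables (dv0 dv1 : V -> expr V) (k0 k1 : expr V).
Hypothesis dvC : forall v, eqv (der dv0 (dv1 v)) (der dv1 (dv0 v)).
Hypothesis kC : eqv (der dv0 k1) (der dv1 k0).

Lemma derC e : eqv (der dv0 (der dv1 e)) (der dv1 (der dv0 e)).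
Proof.
elim: e => [n|v|e IH|e1 IH1 e2 IH2|e1 IH1 e2 IH2] x //=.
- exact: dvC.
- by rewrite IH.
- by rewrite IH1 IH2.
- by rewrite IH1 IH2; ring.
Qed.

(** [kC] is the closedness satisfied by two logarithmic derivatives of one weight; it makes the
    twisted derivations commute as the plain ones do. *)
Lemma wderC e : eqv (wder dv0 k0 (wder dv1 k1 e)) (wder dv1 k1 (wder dv0 k0 e)).
Proof. by move=> x /=; rewrite derC kC; ring. Qed.

Lemma iter_wderC n e : eqv (wder dv1 k1 (iter n (wder dv0 k0) e))
  (iter n (wder dv0 k0) (wder dv1 k1 e)).
Proof.
elim: n => [|n IH] x //.
by rewrite !iterS -wderC (eqv_wder dv0 k0 IH).
Qed.

End commuting_derivations.
End expressions.

(** * Domination of polynomial expressions by a scale of functions *)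

Section growth_scales.
Context {R : realType} {I V : Type}.
Variables (D : set I) (B : nat -> I -> R) (x : I -> V -> R).

(** Squares are asked for instead of products because the main scales below are averages, whose
    squares are controlled by Jensen or Cauchy-Schwarz. Products follow, as [B m * B n] is at most
    the square of [B (maxn m n)]. *)
Definition growth_scale := [/\ forall n i, D i -> 1 <= B n i,
  forall m n i, D i -> (m <= n)%N -> B m i <= B n i &
  forall n, exists m, forall i, D i -> B n i ^+ 2 <= B m i].

Definition scale_bounded (f : I -> R) :=
  exists C N, 0 <= C /\ forall i, D i -> `|f i| <= C * B N i.

Hypothesis gB : growth_scale.

Lemma scale_boundedN f : scale_bounded f -> scale_bounded (fun i => - f i).
Proof.
by case=> C [N [C0 h]]; exists C, N; split=> // i Di; rewrite normrN h.
Qed.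

Lemma scale_bounded_cst (r : R) : scale_bounded (fun=> r).
Proof.
case: gB => B1 _ _; exists `|r|, 0%N; split=> // i Di.
by rewrite ler_peMr // B1.
Qed.

Lemma scale_boundedD f g :
  scale_bounded f -> scale_bounded g -> scale_bounded (fun i => f i + g i).
Proof.
case: gB => B1 Bm _ [C [N [C0 hf]]] [C' [N' [C0' hg]]].
exists (C + C'), (maxn N N'); split; first exact: addr_ge0.
move=> i Di; rewrite (le_trans (ler_normD _ _)) // mulrDl lerD //.
  by rewrite (le_trans (hf _ Di)) // ler_wpM2l // Bm // leq_maxl.
by rewrite (le_trans (hg _ Di)) // ler_wpM2l // Bm // leq_maxr.
Qed.

Lemma scale_boundedM f g :
  scale_bounded f -> scale_bounded g -> scale_bounded (fun i => f i * g i).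
Proof.
case: gB => B1 Bm Bs [C [N [C0 hf]]] [C' [N' [C0' hg]]].
have [M hM] := Bs (maxn N N').
exists (C * C'), M; split; first exact: mulr_ge0.
move=> i Di; rewrite normrM.
have B0 n : 0 <= B n i by rewrite (le_trans ler01) // B1.
apply: (@le_trans _ _ (C * B N i * (C' * B N' i))).
  by rewrite ler_pM // ?hf ?hg.
rewrite mulrACA ler_wpM2l ?mulr_ge0 //.
rewrite (le_trans _ (hM _ Di)) // expr2 ler_pM // Bm //.
  exact: leq_maxl.
exact: leq_maxr.
Qed.

Lemma scale_bounded_ev :
  (forall v, scale_bounded (x^~ v)) ->
  forall e, scale_bounded (fun i => ev (x i) e).
Proof.
move=> bx; elim => [n|v|e IH|e1 IH1 e2 IH2|e1 IH1 e2 IH2] //=.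
- exact: scale_bounded_cst.
- exact: scale_boundedN.
- exact: scale_boundedD.
- exact: scale_boundedM.
Qed.

End growth_scales.

Lemma measurable_ev d (T : measurableType d) (R : realType) (V : Type)
    (x : T -> V -> R) :
  (forall v, measurable_fun setT (x^~ v)) ->
  forall e, measurable_fun setT (fun i => ev (x i) e).
Proof.
move=> mx; elim => [n|v|e IH|e1 IH1 e2 IH2|e1 IH1 e2 IH2] //=.
- exact: measurableT_comp.
- exact: measurable_funD.
- exact: measurable_funM.
Qed.

Section derivation_under_integral.
Context d (T : measurableType d) {R : realType} {V : Type}.
Variables (mu : {measure set T -> \bar R}) (u v : R).
Variables (x : R -> T -> V -> R) (w : R -> T -> R).
Variables (dv : V -> expr V) (k : expr V).
Let I := `]u, v[%classic.

Hypothesis dx : forall t y, I t -> forall v,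
  is_derive t 1 (fun s => x s y v) (ev (x t y) (dv v)).
Hypothesis dw : forall t y, I t ->
  is_derive t 1 (fun s => w s y) (ev (x t y) k * w t y).
Hypothesis mx : forall t v, I t -> measurable_fun setT (fun y => x t y v).
Hypothesis mw : forall t, I t -> measurable_fun setT (w t).
Hypothesis dom : forall e, exists2 G : T -> R,
  mu.-integrable setT (EFin \o G) &
  forall t y, I t -> `|ev (x t y) e * w t y| <= G y.

Lemma measurable_ev_weighted e t : I t ->
  measurable_fun setT (fun y => ev (x t y) e * w t y).
Proof.
move=> It; apply: measurable_funM; last exact: mw.
by apply: measurable_ev => v'; exact: mx.
Qed.

Lemma integrable_ev_weighted e t : I t ->
  mu.-integrable setT (EFin \o (fun y => ev (x t y) e * w t y)).
Proof.
move=> It; have [G iG hG] := dom e; apply: le_integrable iG => //.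
  by apply/measurable_EFinP; exact: measurable_ev_weighted.
move=> y _ /=; rewrite lee_fin.
by rewrite (le_trans (hG _ _ It)) // ler_norm.
Qed.

(** The derivative is an integral of the same shape and [dom] covers every expression, so the lemma
    applies to its own output and yields all orders. *)
Lemma is_derive_integral e t : I t ->
  is_derive t 1 (fun s => \int[mu]_y (ev (x s y) e * w s y))
    (\int[mu]_y (ev (x t y) (wder dv k e) * w t y)).
Proof.
move=> It.
have dxw s y : I s -> is_derive s 1 (fun s => ev (x s y) e * w s y)
    (ev (x s y) (wder dv k e) * w s y).
  move=> Is; apply: (is_derive_eq (@is_derive_wev _ _ (fun s v => x s y v)
    (fun s => w s y) dv k 1 s _ _ e)); last by rewrite mul1r.
    by move=> v'; rewrite mul1r; exact: dx.
  by rewrite mul1r; exact: dw.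
have [G iG hG] := dom (wder dv k e).
have G0 y : 0 <= G y by rewrite (le_trans _ (hG _ y It)).
have d1E s y : I s -> partial1of2 (fun s y => ev (x s y) e * w s y) s y =
    ev (x s y) (wder dv k e) * w s y.
  by move=> Is; rewrite partial1of2E; exact: (@derive_val _ _ _ _ _ _ _ (dxw s y Is)).
have ints s : I s -> mu.-integrable setT (EFin \o (fun y => ev (x s y) e * w s y)).
  by move=> Is; exact: integrable_ev_weighted.
have ders s y : I s -> setT y -> derivable (fun s => ev (x s y) e * w s y) s 1.
  by move=> Is _; exact: (@ex_derive _ _ _ _ _ _ _ (dxw s y Is)).
have Gub s y : I s -> setT y ->
    `|partial1of2 (fun s y => ev (x s y) e * w s y) s y| <= G y.
  by move=> Is _; rewrite d1E //; exact: hG.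
split; first exact: (derivable_under_integral measurableT It ints ders G0 iG Gub).
rewrite -derive1E
  (differentiation_under_integral measurableT It ints ders G0 iG Gub).
by apply: eq_Rintegral => y _; exact: d1E.
Qed.

End derivation_under_integral.

Notation L1 mu f := (integrable mu setT (EFin \o f)).

(** * Real integrals: positivity, Cauchy-Schwarz, Fubini *)

Section real_integrals.
Context d (T : measurableType d) {R : realType}.
Variable mu : {measure set T -> \bar R}.
Implicit Types f g w : T -> R.

Lemma L1_le f g : measurable_fun setT f -> (forall x, `|f x| <= g x) ->
  L1 mu g -> L1 mu f.
Proof.
move=> mf fg; apply: le_integrable => //; first exact/measurable_EFinP.
by move=> x _ /=; rewrite lee_fin (le_trans (fg x)) // ler_norm.
Qed.

Lemma L1D f g : L1 mu f -> L1 mu g -> L1 mu (fun x => f x + g x).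
Proof. by move=> hf hg; have := integrableD measurableT hf hg. Qed.

Lemma L1B f g : L1 mu f -> L1 mu g -> L1 mu (fun x => f x - g x).
Proof. by move=> hf hg; have := integrableB measurableT hf hg. Qed.

Lemma L1Z (r : R) f : L1 mu f -> L1 mu (fun x => r * f x).
Proof. by move=> hf; have := integrableZl measurableT r hf. Qed.

(** A positive function with zero integral would vanish almost everywhere, so the whole space would
    be negligible. *)
Lemma Rintegral_gt0 f : L1 mu f -> (forall x, 0 < f x) ->
  mu setT != 0%E -> 0 < \int[mu]_x f x.
Proof.
move=> If f0 muT; rewrite lt_neqAle Rintegral_ge0 ?andbT; last first.
  by move=> x _; exact: ltW.
apply: contra muT => /eqP intf0.
have mf : measurable_fun setT (EFin \o f) by exact: (measurable_int mu).
have /(ae_eq_integral_abs mu measurableT mf) : (\int[mu]_x `|(EFin \o f) x| = 0)%E.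
  rewrite (eq_integral (EFin \o f)); last first.
    by move=> x _ /=; rewrite ger0_norm // ltW.
  by rewrite -(fineK (integrable_fin_num measurableT If)) [fine _](esym intf0).
case=> N [mN N0 subN]; rewrite -measure_le0 -[leRHS]N0 le_measure ?inE //.
by move=> x _; apply: subN => /= /(_ I)[]/eqP; rewrite gt_eqF.
Qed.

(* Cauchy-Schwarz with weight [w]: integrate [(h - m)^2 w >= 0], where [m] is
   the weighted mean of [h]. *)
Lemma weighted_sqr_le h w : (forall x, 0 <= w x) -> L1 mu w ->
  L1 mu (fun x => h x * w x) -> L1 mu (fun x => h x ^+ 2 * w x) ->
  0 < \int[mu]_x w x ->
  (\int[mu]_x (h x * w x)) ^+ 2 <= \int[mu]_x (h x ^+ 2 * w x) * \int[mu]_x w x.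
Proof.
move=> w0 iw ihw ihhw W0.
set H := \int[mu]_x (h x * w x); set W := \int[mu]_x w x.
set Q := \int[mu]_x (h x ^+ 2 * w x).
have : 0 <= \int[mu]_x ((h x ^+ 2 * w x - 2 * (H / W) * (h x * w x))
    + (H / W) ^+ 2 * w x).
  apply: Rintegral_ge0 => x _.
  have -> : h x ^+ 2 * w x - 2 * (H / W) * (h x * w x) + (H / W) ^+ 2 * w x =
    (h x - H / W) ^+ 2 * w x by ring.
  by rewrite mulr_ge0 ?sqr_ge0.
rewrite RintegralD //; [|by apply: L1B => //; exact: L1Z|exact: L1Z].
rewrite RintegralB //; last exact: L1Z.
rewrite !RintegralZl // -/H -/W -/Q.
have Wn : W != 0 by rewrite gt_eqF.
have -> : Q - 2 * (H / W) * H + (H / W) ^+ 2 * W = Q - H ^+ 2 / W by field.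
by rewrite subr_ge0 ler_pdivrMr.
Qed.

End real_integrals.

Section probability_integrals.
Context d (T : measurableType d) {R : realType} (P : probability T R).

Lemma L1_cst (r : R) : L1 P (fun=> r).
Proof. exact: finite_measure_integrable_cst. Qed.

Lemma Rintegral_prob_cst (r : R) : \int[P]_x r = r.
Proof. by rewrite Rintegral_cst //; rewrite (_ : _ setT = 1%E) ?mulr1 //; exact: (probability_setT P). Qed.

Lemma L1_bounded (f : T -> R) (C : R) : measurable_fun setT f ->
  (forall x, `|f x| <= C) -> L1 P f.
Proof. by move=> mf fC; apply: (L1_le mf fC); exact: L1_cst. Qed.

Lemma sqr_mean_le (h : T -> R) : L1 P h -> L1 P (fun x => h x ^+ 2) ->
  (\int[P]_x h x) ^+ 2 <= \int[P]_x (h x ^+ 2).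
Proof.
move=> ih ihh.
have E1 : (fun x => h x * (1 : R)) = h by apply/funext => x; rewrite mulr1.
have E2 : (fun x => h x ^+ 2 * (1 : R)) = (fun x => h x ^+ 2).
  by apply/funext => x; rewrite mulr1.
have := @weighted_sqr_le _ _ _ P h (fun=> 1) (fun=> ler01) (L1_cst 1).
by rewrite Rintegral_prob_cst ltr01 E1 E2 mulr1; apply.
Qed.

End probability_integrals.

Section parametric_integrals.
Context d1 d2 (T1 : measurableType d1) (T2 : measurableType d2) {R : realType}.

(** Tonelli is applied to the positive and negative parts separately, which works whether or not the
    inner integrals are finite. *)
Lemma measurable_Rintegral_param (m2 : {sigma_finite_measure set T2 -> \bar R})
  (f : T1 -> T2 -> R) : measurable_fun setT (fun z => f z.1 z.2) ->
  measurable_fun setT (fun x => \int[m2]_y f x y).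
Proof.
move=> mf.
have mE : measurable_fun setT (fun z : T1 * T2 => (f z.1 z.2)%:E).
  exact/measurable_EFinP.
rewrite /Rintegral; apply: measurableT_comp => //.
under eq_fun do rewrite integralE.
apply: emeasurable_funB.
  rewrite (_ : (fun x => _) =
      fubini_F m2 (fun z : T1 * T2 => (f z.1 z.2)%:E)^\+%E); last first.
    by apply/funext => x; apply: eq_integral => y _; rewrite !funeposE.
  apply: measurable_fun_fubini_tonelli_F; first exact: measurable_funepos.
  by move=> z; exact: funepos_ge0.
rewrite (_ : (fun x => _) =
    fubini_F m2 (fun z : T1 * T2 => (f z.1 z.2)%:E)^\-%E); last first.
  by apply/funext => x; apply: eq_integral => y _; rewrite !funenegE.
apply: measurable_fun_fubini_tonelli_F; first exact: measurable_funeneg.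
by move=> z; exact: funeneg_ge0.
Qed.

End parametric_integrals.

Section fubini_probability.
Context d1 d2 (T1 : measurableType d1) (T2 : measurableType d2) {R : realType}.
Variables (P1 : probability T1 R) (P2 : probability T2 R).
Variables (f : T1 -> T2 -> R) (C : R).
Hypothesis mf : measurable_fun setT (fun z => f z.1 z.2).
Hypothesis if2 : forall x, L1 P2 (f x).
Hypothesis hC : forall x, \int[P2]_y `|f x y| <= C.

Let mE : measurable_fun setT (fun z : T1 * T2 => (f z.1 z.2)%:E).
Proof. exact/measurable_EFinP. Qed.

(** As [P1] has mass one, the uniform bound [hC] on the inner integrals also bounds the double
    integral. *)
Let prod_integrable :
  integrable (P1 \x P2)%E setT (fun z : T1 * T2 => (f z.1 z.2)%:E).
Proof.
apply/integrable12ltyP => //=.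
apply: (@le_lt_trans _ _ (\int[P1]_x C%:E)%E); last first.
  by rewrite integral_cst // (_ : _ setT = 1%E) ?mule1 ?ltry //; exact: (probability_setT P1).
apply: ge0_le_integral => //=.
- by move=> x _; exact: integral_ge0.
- have := measurable_fun_fubini_tonelli_F (m2 := P2) (fun z : T1 * T2 => `|(f z.1 z.2)%:E|%E) _.
  by apply; [exact: measurableT_comp|by []].
- move=> x _; have := hC x.
  rewrite -lee_fin /Rintegral fineK //.
  by apply: integrable_fin_num => //; exact: integrable_norm.
Qed.

Lemma L1_Rintegral_param : L1 P1 (fun x => \int[P2]_y f x y).
Proof.
have := integrable_fubini_F prod_integrable.
apply: eq_integrable => // x _ /=; rewrite /fubini_F /Rintegral /= fineK //.
by have := integrable_fin_num measurableT (if2 x).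
Qed.

Hypothesis if1 : forall y, L1 P1 (f^~ y).

Lemma L1_Rintegral_param2 : L1 P2 (fun y => \int[P1]_x f x y).
Proof.
have mf' : measurable_fun setT (fun z : T2 * T1 => f z.2 z.1).
  exact: (measurableT_comp mf (@measurable_swap _ _ T2 T1)).
have mG := measurable_Rintegral_param P1 (f := fun y x => f x y) mf'.
apply/integrableP; split; first exact/measurable_EFinP.
apply: le_lt_trans ((integrable21ltyP P1 P2 mE).1 prod_integrable).
apply: ge0_le_integral => //=.
- by apply/measurable_EFinP; exact: measurableT_comp.
- apply: (measurable_fun_fubini_tonelli_F (m2 := P1)
    (fun z : T2 * T1 => `|(f z.2 z.1)%:E|%E)) => //.
  by apply: measurableT_comp => //; exact/measurable_EFinP.
- move=> y _; rewrite EFin_normr_Rintegral //; apply: le_abse_integral => //.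
  exact: (measurable_int P1 (if1 y)).
Qed.

Lemma Rintegral_swap :
  \int[P1]_x \int[P2]_y f x y = \int[P2]_y \int[P1]_x f x y.
Proof.
rewrite /Rintegral; congr fine.
transitivity (\int[P1]_x \int[P2]_y (f x y)%:E)%E.
  apply: eq_integral => x _; rewrite fineK //.
  by have := integrable_fin_num measurableT (if2 x).
rewrite (Fubini prod_integrable); apply: eq_integral => y _.
by rewrite fineK //; have := integrable_fin_num measurableT (if1 y).
Qed.

End fubini_probability.

(** * The base density *)

Lemma is_derive_comp1 {R : realType} (f g : R -> R) (t df dg : R) :
  is_derive (g t) 1 f df -> is_derive t 1 g dg ->
  is_derive t 1 (fun u => f (g u)) (df * dg).
Proof. by move=> hf hg; have := is_derive1_comp hf hg; rewrite /GRing.scale /=. Qed.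

Lemma is_derive_expR {R : realType} (g : R -> R) (t dg : R) :
  is_derive t 1 g dg -> is_derive t 1 (fun u => expR (g u)) (dg * expR (g t)).
Proof.
by move=> hg; rewrite mulrC; apply: is_derive_comp1.
Qed.

Lemma is_derive_inv {R : realType} (g : R -> R) (t dg : R) :
  is_derive t 1 g dg -> g t != 0 -> is_derive t 1 (fun u => (g u)^-1) (- (g t)^-1 ^+ 2 * dg).
Proof.
move=> hg gt0; apply: (is_derive_eq (is_deriveV gt0 hg)).
by rewrite /GRing.scale /= exprVn.
Qed.

(** [expr] has no division, so the two inverse variances are variables of their own; with them the
    polynomials are stable under differentiation in the rate. *)
Inductive base_var := Bc | Brho | Ba | Bb | BS | BD.

(* [Ba] and [Bb] are the inverse variances of (Y_0 + Y_1)/sqrt 2 and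
   (Y_0 - Y_1)/sqrt 2; [BS] and [BD] the squared moduli of these variables. *)
Section base_density.
Context {R : realType}.
Implicit Types c S D : R.

Definition base_val c S D (v : base_var) : R :=
  match v with
  | Bc => c
  | Brho => expR (- c)
  | Ba => (1 + expR (- c))^-1
  | Bb => (1 - expR (- c))^-1
  | BS => S
  | BD => D
  end.

Definition base_density c S D : R :=
  (1 + expR (- c))^-1 * (1 - expR (- c))^-1 / pi ^+ 2
  * expR (- (S * (1 + expR (- c))^-1 + D * (1 - expR (- c))^-1)).

(* The derivation [c d/dc]. *)
Definition base_der (v : base_var) : expr base_var :=
  let c := EVar Bc in let r := EVar Brho in
  let a := EVar Ba in let b := EVar Bb in
  match v with
  | Bc => c
  | Brho => EOpp (EMul c r)
  | Ba => EMul (EMul a a) (EMul c r)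
  | Bb => EOpp (EMul (EMul b b) (EMul c r))
  | BS | BD => ECst 0
  end.

(** The rate is proportional to e^beta, so this logarithmic derivative along [c d/dc] is the
    beta-score of the base model. *)
Definition base_score : expr base_var :=
  let cr := EMul (EVar Bc) (EVar Brho) in
  let a := EVar Ba in let b := EVar Bb in
  EMul cr (EAdd (EAdd a (EOpp b))
    (EAdd (EOpp (EMul (EMul a a) (EVar BS))) (EMul (EMul b b) (EVar BD)))).

Definition base_ratio_expr k := iter k (wder base_der base_score) (ECst 1).

(* [(c d/dc)^k base_density / base_density] *)
Definition base_ratio k c S D := ev (base_val c S D) (base_ratio_expr k).

Lemma base_ratio0 c S D : base_ratio 0 c S D = 1. Proof. by []. Qed.

Lemma base_ratio1 c S D : base_ratio 1 c S D = ev (base_val c S D) base_score.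
Proof. by rewrite /base_ratio /=; ring. Qed.

Lemma onem_expR_gt0 c : 0 < c -> 0 < 1 - expR (- c).
Proof. by move=> c0; rewrite subr_gt0 -expR0 ltr_expR oppr_lt0. Qed.

Lemma base_density_gt0 c S D : 0 < c -> 0 < base_density c S D.
Proof.
move=> c0; have r0 := expR_gt0 (- c); have n := onem_expR_gt0 c0.
by rewrite /base_density !mulr_gt0 ?expR_gt0 ?invr_gt0 ?exprn_gt0 ?pi_gt0 ?n //
  addr_gt0.
Qed.

Section derivatives.
Variables (c : R -> R) (h t : R) (S D : R).
Hypothesis c0 : 0 < c t.
Hypothesis dc : is_derive t 1 c (h * c t).

Let dr : is_derive t 1 (fun u => expR (- c u)) (- (h * c t) * expR (- c t)).
Proof. by apply: is_derive_expR; exact: is_deriveN. Qed.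

Let da : is_derive t 1 (fun u => (1 + expR (- c u))^-1)
  ((1 + expR (- c t))^-1 ^+ 2 * (h * c t * expR (- c t))).
Proof.
have n0 : 1 + expR (- c t) != 0 by rewrite gt_eqF // addr_gt0 // expR_gt0.
apply: (is_derive_eq (is_derive_inv (is_deriveD (is_derive_cst (1 : R) _ _) dr) n0)).
by rewrite add0r; ring.
Qed.

Let db : is_derive t 1 (fun u => (1 - expR (- c u))^-1)
  (- (1 - expR (- c t))^-1 ^+ 2 * (h * c t * expR (- c t))).
Proof.
have n0 : 1 - expR (- c t) != 0 by rewrite gt_eqF // onem_expR_gt0.
apply: (is_derive_eq (is_derive_inv (is_deriveB (is_derive_cst (1 : R) _ _) dr) n0)).
by rewrite sub0r; ring.
Qed.

Lemma is_derive_base_val v : is_derive t 1 (fun u => base_val (c u) S D v)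
  (h * ev (base_val (c t) S D) (base_der v)).
Proof.
case: v => /=.
- exact: dc.
- by apply: (is_derive_eq dr); ring.
- by apply: (is_derive_eq da); ring.
- by apply: (is_derive_eq db); ring.
- by rewrite mulr0; exact: is_derive_cst.
- by rewrite mulr0; exact: is_derive_cst.
Qed.

Lemma is_derive_base_density : is_derive t 1 (fun u => base_density (c u) S D)
  (h * base_ratio 1 (c t) S D * base_density (c t) S D).
Proof.
rewrite base_ratio1.
have n1 : 1 + expR (- c t) != 0 by rewrite gt_eqF // addr_gt0 // expR_gt0.
have n2 : 1 - expR (- c t) != 0 by rewrite gt_eqF // onem_expR_gt0.
have dE := is_derive_expR (is_deriveN (is_deriveD
  (is_deriveM (is_derive_cst S _ _) da) (is_deriveM (is_derive_cst D _ _) db))).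
apply: (is_derive_eq (is_deriveM (is_deriveM (is_deriveM da db)
  (is_derive_cst (pi ^+ 2)^-1 _ _)) dE)).
rewrite /base_density /GRing.scale /= !fctE; move: (pi ^+ 2)^-1 => p.
by field; rewrite n1 n2.
Qed.

Lemma is_derive_base_ratio k : is_derive t 1 (fun u => base_ratio k (c u) S D)
  (h * (base_ratio k.+1 (c t) S D - base_ratio k (c t) S D * base_ratio 1 (c t) S D)).
Proof.
apply: (is_derive_eq (is_derive_ev is_derive_base_val _)).
rewrite base_ratio1 /base_ratio /base_ratio_expr iterS.
by move: (iter k _ _) => e /=; ring.
Qed.

End derivatives.

(** Since [expR c >= 1 + c], the inverse variance [b] blows up at rate zero no faster than [1/c],
    which the bound on the inverse clock can absorb. *)
Lemma base_inv_le c : 0 < c -> (1 - expR (- c))^-1 <= 1 + c^-1.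
Proof.
move=> c0; have n := onem_expR_gt0 c0.
rewrite -[leRHS]invrK lef_pV2 ?posrE ?n // ?invr_gt0 ?addr_gt0 ?invr_gt0 //.
have -> : (1 + c^-1)^-1 = c / (1 + c).
  by field; rewrite !gt_eqF // ?addr_gt0.
rewrite ler_pdivrMr ?addr_gt0 //.
have e1 : expR (- c) * expR c = 1 by rewrite -expRD addNr expR0.
have e2 : 1 + c <= expR c by exact: expR_ge1Dx.
have e3 : 0 < expR (- c) by exact: expR_gt0.
have e4 : expR (- c) * (1 + c) <= 1 by rewrite -[leRHS]e1 ler_pM2l.
by lra.
Qed.

(** As [rho] lies between 0 and 1, both inverse variances are at least 1/2: the decay in the
    observation is uniform in the rate, and only the prefactor [b] degenerates. *)
Lemma base_density_le c S D : 0 < c -> 0 <= S -> 0 <= D ->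
  base_density c S D <= (1 + c^-1) * expR (- ((S + D) / 2)).
Proof.
move=> c0 S0 D0; have e3 := expR_gt0 (- c); have n := onem_expR_gt0 c0.
have a1 : (1 + expR (- c))^-1 <= 1 by rewrite invf_le1 ?lerDl ?ltW ?addr_gt0.
have pi1 : (pi ^+ 2)^-1 <= 1 :> R.
  rewrite invf_le1 ?exprn_gt0 ?pi_gt0 // exprn_ege1 //.
  by rewrite (le_trans _ (pi_ge2 R)) // ler1n.
set a := (1 + _)^-1 in a1 *; pose b := (1 - expR (- c))^-1.
have a0 : 0 <= a by rewrite invr_ge0 ltW // addr_gt0.
have b0 : 0 <= b by rewrite invr_ge0 ltW.
have p0 : 0 <= (pi ^+ 2)^-1 :> R by rewrite invr_ge0 exprn_ge0 // ltW // pi_gt0.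
have bc : b <= 1 + c^-1 by exact: base_inv_le.
have c1 : 0 <= 1 + c^-1 by rewrite (le_trans b0).
rewrite /base_density -/a -/b ler_pM ?mulr_ge0 ?expR_ge0 //.
  rewrite -[leRHS]mulr1 ler_pM ?mulr_ge0 //.
  by rewrite -[leRHS]mul1r ler_pM.
rewrite ler_expR lerN2 mulrDl lerD // ler_wpM2l //.
  rewrite lef_pV2 ?posrE ?addr_gt0 //.
  by rewrite -[leRHS]/(1 + 1) lerD2l -expR0 ler_expR oppr_le0 ltW.
by rewrite lef_pV2 ?posrE //; lra.
Qed.

End base_density.

(** * Exponential averages of a process *)

Section exponential_averages.
Context dS dO (S : measurableType dS) (Omega : measurableType dO) {R : realType}.
Variables (U : probability S R) (P : probability Omega R) (z : S -> Omega -> R).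
Hypothesis mz : measurable_fun setT (fun p : S * Omega => z p.1 p.2).
Hypothesis bz : forall w, exists K : R, forall s, `|z s w| <= K.
Hypothesis ez : forall n : nat, exists C : R, forall s,
  L1 P (fun w => expR (n%:R * `|z s w|)) /\
  \int[P]_w expR (n%:R * `|z s w|) <= C.

Implicit Types (l : R) (w : Omega) (s : S) (n k : nat).

Lemma measurable_z_path w : measurable_fun setT (fun s => z s w).
Proof. exact: (measurable_fun_pair1 w mz). Qed.

Lemma measurable_z_time s : measurable_fun setT (fun w => z s w).
Proof. exact: (measurable_fun_pair2 s mz). Qed.

Definition exp_path l s w : R := expR (l * z s w - l ^+ 2 / 2).

(** For [U] uniform on the sampling interval, [exp_moment 0 l] is the exponential of the log-clock;
    powers of [z] arise because d/dl brings down [z - l]. *)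
Definition exp_moment (k : nat) l w : R :=
  \int[U]_s (z s w ^+ k * exp_path l s w).

(** A time average rather than a supremum of the path, so that its expectation involves exponential
    moments at single times only. *)
Definition exp_abs (n : nat) w : R := \int[U]_s expR (n%:R * `|z s w|).

Let var (l : R) (w : Omega) (s : S) (v : bool) : R := if v then z s w else l.

Let dvar (v : bool) : expr bool := ECst (~~ v).

Let kpath : expr bool := EAdd (EVar true) (EOpp (EVar false)).

Let zpow k : expr bool := iter k (EMul (EVar true)) (ECst 1).

Let ev_zpow k l w s : ev (var l w s) (zpow k) = z s w ^+ k.
Proof. by elim: k => //= k ->; rewrite exprS. Qed.

Let ev_wder_zpow k l w s :
  ev (var l w s) (wder dvar kpath (zpow k)) = z s w ^+ k.+1 - l * z s w ^+ k.
Proof.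
have -> : ev (var l w s) (wder dvar kpath (zpow k)) =
    ev (var l w s) (der dvar (zpow k)) + (z s w - l) * ev (var l w s) (zpow k).
  by [].
have -> : ev (var l w s) (der dvar (zpow k)) = 0.
  by elim: k => //= k ->; rewrite mulr0 mul0r addr0.
by rewrite ev_zpow exprS; ring.
Qed.

Lemma measurable_exp_path l w : measurable_fun setT (fun s => exp_path l s w).
Proof.
apply: measurableT_comp => //; apply: measurable_funB => //.
by apply: measurable_funM => //; exact: measurable_z_path.
Qed.

Let exp_path_le l s w : `|l| <= 1 -> exp_path l s w <= expR (`|z s w|).
Proof.
move=> l1; rewrite ler_expR lerBlDr (le_trans (ler_norm _)) // normrM.
by rewrite (le_trans (ler_wpM2r _ l1)) // mul1r lerDl divr_ge0 // sqr_ge0.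
Qed.

(** For a fixed path [z] is bounded, so the powers of one constant form the scale and the dominating
    function is constant. *)
Let dom_path w e : exists2 G : S -> R, L1 U G & forall l s,
  `]-1, 1[%classic l -> `|ev (var l w s) e * exp_path l s w| <= G s.
Proof.
have [K hK] := bz w; pose K1 := Num.max 1 K.
have K1_ge1 : 1 <= K1 by rewrite le_max lexx.
have gs : @growth_scale R (R * S)%type
    [set p | p.1 \in `]-1, 1[] (fun n _ => K1 ^+ n).
  split=> [n i _|m n i _ mn|n].
  - exact: exprn_ege1.
  - exact: ler_weXn2l.
  - by exists (n * 2)%N => i _; rewrite exprM.
have bv v : scale_bounded [set p : R * S | p.1 \in `]-1, 1[]
    (fun n _ => K1 ^+ n) (fun p => var p.1 w p.2 v).
  exists 1, 1%N; split=> // -[l s] /=; rewrite in_itv /= => /andP[l1 l2].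
  rewrite mul1r expr1; case: v => /=.
    by rewrite (le_trans (hK s)) // le_max lexx orbT.
  by rewrite (le_trans _ K1_ge1) // ler_norml !ltW.
have [C [N [C0 hC]]] := scale_bounded_ev gs bv e.
exists (fun=> C * K1 ^+ N * expR K); first exact: L1_cst.
move=> l s l1; rewrite normrM ler_pM //; first exact: (hC (l, s)).
rewrite gtr0_norm ?expR_gt0 // (le_trans (exp_path_le _ _ _)) ?ler_expR //.
by move: l1; rewrite /= in_itv /= => /andP[? ?]; rewrite ler_norml !ltW.
Qed.

Let path_var_derive w l s : `]-1, 1[%classic l -> forall v,
  is_derive l 1 (fun t => var t w s v) (ev (var l w s) (dvar v)).
Proof. by move=> _ [] /=; [exact: is_derive_cst|exact: is_derive_id]. Qed.

Let exp_path_derive w l s : `]-1, 1[%classic l ->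
  is_derive l 1 (fun t => exp_path t s w) (ev (var l w s) kpath * exp_path l s w).
Proof.
move=> _; have dX := is_deriveM (is_derive_id l (1 : R)) (is_derive_id l (1 : R)).
have := is_derive_expR (is_deriveB
  (is_deriveM (is_derive_id l (1 : R)) (is_derive_cst (z s w) _ _))
  (is_deriveM dX (is_derive_cst (2^-1 : R) _ _))).
move=> h; apply: (is_derive_eq h).
by rewrite /exp_path /GRing.scale /= !fctE /=; field.
Qed.

Let measurable_path_var w l v : `]-1, 1[%classic l ->
  measurable_fun setT (fun s => var l w s v).
Proof. by move=> _; case: v => //=; exact: measurable_z_path. Qed.

Let measurable_exp_path' w l : `]-1, 1[%classic l ->
  measurable_fun setT (fun s => exp_path l s w).
Proof. by move=> _; exact: measurable_exp_path. Qed.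

Lemma L1_exp_moment k l w : -1 < l < 1 ->
  L1 U (fun s => z s w ^+ k * exp_path l s w).
Proof.
move=> l1; have Il : `]-1, 1[%classic l by rewrite /= in_itv.
have := integrable_ev_weighted (@measurable_path_var w) (@measurable_exp_path' w)
  (@dom_path w) (zpow k) Il.
by apply: eq_integrable => // s _ /=; rewrite ev_zpow.
Qed.

Lemma is_derive_exp_moment k l w : -1 < l < 1 ->
  is_derive l 1 (fun t => exp_moment k t w)
    (exp_moment k.+1 l w - l * exp_moment k l w).
Proof.
move=> l1; have Il : `]-1, 1[%classic l by rewrite /= in_itv.
have := is_derive_integral (@path_var_derive w) (@exp_path_derive w)
  (@measurable_path_var w) (@measurable_exp_path' w) (@dom_path w) (zpow k) Il.
rewrite (_ : (fun t => _) = (fun t => exp_moment k t w)); last first.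
  by apply/funext => t; apply: eq_Rintegral => s _; rewrite ev_zpow.
move=> h; apply: (is_derive_eq h).
rewrite /exp_moment -RintegralZl //; last exact: L1_exp_moment.
rewrite -RintegralB //; last 2 first.
- exact: L1_exp_moment.
- by apply: L1Z; exact: L1_exp_moment.
by apply: eq_Rintegral => s _; rewrite ev_wder_zpow; ring.
Qed.

Lemma measurable_exp_moment k l : measurable_fun setT (exp_moment k l).
Proof.
apply: (measurable_Rintegral_param U
  (f := fun w s => z s w ^+ k * exp_path l s w)).
have mz' : measurable_fun setT (fun p : Omega * S => z p.2 p.1).
  exact: (measurableT_comp mz (@measurable_swap _ _ Omega S)).
apply: measurable_funM; first exact: measurable_funX.
apply: measurableT_comp => //; apply: measurable_funB => //.
exact: measurable_funM.
Qed.

Lemma measurable_exp_abs n : measurable_fun setT (exp_abs n).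
Proof.
apply: (measurable_Rintegral_param U
  (f := fun w s => expR (n%:R * `|z s w|))).
have mz' : measurable_fun setT (fun p : Omega * S => z p.2 p.1).
  exact: (measurableT_comp mz (@measurable_swap _ _ Omega S)).
apply: measurableT_comp => //; apply: measurable_funM => //.
exact: measurableT_comp.
Qed.

Lemma L1_exp_abs_path n w : L1 U (fun s => expR (n%:R * `|z s w|)).
Proof.
have [K hK] := bz w; apply: (@L1_bounded _ _ _ _ _ (expR (n%:R * K))).
  apply: measurableT_comp => //; apply: measurable_funM => //.
  by apply: measurableT_comp => //; exact: measurable_z_path.
by move=> s; rewrite gtr0_norm ?expR_gt0 // ler_expR ler_wpM2l.
Qed.

Lemma exp_abs_ge1 n w : 1 <= exp_abs n w.
Proof.
rewrite -[leLHS](Rintegral_prob_cst U) le_Rintegral //.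
- exact: L1_cst.
- exact: L1_exp_abs_path.
- by move=> s _; rewrite -expR0 ler_expR mulr_ge0.
Qed.

Lemma exp_abs_mono m n w : (m <= n)%N -> exp_abs m w <= exp_abs n w.
Proof.
move=> mn; apply: le_Rintegral => //; try exact: L1_exp_abs_path.
by move=> s _; rewrite ler_expR ler_wpM2r // ler_nat.
Qed.

(** Jensen's inequality; this is the squaring condition of [growth_scale], with the index
    doubled. *)
Lemma exp_abs_sqr n w : exp_abs n w ^+ 2 <= exp_abs (n * 2) w.
Proof.
have E : (fun s => expR (n%:R * `|z s w|) ^+ 2) =
    (fun s => expR ((n * 2)%:R * `|z s w|)).
  by apply/funext => s; rewrite expr2 -expRD -mulr2n natrM -mulrAC mulr_natr.
rewrite /exp_abs -E; apply: sqr_mean_le; first exact: L1_exp_abs_path.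
by rewrite E; exact: L1_exp_abs_path.
Qed.

Lemma exp_moment0_gt0 l w : -1 < l < 1 -> 0 < exp_moment 0 l w.
Proof.
move=> l1; apply: Rintegral_gt0; first exact: L1_exp_moment.
  by move=> s; rewrite mul1r expR_gt0.
by rewrite (_ : _ setT = 1%E) ?onee_neq0 //; exact: (probability_setT U).
Qed.

(** [|z|^k] is at most [exp (k |z|)], and for [|l| <= 1] the weight costs one more such factor,
    whence the index [k.+1]. *)
Lemma exp_moment_le k l w : -1 < l < 1 ->
  `|exp_moment k l w| <= exp_abs k.+1 w.
Proof.
move=> l1; have l1' : `|l| <= 1.
  by move: l1 => /andP[? ?]; rewrite ler_norml !ltW.
rewrite (le_trans (le_normr_Rintegral _ _)) //; first exact: L1_exp_moment.
apply: le_Rintegral => //; first by apply: integrable_norm; exact: L1_exp_moment.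
  exact: L1_exp_abs_path.
move=> s _; rewrite normrM normrX (ger0_norm (expR_ge0 _)).
have -> : expR (k.+1%:R * `|z s w|) = expR `|z s w| ^+ k * expR `|z s w|.
  by rewrite expRM_natl exprSr.
rewrite ler_pM ?expR_ge0 ?exprn_ge0 //.
  rewrite lerXn2r ?nnegrE ?expR_ge0 //.
  by rewrite (le_trans _ (expR_ge1Dx _)) // lerDr.
exact: exp_path_le.
Qed.

(* Cauchy-Schwarz: [1 <= (mean of exp) * (mean of exp^-1)]. *)
Lemma exp_moment0_inv_le l w : -1 < l < 1 ->
  (exp_moment 0 l w)^-1 <= expR 1 * exp_abs 1 w.
Proof.
move=> l1; have l1' : `|l| <= 1.
  by move: l1 => /andP[? ?]; rewrite ler_norml !ltW.
have m0 := exp_moment0_gt0 w l1.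
pose h s := (exp_path l s w)^-1.
have hE s : h s * exp_path l s w = 1 by rewrite mulVf // gt_eqF // expR_gt0.
have E0 : (fun s => z s w ^+ 0 * exp_path l s w) = (fun s => exp_path l s w).
  by apply/funext => s; rewrite mul1r.
have iE : L1 U (fun s => exp_path l s w) by rewrite -E0; exact: L1_exp_moment.
have h2E : (fun s => h s ^+ 2 * exp_path l s w) = h.
  by apply/funext => s; rewrite expr2 -mulrA hE mulr1.
have hle s : `|h s| <= expR 1 * expR (1%:R * `|z s w|).
  rewrite /h /exp_path -expRN ger0_norm ?expR_ge0 // -expRD ler_expR mul1r opprB.
  rewrite lerD //.
    rewrite ler_pdivrMr // mul1r (le_trans _ (ler1n _ 2)) //.
    by rewrite -real_normK ?num_real // exprn_ile1.
  by rewrite (le_trans (ler_norm _)) // normrN normrM ler_piMl.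
have ih : L1 U h.
  apply: (L1_le _ hle); last by apply: L1Z; exact: L1_exp_abs_path.
  have -> : h = (fun s => expR (- (l * z s w - l ^+ 2 / 2))).
    by apply/funext => s; rewrite expRN.
  apply: measurableT_comp => //; apply: measurableT_comp => //.
  apply: measurable_funB => //.
  by apply: measurable_funM => //; exact: measurable_z_path.
have := @weighted_sqr_le _ _ _ U h (fun s => exp_path l s w) _ iE.
have hE' : (fun s => h s * exp_path l s w) = (fun=> 1) by apply/funext.
have -> : \int[U]_s exp_path l s w = exp_moment 0 l w.
  by rewrite /exp_moment E0.
rewrite hE' h2E Rintegral_prob_cst expr1n m0 => /(_ _ (L1_cst _ _) ih isT) H.
have {}H : 1 <= \int[U]_x h x * exp_moment 0 l w.
  by apply: H => s; exact: expR_ge0.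
rewrite -[leLHS]mul1r ler_pdivrMr // (le_trans H) // ler_wpM2r ?(ltW m0) //.
rewrite -RintegralZl //; last exact: L1_exp_abs_path.
apply: le_Rintegral => //; first by apply: L1Z; exact: L1_exp_abs_path.
by move=> s _; rewrite (le_trans (ler_norm _)).
Qed.

Lemma L1_exp_abs n : L1 P (exp_abs n).
Proof.
have [C hC] := ez n.
apply: (@L1_Rintegral_param2 _ _ _ _ _ U P (fun s w => expR (n%:R * `|z s w|)) C).
- apply: measurableT_comp => //; apply: measurable_funM => //.
  exact: measurableT_comp.
- by move=> s; case: (hC s).
- move=> s; case: (hC s) => _; apply: le_trans; rewrite le_eqVlt; apply/orP; left.
  by apply/eqP; apply: eq_Rintegral => w _; rewrite ger0_norm // expR_ge0.
- by move=> w; exact: L1_exp_abs_path.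
Qed.

End exponential_averages.

(** * Mixtures over the clock *)

(** Inversion agrees with the real power -1 on nonnegative numbers, zero included, and real powers
    are measurable. *)
Lemma measurable_funV_ge0 d (T : measurableType d) (R : realType) (f : T -> R) :
  measurable_fun setT f -> (forall x, 0 <= f x) ->
  measurable_fun setT (fun x => (f x)^-1).
Proof.
move=> mf f0; have -> : (fun x => (f x)^-1) = (fun x => f x `^ (-1)).
  by apply/funext => x; rewrite powR_inv1.
exact: (measurableT_comp (measurable_powR (-1)) mf).
Qed.

Lemma measurable_base_val d (T : measurableType d) (R : realType)
    (c S D : T -> R) (v : base_var) :
  measurable_fun setT c -> measurable_fun setT S -> measurable_fun setT D ->
  (forall x, 0 < c x) ->
  measurable_fun setT (fun x => base_val (c x) (S x) (D x) v).
Proof.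
move=> mc mS mD c0.
have mr : measurable_fun setT (fun x => expR (- c x)).
  by apply: measurableT_comp => //; exact: measurableT_comp.
case: v => //=.
- apply: measurable_funV_ge0; first exact: measurable_funD.
  by move=> x; rewrite addr_ge0 // expR_ge0.
- apply: measurable_funV_ge0; first exact: measurable_funB.
  by move=> x; rewrite ltW // onem_expR_gt0.
Qed.

Lemma measurable_base_density d (T : measurableType d) (R : realType)
    (c S D : T -> R) :
  measurable_fun setT c -> measurable_fun setT S -> measurable_fun setT D ->
  (forall x, 0 < c x) ->
  measurable_fun setT (fun x => base_density (c x) (S x) (D x)).
Proof.
move=> mc mS mD c0.
have mv v := measurable_base_val v mc mS mD c0.
apply: measurable_funM.
  by apply: measurable_funM => //; apply: measurable_funM; [exact: mv Ba|exact: mv Bb].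
apply: measurableT_comp => //; apply: measurableT_comp => //.
apply: measurable_funD; apply: measurable_funM => //.
  exact: mv Ba.
exact: mv Bb.
Qed.

(** [Tphi k] stands for the k-th beta-derivative of the base density over that density, at the rate
    modified by the clock; [Tinv] is the inverse clock and [Tm k] a weighted moment of the path.
    Polynomials in these are closed under both derivations. *)
Inductive mix_var := Tphi of nat | Tlam | Tinv | Tm of nat.

(* [mix_shift] is the lambda-derivative of the log-clock. *)
Definition mix_shift : expr mix_var :=
  EMul (EAdd (EVar (Tm 1)) (EOpp (EMul (EVar Tlam) (EVar (Tm 0))))) (EVar Tinv).

Definition mix_der_beta (v : mix_var) : expr mix_var :=
  match v with
  | Tphi k => EAdd (EVar (Tphi k.+1)) (EOpp (EMul (EVar (Tphi k)) (EVar (Tphi 1))))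
  | _ => ECst 0
  end.

Definition mix_der_lambda (v : mix_var) : expr mix_var :=
  match v with
  | Tphi k => EMul (mix_der_beta (Tphi k)) mix_shift
  | Tlam => ECst 1
  | Tinv => EOpp (EMul (EVar Tinv) mix_shift)
  | Tm k => EAdd (EVar (Tm k.+1)) (EOpp (EMul (EVar Tlam) (EVar (Tm k))))
  end.

Definition mix_score_beta : expr mix_var := EVar (Tphi 1).

Definition mix_score_lambda : expr mix_var := EMul (EVar (Tphi 1)) mix_shift.

Section mixture_expansion.
Context {R : realType}.
Implicit Types (x : mix_var -> R) (l : seq (expr mix_var)).

(** The coefficients produced by lambda-derivatives involve the clock alone and not beta; a
    beta-derivative then only shifts the index of [Tphi]. *)
Fixpoint phi_free (e : expr mix_var) : bool :=
  match e with
  | ECst _ => true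
  | EVar v => if v is Tphi _ then false else true
  | EOpp e1 => phi_free e1
  | EAdd e1 e2 | EMul e1 e2 => phi_free e1 && phi_free e2
  end.

Lemma phi_free_der_beta e x : phi_free e -> ev x (der mix_der_beta e) = 0.
Proof.
elim: e => //= [v|e IH|e1 IH1 e2 IH2|e1 IH1 e2 IH2].
- by case: v.
- by move=> /IH ->; rewrite oppr0.
- by move=> /andP[/IH1 -> /IH2 ->]; rewrite addr0.
- by move=> /andP[/IH1 -> /IH2 ->]; rewrite mul0r mulr0 addr0.
Qed.

Lemma phi_free_der_lambda e : phi_free e -> phi_free (der mix_der_lambda e).
Proof.
elim: e => //= [v|e1 IH1 e2 IH2|e1 IH1 e2 IH2].
- by case: v.
- by move=> /andP[/IH1 -> /IH2 ->].
- by move=> /andP[h1 h2]; rewrite h1 h2 IH1 // IH2.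
Qed.

Fixpoint add_coefs l1 l2 :=
  match l1, l2 with
  | [::], _ => l2
  | _, [::] => l1
  | e1 :: l1', e2 :: l2' => EAdd e1 e2 :: add_coefs l1' l2'
  end.

(** Differentiating c_k f^(k)(beta + delta) leaves c_k' in place k and adds delta' c_k in place k +
    1: the recursion of the Bell polynomials in the derivatives of the log-clock. *)
Definition next_coefs l :=
  add_coefs (map (der mix_der_lambda) l) (ECst 0 :: map (EMul mix_shift) l).

(* The b-th lambda-derivative of [f (beta + log-clock)] is the sum over k of the
   k-th entry of [coefs b] times the k-th derivative of [f]. *)
Definition coefs b := iter b next_coefs [:: ECst 1].

Fixpoint phi_comb a l : expr mix_var :=
  if l is e :: l' then EAdd (EMul (EVar (Tphi a)) e) (phi_comb a.+1 l')
  else ECst 0.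

Definition mix_expr a b := phi_comb a (coefs b).

Lemma ev_phi_comb x a l : ev x (phi_comb a l) =
  \sum_(k < size l) x (Tphi (a + k)) * ev x (nth (ECst 0) l k).
Proof.
elim: l a => [|e l IH] a /=; first by rewrite big_ord0.
rewrite big_ord_recl /= addn0 IH; congr (_ + _).
by apply: eq_bigr => k _; rewrite /bump /= addSnnS.
Qed.

Lemma phi_free_add_coefs l1 l2 : all phi_free l1 -> all phi_free l2 ->
  all phi_free (add_coefs l1 l2).
Proof.
elim: l1 l2 => [|e1 l1 IH] [|e2 l2] //= /andP[-> h1] /andP[-> h2] /=.
exact: IH.
Qed.

Lemma phi_free_next_coefs l : all phi_free l -> all phi_free (next_coefs l).
Proof.
move=> h; apply: phi_free_add_coefs.
  by rewrite all_map; apply: sub_all h => e; exact: phi_free_der_lambda.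
by rewrite /= all_map; apply: sub_all h => e /=.
Qed.

Lemma phi_free_coefs b : all phi_free (coefs b).
Proof. by elim: b => //= b IH; exact: phi_free_next_coefs. Qed.

Lemma phi_comb_add x a l1 l2 : ev x (phi_comb a (add_coefs l1 l2)) =
  ev x (phi_comb a l1) + ev x (phi_comb a l2).
Proof.
elim: l1 l2 a => [|e1 l1 IH] [|e2 l2] a //=; rewrite ?add0r ?addr0 //.
by rewrite IH; ring.
Qed.

Lemma wder_beta_phi_comb x a l : all phi_free l ->
  ev x (wder mix_der_beta mix_score_beta (phi_comb a l)) = ev x (phi_comb a.+1 l).
Proof.
elim: l a => [|e l IH] a /=; first by rewrite mulr0 addr0.
move=> /andP[he hl]; rewrite -(IH a.+1 hl) /= (phi_free_der_beta _ he); ring.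
Qed.

Lemma wder_lambda_phi_comb x a l :
  ev x (wder mix_der_lambda mix_score_lambda (phi_comb a l)) =
  ev x (phi_comb a (next_coefs l)).
Proof.
rewrite /next_coefs phi_comb_add [X in _ + X]/=.
elim: l a => [|e l IH] a; first by rewrite /=; ring.
have := IH a.+1; rewrite /= => H.
transitivity (x (Tphi a) * ev x (der mix_der_lambda e) + x (Tphi a.+1) *
  (ev x mix_shift * ev x e) + (ev x (der mix_der_lambda (phi_comb a.+1 l)) +
  x (Tphi 1) * ev x mix_shift * ev x (phi_comb a.+1 l))); first by rewrite /=; ring.
by rewrite H /=; ring.
Qed.

Lemma wder_beta_mix_expr x a b :
  ev x (wder mix_der_beta mix_score_beta (mix_expr a b)) = ev x (mix_expr a.+1 b).
Proof. exact/wder_beta_phi_comb/phi_free_coefs. Qed.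

Lemma wder_lambda_mix_expr x a b :
  ev x (wder mix_der_lambda mix_score_lambda (mix_expr a b)) =
  ev x (mix_expr a b.+1).
Proof. exact: wder_lambda_phi_comb. Qed.

End mixture_expansion.

Section mixture.
Context dS dO (S : measurableType dS) (Omega : measurableType dO) {R : realType}.
Variables (U : probability S R) (P : probability Omega R) (z : S -> Omega -> R).
Hypothesis mz : measurable_fun setT (fun p : S * Omega => z p.1 p.2).
Hypothesis bz : forall w, exists K : R, forall s, `|z s w| <= K.
Hypothesis ez : forall n : nat, exists C : R, forall s,
  L1 P (fun w => expR (n%:R * `|z s w|)) /\
  \int[P]_w expR (n%:R * `|z s w|) <= C.
Variables (kap b0 : R).
Hypothesis kap0 : 0 < kap.
Implicit Types (b l : R) (w : Omega) (s d : R) (n k : nat).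

Local Notation m := (exp_moment U z).
Local Notation W := (exp_abs U z).

Let m0_gt0 := @exp_moment0_gt0 _ _ _ _ _ U z mz bz.
Let dm := @is_derive_exp_moment _ _ _ _ _ U z mz bz.
Let W1 := @exp_abs_ge1 _ _ _ _ _ U z mz bz.
Let Wmono := @exp_abs_mono _ _ _ _ _ U z mz bz.
Let Wsqr := @exp_abs_sqr _ _ _ _ _ U z mz bz.
Let mle := @exp_moment_le _ _ _ _ _ U z mz bz.
Let minv := @exp_moment0_inv_le _ _ _ _ _ U z mz bz.

Definition mix_rate b l w : R := expR b * kap * m 0 l w.

Definition mix_val b l s d w (v : mix_var) : R :=
  match v with
  | Tphi k => base_ratio k (mix_rate b l w) s d
  | Tlam => l
  | Tinv => (m 0 l w)^-1
  | Tm k => m k l w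
  end.

Definition mix_kernel b l s d w : R := base_density (mix_rate b l w) s d.

Definition mix_pdf i j b l s d : R :=
  \int[P]_w (ev (mix_val b l s d w) (mix_expr i j) * mix_kernel b l s d w).

Definition param_box b l : bool := (`|b - b0| < 1) && (`|l| < 1).

Let box_l b l : param_box b l -> -1 < l < 1.
Proof. by move=> /andP[_]; rewrite ltr_norml. Qed.

Lemma mix_rate_gt0 b l w : -1 < l < 1 -> 0 < mix_rate b l w.
Proof. by move=> l1; rewrite !mulr_gt0 ?expR_gt0 ?m0_gt0. Qed.

Lemma mix_kernel_gt0 b l s d w : -1 < l < 1 -> 0 < mix_kernel b l s d w.
Proof. by move=> l1; apply/base_density_gt0/mix_rate_gt0. Qed.

Lemma is_derive_mix_rate_beta b l w :
  is_derive b 1 (fun u => mix_rate u l w) (1 * mix_rate b l w).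
Proof.
apply: (is_derive_eq (is_deriveM (is_deriveM (is_derive_expR (is_derive_id b (1 : R)))
  (is_derive_cst (kap : R) _ _)) (is_derive_cst (m 0 l w) _ _))).
by rewrite /mix_rate /GRing.scale /= ?fctE; ring.
Qed.

Lemma is_derive_mix_rate_lambda b l s d w : -1 < l < 1 ->
  is_derive l 1 (fun u => mix_rate b u w)
    (ev (mix_val b l s d w) mix_shift * mix_rate b l w).
Proof.
move=> l1; have m0 := m0_gt0 w l1.
apply: (is_derive_eq (is_deriveM (is_derive_cst (expR b * kap) _ _)
  (dm 0 w l1))).
rewrite /mix_rate /GRing.scale /= ?fctE; field.
by rewrite gt_eqF.
Qed.

Lemma is_derive_mix_val_beta b l s d w : -1 < l < 1 -> forall v,
  is_derive b 1 (fun u => mix_val u l s d w v)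
    (ev (mix_val b l s d w) (mix_der_beta v)).
Proof.
move=> l1 [k| | |k] /=; try exact: is_derive_cst.
have := @is_derive_base_ratio R (fun u => mix_rate u l w) 1 b s d
  (mix_rate_gt0 b w l1) (is_derive_mix_rate_beta b l w) k.
by rewrite mul1r.
Qed.

Lemma is_derive_mix_kernel_beta b l s d w : -1 < l < 1 ->
  is_derive b 1 (fun u => mix_kernel u l s d w)
    (ev (mix_val b l s d w) mix_score_beta * mix_kernel b l s d w).
Proof.
move=> l1; have := @is_derive_base_density R (fun u => mix_rate u l w) 1 b s d
  (mix_rate_gt0 b w l1) (is_derive_mix_rate_beta b l w).
by rewrite mul1r.
Qed.

Lemma is_derive_mix_val_lambda b l s d w : -1 < l < 1 -> forall v,
  is_derive l 1 (fun u => mix_val b u s d w v)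
    (ev (mix_val b l s d w) (mix_der_lambda v)).
Proof.
move=> l1; have m0 := m0_gt0 w l1; case=> [k| | |k].
- apply: (is_derive_eq (@is_derive_base_ratio R (fun u => mix_rate b u w) _ l s d
    (mix_rate_gt0 b w l1) (is_derive_mix_rate_lambda b s d w l1) k)).
  by rewrite /=; ring.
- exact: is_derive_id.
- apply: (is_derive_eq (is_derive_inv (dm 0 w l1) _)).
    by rewrite gt_eqF.
  by rewrite /=; ring.
- exact: dm.
Qed.

Lemma is_derive_mix_kernel_lambda b l s d w : -1 < l < 1 ->
  is_derive l 1 (fun u => mix_kernel b u s d w)
    (ev (mix_val b l s d w) mix_score_lambda * mix_kernel b l s d w).
Proof.
move=> l1; apply: (is_derive_eq (@is_derive_base_density R
  (fun u => mix_rate b u w) _ l s d (mix_rate_gt0 b w l1)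
  (is_derive_mix_rate_lambda b s d w l1))).
by rewrite /mix_kernel /=; ring.
Qed.

(** Growth in the observation times growth in the path; each factor satisfies the squaring condition
    with the index doubled. *)
Definition mix_scale n s d w : R := (1 + s + d) ^+ n * W n w.

Let index : Type := (R * R * R * R * Omega)%type.

Let mix_box : set index := [set i |
  [/\ param_box i.1.1.1.1 i.1.1.1.2, 0 <= i.1.1.2 & 0 <= i.1.2]].

Let scale (n : nat) (i : index) := mix_scale n i.1.1.2 i.1.2 i.2.

Let W_ge0 n w : 0 <= W n w.
Proof. by rewrite (le_trans ler01) // W1. Qed.

Lemma mix_scale_ge1 n s d w : 0 <= s -> 0 <= d -> 1 <= mix_scale n s d w.
Proof.
move=> s0 d0; rewrite -[leLHS]mulr1 ler_pM // ?W1 //.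
by rewrite exprn_ege1 // -addrA lerDl addr_ge0.
Qed.

Lemma mix_scale_mono n1 n2 s d w : 0 <= s -> 0 <= d -> (n1 <= n2)%N ->
  mix_scale n1 s d w <= mix_scale n2 s d w.
Proof.
move=> s0 d0 n12; rewrite ler_pM ?exprn_ge0 ?addr_ge0 ?W_ge0 //.
  by rewrite ler_weXn2l // -addrA lerDl addr_ge0.
exact: Wmono.
Qed.

Lemma mix_scale_sqr n s d w : 0 <= s -> 0 <= d ->
  mix_scale n s d w ^+ 2 <= mix_scale (n * 2) s d w.
Proof.
move=> s0 d0; rewrite exprMn ler_pM ?exprn_ge0 ?addr_ge0 ?W_ge0 ?sqr_ge0 //.
by rewrite exprM.
Qed.

Let scale_growth : growth_scale mix_box scale.
Proof.
split=> [n i [_ s0 d0]|n1 n2 i [_ s0 d0]|n].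
- exact: mix_scale_ge1.
- exact: mix_scale_mono.
- by exists (n * 2)%N => i [_ s0 d0]; exact: mix_scale_sqr.
Qed.

Let scale_boundedW (f : index -> R) C N : 0 <= C ->
  (forall i, mix_box i -> `|f i| <= C * W N i.2) -> scale_bounded mix_box scale f.
Proof.
move=> C0 hf; exists C, N; split=> // i Bi; rewrite (le_trans (hf _ Bi)) //.
case: Bi => _ s0 d0; rewrite ler_wpM2l // -[leLHS]mul1r ler_wpM2r //.
by rewrite exprn_ege1 // -addrA lerDl addr_ge0.
Qed.

Let rate_le b l w : param_box b l -> mix_rate b l w <= expR (b0 + 1) * kap * W 1 w.
Proof.
move=> bx; have l1 := box_l bx; case/andP: bx; rewrite ltr_distl => /andP[_ hb] _.
rewrite ler_pM ?mulr_ge0 ?expR_ge0 ?(ltW kap0) ?(ltW (m0_gt0 _ l1)) //.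
  by rewrite ler_wpM2r ?(ltW kap0) // ler_expR ltW.
by rewrite (le_trans (ler_norm _)) // exp_moment_le.
Qed.

Let rate_inv_le b l w : param_box b l ->
  1 + (mix_rate b l w)^-1 <= (1 + (expR (b0 - 1) * kap)^-1 * expR 1) * W 1 w.
Proof.
move=> bx; have l1 := box_l bx; case/andP: bx; rewrite ltr_distl => /andP[hb _] _.
rewrite mulrDl lerD // ?mul1r ?W1 // invfM -mulrA.
rewrite ler_pM ?invr_ge0 ?mulr_ge0 ?expR_ge0 ?(ltW kap0) //.
- by rewrite (ltW (m0_gt0 _ l1)).
- by rewrite lef_pV2 ?posrE ?mulr_gt0 ?expR_gt0 // ler_wpM2r ?(ltW kap0) // ler_expR ltW.
- exact: minv.
Qed.

(** Only [Bb] is singular as the rate tends to 0; [rate_inv_le] trades this singularity for an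
    exponential average of the path. *)
Let base_val_bounded v : scale_bounded mix_box scale
  (fun i => base_val (mix_rate i.1.1.1.1 i.1.1.1.2 i.2) i.1.1.2 i.1.2 v).
Proof.
have C1 : 0 <= 1 + (expR (b0 - 1) * kap)^-1 * expR 1.
  by rewrite addr_ge0 ?mulr_ge0 ?invr_ge0 ?mulr_ge0 ?expR_ge0 ?(ltW kap0).
have cst1 (f : index -> R) : (forall i, mix_box i -> `|f i| <= 1) ->
    scale_bounded mix_box scale f.
  move=> hf; apply: (@scale_boundedW _ 1 0%N) => // i Bi.
  by rewrite mul1r (le_trans (hf _ Bi)) // W1.
case: v => /=.
- apply: (@scale_boundedW _ (expR (b0 + 1) * kap) 1%N).
    by rewrite mulr_ge0 ?expR_ge0 ?ltW.
  move=> -[[[[b l] s] d] w] /= [/= bx _ _]; have l1 := box_l bx.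
  by rewrite gtr0_norm ?rate_le // mix_rate_gt0.
- apply: cst1 => -[[[[b l] s] d] w] /= [/= bx _ _]; have l1 := box_l bx.
  rewrite gtr0_norm ?expR_gt0 // -expR0 ler_expR oppr_le0 ltW //.
  exact/mix_rate_gt0.
- apply: cst1 => -[[[[b l] s] d] w] /= [/= bx _ _]; have l1 := box_l bx.
  rewrite normfV gtr0_norm ?addr_gt0 ?expR_gt0 //.
  by rewrite invf_le1 ?addr_gt0 ?expR_gt0 // lerDl expR_ge0.
- apply: (scale_boundedW C1 (N := 1)) => -[[[[b l] s] d] w] /= [/= bx _ _]; have l1 := box_l bx.
  have c0 := mix_rate_gt0 b w l1.
  rewrite gtr0_norm ?invr_gt0 ?onem_expR_gt0 //.
  by rewrite (le_trans (base_inv_le c0)) // rate_inv_le.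
- exists 1, 1%N; split=> // -[[[[b l] s] d] w] /= [/= bx s0 d0]; have l1 := box_l bx.
  rewrite ger0_norm // mul1r /scale /mix_scale /= expr1.
  rewrite (@le_trans _ _ (1 + s + d)) //.
    by lra.
  by rewrite ler_peMr ?W1 ?addr_ge0.
- exists 1, 1%N; split=> // -[[[[b l] s] d] w] /= [/= bx s0 d0]; have l1 := box_l bx.
  rewrite ger0_norm // mul1r /scale /mix_scale /= expr1.
  rewrite (@le_trans _ _ (1 + s + d)) //; first by lra.
  by rewrite ler_peMr ?W1 ?addr_ge0.
Qed.

Let mix_val_bounded v : scale_bounded mix_box scale
  (fun i => mix_val i.1.1.1.1 i.1.1.1.2 i.1.1.2 i.1.2 i.2 v).
Proof.
case: v => [k| | |k] /=.
- by apply: scale_bounded_ev => //; exact: base_val_bounded.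
- apply: (@scale_boundedW _ 1 0%N) => // -[[[[b l] s] d] w] /= [/= bx _ _]; have l1 := box_l bx.
  rewrite mul1r (le_trans _ (W1 _ _)) //.
  by case/andP: bx => _ /ltW.
- apply: (@scale_boundedW _ (expR 1) 1%N); first exact: expR_ge0.
  move=> -[[[[b l] s] d] w] /= [/= bx _ _]; have l1 := box_l bx.
  rewrite gtr0_norm ?invr_gt0 ?m0_gt0 //.
  exact: minv.
- apply: (@scale_boundedW _ 1 k.+1) => // -[[[[b l] s] d] w] /= [/= bx _ _]; have l1 := box_l bx.
  by rewrite mul1r mle.
Qed.

Lemma mix_expr_bounded e : exists C N, 0 <= C /\ forall b l s d w,
  param_box b l -> 0 <= s -> 0 <= d ->
  `|ev (mix_val b l s d w) e| <= C * mix_scale N s d w.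
Proof.
have [C [N [C0 hC]]] := scale_bounded_ev scale_growth mix_val_bounded e.
exists C, N; split=> // b l s d w bx s0 d0.
by apply: (hC (b, l, s, d, w)).
Qed.

Lemma mix_kernel_scale_le N : exists C N', 0 <= C /\ forall b l s d w,
  param_box b l -> 0 <= s -> 0 <= d ->
  mix_scale N s d w * mix_kernel b l s d w <=
  C * (1 + s + d) ^+ N * expR (- ((s + d) / 2)) * W N' w.
Proof.
set C := 1 + (expR (b0 - 1) * kap)^-1 * expR 1.
have C0 : 0 <= C by rewrite addr_ge0 ?mulr_ge0 ?invr_ge0 ?mulr_ge0 ?expR_ge0 ?(ltW kap0).
(* The prefactor of the kernel costs [W 1], and [W N * W 1] is absorbed by squaring at index
   [maxn N 1]. *)
exists C, (maxn N 1 * 2)%N; split=> // b l s d w bx s0 d0.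
have k1 : mix_kernel b l s d w <= C * W 1 w * expR (- ((s + d) / 2)).
  rewrite (le_trans (base_density_le _ _ _)) ?mix_rate_gt0 ?(box_l bx) //.
  by rewrite ler_wpM2r ?expR_ge0 // rate_inv_le.
have sd0 : 0 <= (1 + s + d) ^+ N by rewrite exprn_ge0 ?addr_ge0.
have WW : W N w * W 1 w <= W (maxn N 1 * 2) w.
  rewrite (le_trans _ (Wsqr _ _)) // expr2 ler_pM //.
    by apply: Wmono => //; exact: leq_maxl.
  by apply: Wmono => //; exact: leq_maxr.
rewrite (le_trans (ler_wpM2l _ k1)) ?mulr_ge0 //.
have -> : mix_scale N s d w * (C * W 1 w * expR (- ((s + d) / 2))) =
  C * (1 + s + d) ^+ N * expR (- ((s + d) / 2)) * (W N w * W 1 w).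
  by rewrite /mix_scale; ring.
by rewrite ler_wpM2l // !mulr_ge0 ?expR_ge0.
Qed.

End mixture.

Lemma poly_exp_le (R : realType) (N : nat) : exists2 C : R, 0 <= C &
  forall x : R, 0 <= x -> (1 + x) ^+ N * expR (- (x / 2)) <= C * expR (- (x / 4)).
Proof.
(* The bound [1 + x <= k * expR (x / k)] is raised to the power [N], and [N / k <= 1/4]; the
   successor keeps [k] positive when [N = 0]. *)
pose k : R := (4 * N.+1)%:R.
have k0 : 0 < k by rewrite ltr0n.
exists (k ^+ N); first by rewrite exprn_ge0 // ltW.
move=> x x0.
have h1 : 1 + x <= k * expR (x / k).
  rewrite (@le_trans _ _ (k * (1 + x / k))) //.
    rewrite mulrDr mulr1 mulrCA divff ?gt_eqF // mulr1 lerD2r.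
    by rewrite ler1n muln_gt0.
  by rewrite ler_wpM2l ?(ltW k0) // expR_ge1Dx.
have h2 : (1 + x) ^+ N <= k ^+ N * expR (x / 4).
  rewrite (le_trans (lerXn2r _ _ _ h1)) ?nnegrE ?addr_ge0 //.
    by rewrite mulr_ge0 ?expR_ge0 ?ltW.
  rewrite exprMn ler_pM2l ?exprn_gt0 // -expRM_natl ler_expR.
  rewrite mulrCA ler_wpM2l // /k natrM invfM mulrCA ler_piMr ?invr_ge0 //.
  by rewrite ler_pdivrMr ?ltr0n // mul1r ler_nat.
rewrite (le_trans (ler_wpM2r (expR_ge0 _) h2)) // -mulrA -expRD.
by rewrite ler_pM2l ?exprn_gt0 // ler_expR; lra.
Qed.

Section mixture_derivatives.
Context dS dO (S : measurableType dS) (Omega : measurableType dO) {R : realType}.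
Variables (U : probability S R) (P : probability Omega R) (z : S -> Omega -> R).
Hypothesis mz : measurable_fun setT (fun p : S * Omega => z p.1 p.2).
Hypothesis bz : forall w, exists K : R, forall s, `|z s w| <= K.
Hypothesis ez : forall n : nat, exists C : R, forall s,
  L1 P (fun w => expR (n%:R * `|z s w|)) /\
  \int[P]_w expR (n%:R * `|z s w|) <= C.
Variables (kap b0 : R).
Hypothesis kap0 : 0 < kap.
Implicit Types (b l : R) (w : Omega) (s d : R) (n k i j : nat).

Local Notation W := (exp_abs U z).
Local Notation mval := (mix_val U z kap).
Local Notation mker := (mix_kernel U z kap).
Local Notation mpdf := (mix_pdf U P z kap).
Local Notation mscale := (mix_scale U z).
Local Notation box := (param_box b0).

Let ker_gt0 := @mix_kernel_gt0 _ _ _ _ _ U z mz bz kap kap0.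
Let rate_gt0 := @mix_rate_gt0 _ _ _ _ _ U z mz bz kap kap0.
Let kernel_scale_le := @mix_kernel_scale_le _ _ _ _ _ U z mz bz kap b0 kap0.
Let expr_bounded := @mix_expr_bounded _ _ _ _ _ U z mz bz kap b0 kap0.
Let L1W := @L1_exp_abs _ _ _ _ _ U P z mz bz ez.
Let W1 := @exp_abs_ge1 _ _ _ _ _ U z mz bz.

Let box_l b l : box b l -> -1 < l < 1.
Proof. by move=> /andP[_]; rewrite ltr_norml. Qed.

Let W_ge0 n w : 0 <= W n w.
Proof. by rewrite (le_trans ler01) // W1. Qed.

Let mscale_ge0 n s d w : 0 <= s -> 0 <= d -> 0 <= mscale n s d w.
Proof. by move=> s0 d0; rewrite mulr_ge0 ?exprn_ge0 ?addr_ge0. Qed.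

Lemma measurable_mix_rate b l : measurable_fun setT (mix_rate U z kap b l).
Proof. by apply: measurable_funM => //; exact: measurable_exp_moment. Qed.

Lemma measurable_mix_val_joint dY (Y : measurableType dY) (s d : Y -> R) b l v :
  measurable_fun setT s -> measurable_fun setT d -> -1 < l < 1 ->
  measurable_fun setT (fun p : Y * Omega => mval b l (s p.1) (d p.1) p.2 v).
Proof.
move=> ms md l1; case: v => [k| | |k] //=.
- apply: measurable_ev => v; apply: measurable_base_val => //.
  + by apply: measurableT_comp (measurable_mix_rate b l) _.
  + exact: measurableT_comp.
  + exact: measurableT_comp.
  + by move=> p; exact: rate_gt0.
- apply: (measurableT_comp (f := fun w => (exp_moment U z 0 l w)^-1)) => //.
  apply: measurable_funV_ge0; first exact: measurable_exp_moment.
  by move=> w; rewrite ltW // exp_moment0_gt0.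
- by apply: (measurableT_comp (measurable_exp_moment U mz k l)).
Qed.

Lemma measurable_mix_kernel_joint dY (Y : measurableType dY) (s d : Y -> R) b l :
  measurable_fun setT s -> measurable_fun setT d -> -1 < l < 1 ->
  measurable_fun setT (fun p : Y * Omega => mker b l (s p.1) (d p.1) p.2).
Proof.
move=> ms md l1; apply: measurable_base_density.
- by apply: measurableT_comp (measurable_mix_rate b l) _.
- exact: measurableT_comp.
- exact: measurableT_comp.
- by move=> p; exact: rate_gt0.
Qed.

Let measurable_mval b l s d v : -1 < l < 1 ->
  measurable_fun setT (fun w => mval b l s d w v).
Proof.
(* Joint measurability with a frozen observation and [Omega] as parameter space, pulled back along
   the diagonal. *)
move=> l1; have H := @measurable_mix_val_joint _ Omega (fun=> s) (fun=> d) b l v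
  (measurable_cst _) (measurable_cst _) l1.
have G : measurable_fun setT (fun w : Omega => (w, w)).
  exact: measurable_fun_pair.
by have := measurableT_comp H G.
Qed.

Let measurable_mker b l s d : -1 < l < 1 ->
  measurable_fun setT (fun w => mker b l s d w).
Proof.
move=> l1; have H := @measurable_mix_kernel_joint _ Omega (fun=> s) (fun=> d) b l
  (measurable_cst _) (measurable_cst _) l1.
have G : measurable_fun setT (fun w : Omega => (w, w)).
  exact: measurable_fun_pair.
by have := measurableT_comp H G.
Qed.

(** [G] serves twice: being free of the parameters it justifies derivatives under [P], and its
    integral decays exponentially, which later gives integrability in the observation. *)
Lemma mix_scale_kernel_dom N : exists2 G : R -> R -> Omega -> R,
  forall s d, 0 <= s -> 0 <= d -> L1 P (G s d) &
  exists2 C, 0 <= C & forall s d, 0 <= s -> 0 <= d ->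
    \int[P]_w G s d w <= C * expR (- ((s + d) / 4)) /\
    forall b l w, box b l -> mscale N s d w * mker b l s d w <= G s d w.
Proof.
have [C [N' [C0 hC]]] := kernel_scale_le N.
have [C' C'0 hC'] := poly_exp_le R N.
exists (fun s d w => C * (1 + s + d) ^+ N * expR (- ((s + d) / 2)) * W N' w).
  by move=> s d s0 d0; apply: L1Z.
exists (C * C' * \int[P]_w W N' w).
  by rewrite !mulr_ge0 //; apply: Rintegral_ge0 => w _; exact: W_ge0.
move=> s d s0 d0; split; last by move=> b l w bx; exact: hC.
rewrite RintegralZl // [leRHS]mulrAC ler_wpM2r //.
  by apply: Rintegral_ge0 => w _; exact: W_ge0.
by rewrite -!mulrA ler_wpM2l // -addrA hC' // addr_ge0.
Qed.

Let L1_scale_ker N b l s d : box b l -> 0 <= s -> 0 <= d ->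
  L1 P (fun w => mscale N s d w * mker b l s d w).
Proof.
move=> bx s0 d0; have [G iG [C C0 hC]] := mix_scale_kernel_dom N.
apply: (L1_le _ _ (iG s d s0 d0)).
  apply: measurable_funM; last by apply: measurable_mker; exact: box_l bx.
  by apply: measurable_funM => //; exact: measurable_exp_abs.
move=> w; rewrite ger0_norm; first by apply: (hC _ _ s0 d0).2.
by rewrite mulr_ge0 ?mscale_ge0 // ltW // ker_gt0 // (box_l bx).
Qed.

Let mix_dom s d e : 0 <= s -> 0 <= d -> exists2 G : Omega -> R, L1 P G &
  forall b l w, box b l -> `|ev (mval b l s d w) e * mker b l s d w| <= G w.
Proof.
move=> s0 d0; have [C [N [C0 hC]]] := expr_bounded e.
have [G iG [C' C'0 hG]] := mix_scale_kernel_dom N.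
exists (fun w => C * G s d w); first by apply: L1Z; exact: iG.
move=> b l w bx; have k0 := ker_gt0 b s d w (box_l bx).
rewrite normrM (gtr0_norm k0) (le_trans (ler_wpM2r (ltW k0) (hC _ _ _ _ _ bx s0 d0))) //.
by rewrite -mulrA ler_wpM2l // (hG _ _ s0 d0).2.
Qed.

Lemma L1_mix_pdf e b l s d : box b l -> 0 <= s -> 0 <= d ->
  L1 P (fun w => ev (mval b l s d w) e * mker b l s d w).
Proof.
move=> bx s0 d0; have [G iG hG] := mix_dom e s0 d0.
apply: (L1_le _ _ iG); last by move=> w; exact: hG.
apply: measurable_funM; last exact/measurable_mker/(box_l bx).
by apply: measurable_ev => v; exact/measurable_mval/(box_l bx).
Qed.

Lemma is_derive_mix_pdf_beta i j b l s d : box b l -> 0 <= s -> 0 <= d ->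
  is_derive b 1 (fun u => mpdf i j u l s d) (mpdf i.+1 j b l s d).
Proof.
move=> bx s0 d0; have l1 := box_l bx.
have Ib u : `]b0 - 1, b0 + 1[%classic u -> box u l.
  rewrite /= in_itv /= => ub; apply/andP; split; last by case/andP: bx.
  by rewrite ltr_distl.
have Ib0 : `]b0 - 1, b0 + 1[%classic b.
  by rewrite /= in_itv /=; case/andP: bx; rewrite ltr_distl.
have dom e : exists2 G : Omega -> R, L1 P G & forall u w,
    `]b0 - 1, b0 + 1[%classic u ->
    `|ev (mval u l s d w) e * mker u l s d w| <= G w.
  by have [G iG hG] := mix_dom e s0 d0; exists G => // u w /Ib; exact: hG.
apply: (is_derive_eq (is_derive_integral (mu := P)
  (x := fun u w v => mval u l s d w v) (w := fun u w => mker u l s d w)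
  (dv := mix_der_beta) (k := mix_score_beta) _ _ _ _ dom _ Ib0)).
- by move=> u w _ v; exact: is_derive_mix_val_beta.
- by move=> u w _; exact: is_derive_mix_kernel_beta.
- by move=> u v _; exact: measurable_mval.
- by move=> u _; exact: measurable_mker.
- by apply: eq_Rintegral => w _; rewrite wder_beta_mix_expr.
Qed.

Lemma is_derive_mix_pdf_lambda i j b l s d : box b l -> 0 <= s -> 0 <= d ->
  is_derive l 1 (fun u => mpdf i j b u s d) (mpdf i j.+1 b l s d).
Proof.
move=> bx s0 d0; have l1 := box_l bx.
have Il u : `]-1, 1[%classic u -> -1 < u < 1 by rewrite /= in_itv.
have Il0 : `]-1, 1[%classic l by rewrite /= in_itv.
have dom e : exists2 G : Omega -> R, L1 P G & forall u w,
    `]-1, 1[%classic u ->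
    `|ev (mval b u s d w) e * mker b u s d w| <= G w.
  have [G iG hG] := mix_dom e s0 d0; exists G => // u w /Il u1.
  apply: hG; apply/andP; split; first by case/andP: bx.
  by rewrite ltr_norml.
apply: (is_derive_eq (is_derive_integral (mu := P)
  (x := fun u w v => mval b u s d w v) (w := fun u w => mker b u s d w)
  (dv := mix_der_lambda) (k := mix_score_lambda) _ _ _ _ dom _ Il0)).
- by move=> u w /Il u1 v; exact: is_derive_mix_val_lambda.
- by move=> u w /Il u1; exact: is_derive_mix_kernel_lambda.
- by move=> u v /Il u1; exact: measurable_mval.
- by move=> u /Il u1; exact: measurable_mker.
- by apply: eq_Rintegral => w _; rewrite wder_lambda_mix_expr.
Qed.

Lemma mix_pdf00E b l s d : mpdf 0 0 b l s d = \int[P]_w mker b l s d w.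
Proof.
by apply: eq_Rintegral => w _ /=; rewrite base_ratio0 mulr1 addr0 mul1r.
Qed.

Let L1_ker b l s d : box b l -> 0 <= s -> 0 <= d -> L1 P (fun w => mker b l s d w).
Proof.
move=> bx s0 d0; have := L1_mix_pdf (ECst 1) bx s0 d0.
by apply: eq_integrable => // w _ /=; rewrite mul1r.
Qed.

Lemma mix_pdf00_gt0 b l s d : box b l -> 0 <= s -> 0 <= d -> 0 < mpdf 0 0 b l s d.
Proof.
move=> bx s0 d0; rewrite mix_pdf00E; apply: Rintegral_gt0; first exact: L1_ker.
  by move=> w; exact: ker_gt0 (box_l bx).
by rewrite (_ : _ setT = 1%E) ?onee_neq0 //; exact: (probability_setT P).
Qed.

(** The conditional mean of [mix_scale] given the observation. The ratio of a derivative of the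
    mixture to the mixture is itself a conditional mean, hence bounded at this scale without any
    lower bound on the density. *)
Definition tilted_scale n b l s d : R :=
  (\int[P]_w (mscale n s d w * mker b l s d w)) / mpdf 0 0 b l s d.

Let tilt_index : Type := (R * R * R * R)%type.

Let tilt_box : set tilt_index := [set i |
  [/\ box i.1.1.1 i.1.1.2, 0 <= i.1.2 & 0 <= i.2]].

Let tilt_scale (n : nat) (i : tilt_index) :=
  tilted_scale n i.1.1.1 i.1.1.2 i.1.2 i.2.

Let mscale_sqr N s d w : 0 <= s -> 0 <= d ->
  mscale N s d w ^+ 2 <= mscale (N * 2) s d w.
Proof. exact: mix_scale_sqr. Qed.

Let tilt_growth : growth_scale tilt_box tilt_scale.
Proof.
split=> [n [[[b l] s] d] [/= bx s0 d0]|n1 n2 [[[b l] s] d] [/= bx s0 d0] n12|n].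
- have q0 := mix_pdf00_gt0 bx s0 d0.
  rewrite /tilt_scale /tilted_scale ler_pdivlMr // mul1r mix_pdf00E.
  apply: le_Rintegral => //; [exact: L1_ker|exact: L1_scale_ker|].
  move=> w _; rewrite ler_peMl ?(ltW (ker_gt0 _ _ _ _ (box_l bx))) //.
  exact: mix_scale_ge1.
- have q0 := mix_pdf00_gt0 bx s0 d0.
  rewrite /tilt_scale /tilted_scale /=.
  apply: ler_wpM2r; first by rewrite invr_ge0 ltW.
  apply: le_Rintegral => //; try exact: L1_scale_ker.
  move=> w _; rewrite ler_wpM2r ?(ltW (ker_gt0 _ _ _ _ (box_l bx))) //.
  exact: mix_scale_mono.
- exists (n * 2)%N => -[[[b l] s] d] [/= bx s0 d0].
  have q0 := mix_pdf00_gt0 bx s0 d0.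
  have k0 w := ltW (ker_gt0 b s d w (box_l bx)).
  have i2 : L1 P (fun w => mscale n s d w ^+ 2 * mker b l s d w).
    apply: (L1_le _ _ (L1_scale_ker (n * 2) bx s0 d0)).
      apply: measurable_funM; last by apply: measurable_mker; exact: box_l bx.
      apply: measurable_funX.
      by apply: measurable_funM => //; exact: measurable_exp_abs.
    move=> w; rewrite ger0_norm; last by rewrite mulr_ge0 ?sqr_ge0 ?k0.
    by rewrite ler_wpM2r ?k0 // mscale_sqr.
  (* The squared conditional mean is at most the conditional mean of the square, which is bounded at
     index [n * 2]. *)
  have := weighted_sqr_le k0 (L1_ker bx s0 d0) (L1_scale_ker n bx s0 d0) i2.
  rewrite -mix_pdf00E => /(_ q0) H.
  rewrite /tilt_scale /tilted_scale expr_div_n ler_pdivrMr ?exprn_gt0 //.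
  rewrite (le_trans H) // expr2 mulrA divfK ?gt_eqF // ler_wpM2r ?(ltW q0) //.
  apply: le_Rintegral => //; first exact: L1_scale_ker.
  by move=> w _; rewrite ler_wpM2r ?k0 // mscale_sqr.
Qed.

Let mix_ratio_bounded i j : scale_bounded tilt_box tilt_scale
  (fun p => mpdf i j p.1.1.1 p.1.1.2 p.1.2 p.2 / mpdf 0 0 p.1.1.1 p.1.1.2 p.1.2 p.2).
Proof.
have [C [N [C0 hC]]] := expr_bounded (mix_expr i j).
exists C, N; split=> // -[[[b l] s] d] [/= bx s0 d0].
have q0 := mix_pdf00_gt0 bx s0 d0.
rewrite /tilt_scale /tilted_scale /= normrM normfV (gtr0_norm q0) mulrA.
apply: ler_wpM2r; first by rewrite invr_ge0 ltW.
rewrite -RintegralZl //; last exact: L1_scale_ker.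
rewrite (le_trans (le_normr_Rintegral _ _)) //; first exact: L1_mix_pdf.
apply: le_Rintegral => //.
- by apply: integrable_norm; exact: L1_mix_pdf.
- by apply: L1Z; exact: L1_scale_ker.
- move=> w _; have k0 := ker_gt0 b s d w (box_l bx).
  by rewrite normrM (gtr0_norm k0) mulrA ler_wpM2r ?(ltW k0) // hC.
Qed.

Definition ratio_val b l s d (v : nat * nat) : R :=
  mpdf v.1 v.2 b l s d / mpdf 0 0 b l s d.

(** Multiplying the conditional mean by the density removes the conditioning and leaves an integral
    against [P], with the decay of [mix_scale_kernel_dom]. *)
Lemma ratio_expr_dom e : exists2 C, 0 <= C & forall b l s d,
  box b l -> 0 <= s -> 0 <= d ->
  `|ev (ratio_val b l s d) e * mpdf 0 0 b l s d| <= C * expR (- ((s + d) / 4)).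
Proof.
have [C [N [C0 hC]]] := scale_bounded_ev tilt_growth
  (x := fun p => ratio_val p.1.1.1 p.1.1.2 p.1.2 p.2)
  (fun v => mix_ratio_bounded v.1 v.2) e.
have [G iG [C' C'0 hG]] := mix_scale_kernel_dom N.
exists (C * C'); first exact: mulr_ge0.
move=> b l s d bx s0 d0; have q0 := mix_pdf00_gt0 bx s0 d0.
have {}hC := hC (b, l, s, d) (And3 bx s0 d0).
rewrite normrM (gtr0_norm q0) (le_trans (ler_wpM2r (ltW q0) hC)) //.
rewrite /tilt_scale /tilted_scale /= mulrA divfK ?gt_eqF //.
rewrite -mulrA ler_wpM2l // (le_trans _ (hG _ _ s0 d0).1) //.
apply: le_Rintegral => //; [exact: L1_scale_ker|exact: iG|].
by move=> w _; apply: (hG _ _ s0 d0).2.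
Qed.

End mixture_derivatives.

(** * Integrals of polynomials in the ratios *)

(* The variable [(i, j)] stands for the ratio of the i-th beta- and j-th
   lambda-derivative of the density to the density. *)
Definition ratio_der_beta (v : nat * nat) : expr (nat * nat) :=
  EAdd (EVar (v.1.+1, v.2)) (EOpp (EMul (EVar v) (EVar (1, 0)))).

Definition ratio_der_lambda (v : nat * nat) : expr (nat * nat) :=
  EAdd (EVar (v.1, v.2.+1)) (EOpp (EMul (EVar v) (EVar (0, 1)))).

Definition wder_beta := wder ratio_der_beta (EVar (1, 0)).
Definition wder_lambda := wder ratio_der_lambda (EVar (0, 1)).

Lemma ratio_der_comm {R : realType} v : @eqv R _
  (der ratio_der_beta (ratio_der_lambda v)) (der ratio_der_lambda (ratio_der_beta v)).
Proof. by case: v => i j x /=; ring. Qed.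

Lemma iter_wder_comm {R : realType} n e : @eqv R _
  (wder_lambda (iter n wder_beta e)) (iter n wder_beta (wder_lambda e)).
Proof.
apply: iter_wderC => [v|x]; first exact: ratio_der_comm.
by rewrite /=; ring.
Qed.

Section ratio_integrals.
Context dS dO dY (S : measurableType dS) (Omega : measurableType dO)
  (Y : measurableType dY) {R : realType}.
Variables (U : probability S R) (P : probability Omega R) (z : S -> Omega -> R).
Hypothesis mz : measurable_fun setT (fun p : S * Omega => z p.1 p.2).
Hypothesis bz : forall w, exists K : R, forall s, `|z s w| <= K.
Hypothesis ez : forall n : nat, exists C : R, forall s,
  L1 P (fun w => expR (n%:R * `|z s w|)) /\
  \int[P]_w expR (n%:R * `|z s w|) <= C.
Variables (kap b0 : R).
Hypothesis kap0 : 0 < kap.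
Variables (mu : {measure set Y -> \bar R}) (sy dy : Y -> R).
Hypotheses (msy : measurable_fun setT sy) (mdy : measurable_fun setT dy).
Hypotheses (sy0 : forall y, 0 <= sy y) (dy0 : forall y, 0 <= dy y).
Hypothesis iexp : L1 mu (fun y => expR (- ((sy y + dy y) / 4))).
Implicit Types (b l : R) (y : Y) (n k i j : nat) (e : expr (nat * nat)).

Local Notation mpdf := (mix_pdf U P z kap).
Local Notation box := (param_box b0).
Local Notation rval := (ratio_val U P z kap).

Let pdf_beta := @is_derive_mix_pdf_beta _ _ _ _ _ U P z mz bz ez kap b0 kap0.
Let pdf_lambda := @is_derive_mix_pdf_lambda _ _ _ _ _ U P z mz bz ez kap b0 kap0.
Let pdf_gt0 := @mix_pdf00_gt0 _ _ _ _ _ U P z mz bz ez kap b0 kap0.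
Let ratio_dom := @ratio_expr_dom _ _ _ _ _ U P z mz bz ez kap b0 kap0.

Let box_l b l : box b l -> -1 < l < 1.
Proof. by move=> /andP[_]; rewrite ltr_norml. Qed.

Definition yval b l y v : R := rval b l (sy y) (dy y) v.

Definition ypdf b l y : R := mpdf 0 0 b l (sy y) (dy y).

Definition ratio_integral e b l : R := \int[mu]_y (ev (yval b l y) e * ypdf b l y).

Lemma measurable_ymix_pdf i j b l : box b l ->
  measurable_fun setT (fun y => mpdf i j b l (sy y) (dy y)).
Proof.
move=> bx; have l1 := box_l bx.
apply: (measurable_Rintegral_param P (f := fun y w =>
  ev (mix_val U z kap b l (sy y) (dy y) w) (mix_expr i j) *
  mix_kernel U z kap b l (sy y) (dy y) w)).
apply: measurable_funM; last exact: measurable_mix_kernel_joint.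
by apply: measurable_ev => v; exact: measurable_mix_val_joint.
Qed.

Lemma measurable_yval b l v : box b l -> measurable_fun setT (fun y => yval b l y v).
Proof.
move=> bx; apply: measurable_funM; first exact: measurable_ymix_pdf.
apply: measurable_funV_ge0; first exact: measurable_ymix_pdf.
by move=> y; rewrite ltW // pdf_gt0.
Qed.

Let ratio_derive (f : nat * nat -> R -> R) (t : R) v v' v1 :
  f (0, 0) t != 0 ->
  is_derive t 1 (f v) (f v' t) -> is_derive t 1 (f (0, 0)) (f v1 t) ->
  is_derive t 1 (fun u => f v u / f (0, 0) u)
    (f v' t / f (0, 0) t - f v t / f (0, 0) t * (f v1 t / f (0, 0) t)).
Proof.
move=> f0 h h0; apply: (is_derive_eq (is_deriveM h (is_derive_inv h0 f0))).
by rewrite /GRing.scale /=; field.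
Qed.

Lemma is_derive_yval_beta b l y v : box b l ->
  is_derive b 1 (fun u => yval u l y v) (ev (yval b l y) (ratio_der_beta v)).
Proof.
move=> bx.
apply: (@ratio_derive (fun v u => mpdf v.1 v.2 u l (sy y) (dy y)) b v
  (v.1.+1, v.2) (1, 0)) => /=; [|exact: pdf_beta|exact: pdf_beta].
by rewrite gt_eqF // pdf_gt0.
Qed.

Lemma is_derive_yval_lambda b l y v : box b l ->
  is_derive l 1 (fun u => yval b u y v) (ev (yval b l y) (ratio_der_lambda v)).
Proof.
move=> bx.
apply: (@ratio_derive (fun v u => mpdf v.1 v.2 b u (sy y) (dy y)) l v
  (v.1, v.2.+1) (0, 1)) => /=; [|exact: pdf_lambda|exact: pdf_lambda].
by rewrite gt_eqF // pdf_gt0.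
Qed.

Lemma is_derive_ypdf_beta b l y : box b l ->
  is_derive b 1 (fun u => ypdf u l y) (yval b l y (1, 0) * ypdf b l y).
Proof.
move=> bx; have h := pdf_beta 0 0 bx (sy0 y) (dy0 y).
rewrite /ypdf; apply: (is_derive_eq h).
by rewrite /yval /ratio_val /= divfK // gt_eqF // pdf_gt0.
Qed.

Lemma is_derive_ypdf_lambda b l y : box b l ->
  is_derive l 1 (fun u => ypdf b u y) (yval b l y (0, 1) * ypdf b l y).
Proof.
move=> bx; have h := pdf_lambda 0 0 bx (sy0 y) (dy0 y).
rewrite /ypdf; apply: (is_derive_eq h).
by rewrite /yval /ratio_val /= divfK // gt_eqF // pdf_gt0.
Qed.

Let ydom e : exists2 G : Y -> R, L1 mu G & forall b l y,
  box b l -> `|ev (yval b l y) e * ypdf b l y| <= G y.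
Proof.
have [C C0 hC] := ratio_dom e.
exists (fun y => C * expR (- ((sy y + dy y) / 4))); first exact: L1Z.
by move=> b l y bx; exact: hC.
Qed.

Lemma L1_ratio_integral e b l : box b l ->
  L1 mu (fun y => ev (yval b l y) e * ypdf b l y).
Proof.
move=> bx; have [G iG hG] := ydom e.
apply: (L1_le _ _ iG); last by move=> y; exact: hG.
apply: measurable_funM; last exact: measurable_ymix_pdf.
by apply: measurable_ev => v; exact: measurable_yval.
Qed.

Lemma ratio_integral_bounded e : exists C, forall b l, box b l ->
  `|ratio_integral e b l| <= C.
Proof.
have [G iG hG] := ydom e; exists (\int[mu]_y G y) => b l bx.
rewrite (le_trans (le_normr_Rintegral _ _)) //; first exact: L1_ratio_integral.
apply: le_Rintegral => //.
- by apply: integrable_norm; exact: L1_ratio_integral.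
- by move=> y _; exact: hG.
Qed.

Lemma is_derive_ratio_integral_beta e b l : box b l ->
  is_derive b 1 (fun u => ratio_integral e u l) (ratio_integral (wder_beta e) b l).
Proof.
move=> bx.
have Ib u : `]b0 - 1, b0 + 1[%classic u -> box u l.
  rewrite /= in_itv /= => ub; apply/andP; split; last by case/andP: bx.
  by rewrite ltr_distl.
have Ib0 : `]b0 - 1, b0 + 1[%classic b.
  by rewrite /= in_itv /=; case/andP: bx; rewrite ltr_distl.
have dom e' : exists2 G : Y -> R, L1 mu G & forall u y,
    `]b0 - 1, b0 + 1[%classic u -> `|ev (yval u l y) e' * ypdf u l y| <= G y.
  by have [G iG hG] := ydom e'; exists G => // u w /Ib; exact: hG.
apply: (is_derive_integral (mu := mu) (x := fun u y v => yval u l y v)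
  (w := fun u y => ypdf u l y) (dv := ratio_der_beta) (k := EVar (1, 0))
  _ _ _ _ dom _ Ib0).
- by move=> u y /Ib bu v; exact: is_derive_yval_beta.
- by move=> u y /Ib bu; exact: is_derive_ypdf_beta.
- by move=> u v /Ib bu; exact: measurable_yval.
- by move=> u /Ib bu; exact: measurable_ymix_pdf.
Qed.

Lemma is_derive_ratio_integral_lambda e b l : box b l ->
  is_derive l 1 (fun u => ratio_integral e b u) (ratio_integral (wder_lambda e) b l).
Proof.
move=> bx.
have Il u : `]-1, 1[%classic u -> box b u.
  rewrite /= in_itv /= => u1; apply/andP; split; first by case/andP: bx.
  by rewrite ltr_norml.
have Il0 : `]-1, 1[%classic l by rewrite /= in_itv /=; exact: box_l bx.
have dom e' : exists2 G : Y -> R, L1 mu G & forall u y,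
    `]-1, 1[%classic u -> `|ev (yval b u y) e' * ypdf b u y| <= G y.
  by have [G iG hG] := ydom e'; exists G => // u w /Il; exact: hG.
apply: (is_derive_integral (mu := mu) (x := fun u y v => yval b u y v)
  (w := fun u y => ypdf b u y) (dv := ratio_der_lambda) (k := EVar (0, 1))
  _ _ _ _ dom _ Il0).
- by move=> u y /Il bu v; exact: is_derive_yval_lambda.
- by move=> u y /Il bu; exact: is_derive_ypdf_lambda.
- by move=> u v /Il bu; exact: measurable_yval.
- by move=> u /Il bu; exact: measurable_ymix_pdf.
Qed.

Definition ratio_jet e i j b l : R :=
  ratio_integral (iter i wder_beta (iter j wder_lambda e)) b l.

Lemma is_derive_ratio_jet_beta e i j b l : box b l ->
  is_derive b 1 (fun u => ratio_jet e i j u l) (ratio_jet e i.+1 j b l).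
Proof. by move=> bx; exact: is_derive_ratio_integral_beta. Qed.

(** [ratio_jet] puts the beta-derivations outermost, so a new lambda-derivation has to be commuted
    past all [i] of them. *)
Lemma is_derive_ratio_jet_lambda e i j b l : box b l ->
  is_derive l 1 (fun u => ratio_jet e i j b u) (ratio_jet e i j.+1 b l).
Proof.
move=> bx; apply: (is_derive_eq (is_derive_ratio_integral_lambda _ bx)).
by apply: eq_Rintegral => y _; rewrite iter_wder_comm iterS.
Qed.

Lemma ratio_jet_bounded e i j : exists C, forall b l, box b l ->
  `|ratio_jet e i j b l| <= C.
Proof. exact: ratio_integral_bounded. Qed.

End ratio_integrals.

(** * Values at lambda = 0 *)

Section boundary_values.
Context dS dO (S : measurableType dS) (Omega : measurableType dO) {R : realType}.
Variables (U : probability S R) (P : probability Omega R) (z : S -> Omega -> R).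
Hypothesis mz : measurable_fun setT (fun p : S * Omega => z p.1 p.2).
Hypothesis bz : forall w, exists K : R, forall s, `|z s w| <= K.
Hypothesis ez : forall n : nat, exists C : R, forall s,
  L1 P (fun w => expR (n%:R * `|z s w|)) /\
  \int[P]_w expR (n%:R * `|z s w|) <= C.
Variables (kap : R).
Hypothesis kap0 : 0 < kap.
Implicit Types (b : R) (w : Omega) (s d : R) (k i j : nat) (e : expr mix_var).

Local Notation M := (fun k w => exp_moment U z k 0 w).
Local Notation mpdf := (mix_pdf U P z kap).

Lemma exp_moment00 w : exp_moment U z 0 0 w = 1.
Proof.
rewrite -[RHS](Rintegral_prob_cst U); apply: eq_Rintegral => s _.
by rewrite /exp_path mul1r mul0r expr0n mul0r subr0 expR0.
Qed.

(** Meant for [phi_free] expressions; the value 0 on [Tphi] is a placeholder. *)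
Definition val0 w (v : mix_var) : R :=
  match v with Tphi _ => 0 | Tlam => 0 | Tinv => 1 | Tm k => M k w end.

Lemma ev_phi_free (x x' : mix_var -> R) e : phi_free e ->
  (forall v, (if v is Tphi _ then false else true) -> x v = x' v) -> ev x e = ev x' e.
Proof.
move=> + xx; elim: e => [n|u|e IH|e1 IH1 e2 IH2|e1 IH1 e2 IH2] //=.
- by move=> hu; exact: xx.
- by move=> he; rewrite IH.
- by move=> /andP[h1 h2]; rewrite IH1 // IH2.
- by move=> /andP[h1 h2]; rewrite IH1 // IH2.
Qed.

Lemma mix_val0E b s d w e : phi_free e ->
  ev (mix_val U z kap b 0 s d w) e = ev (val0 w) e.
Proof.
move=> he; apply: ev_phi_free => // -[] //=.
by rewrite exp_moment00 invr1.
Qed.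

Lemma mix_rate0E b w : mix_rate U z kap b 0 w = expR b * kap.
Proof. by rewrite /mix_rate exp_moment00 mulr1. Qed.

(** At lambda = 0 the kernel is the same for all paths; dividing an integrable mixture integrand by
    this positive constant leaves the expression in the path alone. *)
Lemma L1_val0 e : phi_free e -> L1 P (fun w => ev (val0 w) e).
Proof.
move=> he.
have bx : param_box 0 0 (0 : R) by rewrite /param_box subrr normr0 ltr01.
have := @L1_mix_pdf _ _ _ _ _ U P z mz bz ez kap 0 kap0 e 0 0 0 0 bx (lexx 0) (lexx 0).
move/(@L1Z _ _ _ _ (base_density (expR 0 * kap) 0 0)^-1).
apply: eq_integrable => // w _ /=.
rewrite mix_val0E // /mix_kernel mix_rate0E mulrCA mulVf ?mulr1 //.
by rewrite gt_eqF // base_density_gt0 // mulr_gt0 ?expR_gt0.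
Qed.

Definition coef_mean j k : R :=
  \int[P]_w ev (val0 w) (nth (ECst 0) (coefs j) k).

Lemma phi_free_nth_coefs j k : phi_free (nth (ECst 0) (coefs j) k).
Proof.
have [kj|kj] := ltnP k (size (coefs j)); last by rewrite nth_default.
exact: (all_nthP (ECst 0) (phi_free_coefs j) k kj).
Qed.

Lemma mix_pdf_at0 i j b s d : mpdf i j b 0 s d =
  (\sum_(k < size (coefs j)) base_ratio (i + k) (expR b * kap) s d * coef_mean j k)
  * base_density (expR b * kap) s d.
Proof.
set r := base_density _ _ _.
have -> : mpdf i j b 0 s d = \int[P]_w ((\sum_(k < size (coefs j))
    base_ratio (i + k) (expR b * kap) s d *
    ev (val0 w) (nth (ECst 0) (coefs j) k)) * r).
  apply: eq_Rintegral => w _; rewrite ev_phi_comb /mix_kernel mix_rate0E.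
  congr (_ * _); apply: eq_bigr => k _ /=; rewrite mix_rate0E mix_val0E //.
  exact: phi_free_nth_coefs.
have L n (a : nat -> R) (e : nat -> expr mix_var) : (forall k, phi_free (e k)) ->
    L1 P (fun w => \sum_(k < n) a k * ev (val0 w) (e k)) /\
    \int[P]_w (\sum_(k < n) a k * ev (val0 w) (e k)) =
    \sum_(k < n) a k * \int[P]_w ev (val0 w) (e k).
  move=> he; elim: n => [|n [IH1 IH2]].
    rewrite (_ : (fun w => _) = cst 0); last by apply/funext => w; rewrite big_ord0.
    by split; [exact: L1_cst|rewrite Rintegral_prob_cst big_ord0].
  rewrite (_ : (fun w => _) = (fun w => \sum_(k < n) a k * ev (val0 w) (e k)
    + a n * ev (val0 w) (e n))); last by apply/funext => w; rewrite big_ord_recr.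
  have In : L1 P (fun w => a n * ev (val0 w) (e n)) by apply/L1Z/L1_val0.
  split; first exact: L1D.
  by rewrite RintegralD // IH2 RintegralZl ?big_ord_recr //; exact: L1_val0.
have [L' E] := L (size (coefs j)) (fun k => base_ratio (i + k) (expR b * kap) s d)
  (fun k => nth (ECst 0) (coefs j) k) (phi_free_nth_coefs j).
by rewrite RintegralZr // E.
Qed.

Variable v : R.
Hypothesis mean1 : \int[P]_w M 1 w = 0.
Hypothesis mean2 : \int[P]_w M 2 w = 1.
Hypothesis mean3 : \int[P]_w M 3 w = 0.
Hypothesis mean11 : \int[P]_w (M 1 w ^+ 2) = v.
Hypothesis mean12 : \int[P]_w (M 1 w * M 2 w) = 0.
Hypothesis mean111 : \int[P]_w (M 1 w ^+ 3) = 0.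

Let T1 : expr mix_var := EVar (Tm 1).
Let T2 : expr mix_var := EVar (Tm 2).
Let T3 : expr mix_var := EVar (Tm 3).

Let I e : phi_free e -> L1 P (fun w => ev (val0 w) e). Proof. exact: L1_val0. Qed.

(** A positive number of lambda-derivatives of f(beta + delta) always differentiates f, so no term
    in f itself remains. *)
Let coef_mean_head j : (0 < j <= 4)%N -> coef_mean j 0 = 0.
Proof.
move=> j4; rewrite -[RHS](Rintegral_prob_cst P); apply: eq_Rintegral => w _.
by case: j j4 => [|[|[|[|[|j]]]]] //= _; rewrite !addr0.
Qed.

Let coef_mean11 : coef_mean 1 1 = 0.
Proof.
rewrite -mean1; apply: eq_Rintegral => w _ /=; rewrite exp_moment00; ring.
Qed.

Let coef_mean22 : coef_mean 2 2 = v.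
Proof.
rewrite -mean11; apply: eq_Rintegral => w _ /=; rewrite exp_moment00; ring.
Qed.

Let coef_mean33 : coef_mean 3 3 = 0.
Proof.
rewrite -mean111; apply: eq_Rintegral => w _ /=; rewrite exp_moment00; ring.
Qed.

(** The entry is the second derivative of the log-clock, the variance of the path over time minus 1,
    whose mean is [(1 - v) - 1]. *)
Let coef_mean21 : coef_mean 2 1 = - v.
Proof.
have -> : coef_mean 2 1 = \int[P]_w ((M 2 w - 1) - M 1 w ^+ 2).
  by apply: eq_Rintegral => w _ /=; rewrite exp_moment00; ring.
have i2 := I (e := T2) isT; have i11 := I (e := EMul T1 T1) isT.
have i2' : L1 P (fun w => M 2 w - 1) by apply: L1B => //; exact: L1_cst.
rewrite RintegralB //.
rewrite RintegralB //; last exact: L1_cst.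
by rewrite mean2 Rintegral_prob_cst mean11 subrr sub0r.
Qed.

(** The entry is three times the product of the first two derivatives of the log-clock, odd in the
    path. *)
Let coef_mean32 : coef_mean 3 2 = 0.
Proof.
have -> : coef_mean 3 2 = \int[P]_w (3 * (M 1 w * M 2 w - M 1 w - M 1 w ^+ 3)).
  by apply: eq_Rintegral => w _ /=; rewrite exp_moment00; ring.
have i1 := I (e := T1) isT; have i12 := I (e := EMul T1 T2) isT.
have i111 : L1 P (fun w => M 1 w ^+ 3) by have := I (e := EMul T1 (EMul T1 T1)) isT.
have i2 : L1 P (fun w => M 1 w * M 2 w - M 1 w) by exact: L1B.
rewrite RintegralZl //; last exact: L1B.
by rewrite !RintegralB // mean12 mean1 mean111 !subr0 mulr0.
Qed.

(** The entry is the third cumulant of the path over time, again odd in the path. *)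
Let coef_mean31 : coef_mean 3 1 = 0.
Proof.
have -> : coef_mean 3 1 =
    \int[P]_w ((M 3 w - 3 * (M 1 w * M 2 w)) + 2 * M 1 w ^+ 3).
  by apply: eq_Rintegral => w _ /=; rewrite exp_moment00; ring.
have i3 := I (e := T3) isT; have i12 := I (e := EMul T1 T2) isT.
have i111 : L1 P (fun w => M 1 w ^+ 3) by have := I (e := EMul T1 (EMul T1 T1)) isT.
have z12 : L1 P (fun w => 3 * (M 1 w * M 2 w)) by exact: L1Z.
rewrite RintegralD //; [|exact: L1B|exact: (L1Z 2 i111)].
rewrite RintegralB // !RintegralZl //.
by rewrite mean3 mean12 mean111 !mulr0 subr0 addr0.
Qed.

Section ratios.
Variables (b s d : R).
Let c := expR b * kap.
Let phi k := base_ratio k c s d.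
Let rval := ratio_val U P z kap b 0 s d.

Let ratioE i j : rval (i, j) =
  \sum_(k < size (coefs j)) phi (i + k) * coef_mean j k.
Proof.
have r0 : base_density c s d != 0 by rewrite gt_eqF // base_density_gt0 // mulr_gt0 ?expR_gt0.
rewrite /rval /ratio_val /= !mix_pdf_at0 -/c -/phi.
have -> : \sum_(k < size (coefs 0)) phi (0 + k) * coef_mean 0 k = 1.
  rewrite big_ord_recl big_ord0 addr0 /= mul1r -[RHS](Rintegral_prob_cst P).
  by apply: eq_Rintegral => w _.
by rewrite mul1r mulfK.
Qed.

Lemma ratio_at0_0 i : rval (i, 0) = phi i.
Proof.
rewrite ratioE big_ord_recl big_ord0 addr0 addn0.
have -> : coef_mean 0 (@ord0 0) = 1.
  by rewrite -[RHS](Rintegral_prob_cst P); apply: eq_Rintegral => w _.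
by rewrite mulr1.
Qed.

Lemma ratio_at0_1 i : rval (i, 1) = 0.
Proof.
rewrite ratioE !big_ord_recl big_ord0 /= coef_mean_head // coef_mean11.
by rewrite !mulr0 !addr0.
Qed.

Lemma ratio_at0_2 i : rval (i, 2) = v * (phi i.+2 - phi i.+1).
Proof.
rewrite ratioE !big_ord_recl big_ord0 /= coef_mean_head // coef_mean21 coef_mean22.
by rewrite /bump /= !addn0 addn1 addn2; ring.
Qed.

Lemma ratio_at0_3 i : rval (i, 3) = 0.
Proof.
rewrite ratioE !big_ord_recl big_ord0 /= coef_mean_head // coef_mean31.
by rewrite coef_mean32 coef_mean33 !mulr0 !addr0.
Qed.

(** The four coefficients are left unevaluated, since they cancel from the curvature. *)
Lemma ratio_at0_4 i : rval (i, 4) =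
  \sum_(k < 4) phi (i + k.+1) * coef_mean 4 k.+1.
Proof. by rewrite ratioE big_ord_recl coef_mean_head // mulr0 add0r. Qed.

End ratios.
End boundary_values.

(** * Calculus on the half-plane *)

Lemma is_derive_cvg {R : realType} (g : R -> R) (a l : R) : is_derive a 1 g l ->
  h^-1 * (g (a + h) - g a) @[h --> 0^'] --> l.
Proof.
case=> /cvg_ex[/= l' hl'] <-.
have -> : 'D_1 g a = l' by apply/cvg_lim.
move: hl'; apply: cvg_trans; apply: near_eq_cvg; near=> h.
by rewrite [a + h]addrC /GRing.scale /= mulr1.
Unshelve. all: by end_near. Qed.

Lemma is_derive_continuous {R : realType} (g : R -> R) (a l : R) :
  is_derive a 1 g l -> g u @[u --> a] --> g a.
Proof.
move=> h; apply: differentiable_continuous.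
exact/derivable1_diffP/(@ex_derive _ _ _ _ _ _ _ h).
Qed.

Section partial_calculus.
Context {R : realType}.
Implicit Types (f g : R * R -> R) (t : R * R) (i : 'I_2) (l : R).

Definition is_partial i f t l := diff_quot i f t @ increments i t --> l.

#[global] Instance increments_filter i t : Filter (increments i t).
Proof. exact: within_filter. Qed.

Lemma near_increments i t (Q : R -> Prop) (e : R) : 0 < e ->
  (forall h, h != 0 -> `|h| < e -> half_plane (t + h *: coord_dir i) -> Q h) ->
  \forall h \near increments i t, Q h.
Proof.
move=> e0 hQ; rewrite /increments /within /dnbhs /within /=.
exists e => //= h; rewrite /ball_ /= sub0r normrN => he h0 hp.
exact: hQ.
Qed.

Lemma increments_cvg0 i t : h @[h --> increments i t] --> (0 : R).
Proof.
apply/cvgrPdist_lt => e e0; apply: (near_increments e0) => h _ he _.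
by rewrite sub0r normrN.
Qed.

Lemma increments_proper i t : half_plane t -> ProperFilter (increments i t).
Proof.
move=> ht; apply: Build_ProperFilter_ex => Q; rewrite /increments /within /dnbhs /within /=.
(* A positive increment stays in the half-plane in both directions. *)
case=> e /= e0 hQ; exists (e / 2); apply: hQ => /=.
- by rewrite sub0r normrN gtr0_norm ?divr_gt0 // ltr_pdivrMr // ltr_pMr // ltr1n.
- by rewrite gt_eqF // divr_gt0.
- rewrite /half_plane /= addr_ge0 // /GRing.scale /= mulr_ge0 ?divr_ge0 ?(ltW e0) //.
  by rewrite /coord_dir; case: ifP.
Qed.

Lemma is_partialE i f t l : half_plane t -> is_partial i f t l ->
  has_partial i f t /\ partial i f t = l.
Proof.
move=> ht h; split; first by apply/cvg_ex; exists l.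
have p := increments_proper i ht.
exact: (@cvg_lim _ (@Rhausdorff R)).
Qed.

Lemma shift_diff_quot i f t h :
  f (t + h *: coord_dir i) = f t + h * diff_quot i f t h.
Proof.
rewrite /diff_quot; have [->|h0] := eqVneq h 0.
  by rewrite scale0r addr0 mul0r addr0.
by rewrite mulVKf // subrKC.
Qed.

Lemma is_partial_shift i f t l : is_partial i f t l ->
  f (t + h *: coord_dir i) @[h --> increments i t] --> f t.
Proof.
move=> hf; have H : f t + h * diff_quot i f t h @[h --> increments i t] --> f t + 0 * l.
  by apply: cvgD; [exact: cvg_cst|apply: cvgM => //; exact: increments_cvg0].
move: H; rewrite mul0r addr0.
by rewrite (_ : (fun h => f t + _) = (fun h => f (t + h *: coord_dir i))) //;
  apply/funext => h; rewrite shift_diff_quot.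
Qed.

Lemma is_partial_near i f g t l :
  (\forall h \near increments i t, f (t + h *: coord_dir i) = g (t + h *: coord_dir i)) ->
  f t = g t -> is_partial i g t l -> is_partial i f t l.
Proof.
move=> fg fgt; apply: cvg_trans; apply: near_eq_cvg.
by apply: filterS fg => h fgh; rewrite /diff_quot fgh fgt.
Qed.

Lemma is_partialM i f g t l m : is_partial i f t l -> is_partial i g t m ->
  is_partial i (fun u => f u * g u) t (l * g t + f t * m).
Proof.
move=> hf hg; have gs := is_partial_shift hg.
apply: cvg_trans (cvgD (cvgM hf gs) (cvgM (cvg_cst (f t)) hg)).
apply: near_eq_cvg; near=> h.
by rewrite /diff_quot /GRing.mul_fun /GRing.add_fun /= ?fctE; ring.
Unshelve. all: by end_near. Qed.

Lemma is_partial_cst i (r : R) t : is_partial i (fun=> r) t 0.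
Proof.
rewrite /is_partial /diff_quot; under eq_fun do rewrite subrr mulr0.
exact: cvg_cst.
Qed.

Lemma is_partialZ i (r : R) f t l : is_partial i f t l ->
  is_partial i (fun u => r * f u) t (r * l).
Proof.
by move=> hf; have := is_partialM (is_partial_cst i r t) hf; rewrite mul0r add0r.
Qed.

Lemma is_partialB i f g t l m : is_partial i f t l -> is_partial i g t m ->
  is_partial i (fun u => f u - g u) t (l - m).
Proof.
move=> hf hg; apply: cvg_trans (cvgB hf hg); apply: near_eq_cvg; near=> h.
by rewrite /diff_quot /= ?fctE; ring.
Unshelve. all: by end_near. Qed.

Lemma is_partialV i f t l : f t != 0 -> is_partial i f t l ->
  is_partial i (fun u => (f u)^-1) t (- l / f t ^+ 2).
Proof.
move=> f0 hf; have fs := is_partial_shift hf.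
have fn : \forall h \near increments i t, f (t + h *: coord_dir i) != 0.
  exact: (cvgr_neq0 _ fs f0).
have -> : - l / f t ^+ 2 = - (f t)^-1 * l * (f t)^-1.
  by rewrite expr2 invfM; ring.
apply: cvg_trans (cvgM (cvgM (cvg_cst (- (f t)^-1)) hf) (cvgV f0 fs)).
apply: near_eq_cvg; near=> h.
have fh : f (t + h *: coord_dir i) != 0 by near: h.
by rewrite /diff_quot /GRing.mul_fun /GRing.add_fun /= ?fctE; have [->|h0] := eqVneq h 0; [rewrite invr0; ring|field; rewrite f0 fh h0].
Unshelve. all: by end_near. Qed.

Let shift0 (b m h : R) : (b, m) + h *: coord_dir 0 = (b + h, m).
Proof.
apply: injective_projections; first by rewrite /= /GRing.scale /= mulr1.
by rewrite /= /GRing.scale /= mulr0 addr0.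
Qed.

Let shift1 (b m h : R) : (b, m) + h *: coord_dir 1 = (b, m + h).
Proof.
apply: injective_projections; first by rewrite /= /GRing.scale /= mulr0 addr0.
by rewrite /= /GRing.scale /= mulr1.
Qed.

Lemma is_partial0 f (b m l : R) :
  is_derive b 1 (fun u => f (u, m)) l -> is_partial 0 f (b, m) l.
Proof.
move=> /is_derive_cvg h; rewrite /is_partial /increments.
apply: cvg_within_filter; move: h; apply: cvg_trans; apply: near_eq_cvg; near=> h.
by rewrite /diff_quot shift0.
Unshelve. all: by end_near. Qed.

Lemma is_partial1 f (b m l : R) :
  is_derive m 1 (fun u => f (b, u)) l -> is_partial 1 f (b, m) l.
Proof.
move=> /is_derive_cvg h; rewrite /is_partial /increments.
apply: cvg_within_filter; move: h; apply: cvg_trans; apply: near_eq_cvg; near=> h.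
by rewrite /diff_quot shift1.
Unshelve. all: by end_near. Qed.

Lemma is_partial1_boundary f (b l : R) :
  (f (b, h) - f (b, 0)) / h @[h --> 0^'+] --> l -> is_partial 1 f (b, 0) l.
Proof.
move=> h; apply/cvgrPdist_lt => e e0.
move/cvgrPdist_lt : h => /(_ _ e0)[r /= r0 hr].
apply: (near_increments r0) => h h0 hrr.
rewrite shift1 add0r /half_plane /= => hp.
have h1 : 0 < h by rewrite lt_neqAle eq_sym h0.
rewrite /diff_quot shift1 add0r mulrC; apply: hr => //=.
by rewrite sub0r normrN.
Qed.

End partial_calculus.

Lemma is_derive_pow {R : realType} (n : nat) (x : R) :
  is_derive x 1 (fun l => l ^+ n.+1) (n.+1%:R * x ^+ n).
Proof.
elim: n => [|n IH].
  by rewrite mulr1; under eq_fun do rewrite expr1; exact: is_derive_id.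
under eq_fun do rewrite exprS.
apply: (is_derive_eq (is_deriveM (is_derive_id x (1 : R)) IH)).
by rewrite /GRing.scale /= mulr1 -[in RHS]natr1 mulrDl mul1r mulrCA -exprS.
Qed.

(** * Taylor expansions at 0 for a chain of derivatives *)

Section taylor.
Context {R : realType}.
Variable r : nat -> R -> R.
Implicit Types (l x : R).
Hypothesis dr : forall j l, -1 < l < 1 -> is_derive l 1 (r j) (r j.+1 l).

Let r_cont j l : -1 < l < 1 -> {for l, continuous (r j)}.
Proof.
by move=> /(dr j) /is_derive_continuous.
Qed.

(** Each use of the mean value theorem gains a factor [l] and keeps the constant [K], so bounds
    uniform in beta give remainders uniform in beta. *)
Lemma taylor_bound (K : R) n j l : 0 <= l < 1 ->
  (forall i, (i < n)%N -> r (j + i) 0 = 0) ->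
  (forall l, 0 <= l < 1 -> `|r (j + n) l| <= K) -> `|r j l| <= K * l ^+ n.
Proof.
elim: n j l => [|n IH] j l l01 r0 hK.
  by rewrite mulr1 -(addn0 j) hK.
have [l0 l1] := andP l01.
have K0 : 0 <= K by rewrite (le_trans _ (hK 0 _)) ?lexx ?ltr01.
have [->|ln0] := eqVneq l 0.
  by have := r0 0%N isT; rewrite addn0 => ->; rewrite normr0 mulr_ge0 ?exprn_ge0.
have lp : 0 < l by rewrite lt_neqAle eq_sym ln0.
have d x : x \in `]0, l[ -> is_derive x 1 (r j) (r j.+1 x).
  rewrite in_itv /= => /andP[x0 xl]; apply: dr.
  by rewrite (lt_trans _ x0) ?ltrN10 //= (lt_trans xl).
have c : {within `[0, l], continuous (r j)}.
  apply: derivable_within_continuous => x; rewrite in_itv /= => /andP[x0 xl].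
  have x1 : -1 < x < 1 by rewrite (lt_le_trans _ x0) ?ltrN10 //= (le_lt_trans xl).
  exact: (@ex_derive _ _ _ _ _ _ _ (dr j x1)).
have [x] := MVT lp d c; rewrite in_itv /= => /andP[x0 xl].
have := r0 0%N isT; rewrite addn0 => ->; rewrite !subr0 => ->.
have hx : `|r j.+1 x| <= K * x ^+ n.
  apply: IH; first by rewrite (ltW x0) (lt_trans xl).
    by move=> i i_n; rewrite addSnnS r0.
  by move=> y y1; rewrite addSnnS hK.
rewrite normrM (gtr0_norm lp) exprSr mulrA ler_pM2r // (le_trans hx) //.
by rewrite ler_wpM2l // lerXn2r ?nnegrE ?ltW.
Qed.

(** Induction by l'Hopital's rule, each step contributing one factor of the factorial. *)
Lemma taylor_limit n j : (forall i, (i < n)%N -> r (j + i) 0 = 0) ->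
  r j l / l ^+ n @[l --> 0^'+] --> r (j + n) 0 / n`!%:R.
Proof.
have z1 : -1 < (0 : R) < 1 by rewrite ltrN10 ltr01.
elim: n j => [|n IH] j r0.
  rewrite addn0 divr1; under eq_fun do rewrite divr1.
  by apply: cvg_at_right_filter; have := @r_cont j 0 z1.
have gd (x : R) : x \in `]0, 1[ -> is_derive x 1 (fun l => l ^+ n.+1) (n.+1%:R * x ^+ n).
  by move=> _; exact: is_derive_pow.
have rd (x : R) : x \in `]0, 1[ -> is_derive x 1 (r j) (r j.+1 x).
  by rewrite in_itv /= => /andP[x0 x1]; apply: dr; rewrite x1 (lt_trans _ x0) ?ltrN10.
apply: (lhopital_at_right ltr01 rd gd).
- have h : r j x @[x --> 0^'+] --> r j 0 by apply: cvg_at_right_filter; exact: r_cont.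
  by move: h; have := r0 0%N isT; rewrite addn0 => ->.
- have h : (x : R) ^+ n.+1 @[x --> 0^'+] --> (0 : R) ^+ n.+1.
    by apply: cvg_at_right_filter; exact: exprn_continuous.
  by move: h; rewrite expr0n.
- move=> x; rewrite in_itv /= => /andP[x0 _].
  by rewrite mulf_neq0 ?pnatr_eq0 // expf_neq0 // gt_eqF.
- have h : r j.+1 l / l ^+ n @[l --> 0^'+] --> r (j + n.+1) 0 / n`!%:R.
    by rewrite -addSnnS; apply: IH => i i_n; rewrite addSnnS r0.
  rewrite factS natrM.
  have -> : r (j + n.+1) 0 / (n.+1%:R * n`!%:R) =
      n.+1%:R^-1 * (r (j + n.+1) 0 / n`!%:R) by rewrite invfM; ring.
  apply: cvg_trans (cvgM (cvg_cst (n.+1%:R^-1 : R)) h).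
  by apply: near_eq_cvg; near=> x; rewrite /GRing.mul_fun /= invfM; ring.
Unshelve. all: by end_near. Qed.

End taylor.

(** * Division by powers of lambda in the coordinate mu *)

Section half_line_division.
Context {R : realType}.
Variable b0 : R.
Implicit Types (phi : nat -> nat -> R -> R -> R) (b l m : R) (t : R * R) (k i j : nat).

Local Notation box := (param_box b0).

(* [phi i j] is the i-th derivative in b and j-th derivative in l of [phi 0 0]. *)
Definition derive_jet phi :=
  (forall i j b l, box b l -> is_derive b 1 (fun u => phi i j u l) (phi i.+1 j b l)) /\
  (forall i j b l, box b l -> is_derive l 1 (fun u => phi i j b u) (phi i j.+1 b l)).

(** The uniform bounds give joint continuity at the boundary. They are available for integrals over
    the observation; the log density at a fixed observation is treated with [derive_jet]. *)
Definition smooth_jet phi := [/\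
  forall i j b l, box b l -> is_derive b 1 (fun u => phi i j u l) (phi i.+1 j b l),
  forall i j b l, box b l -> is_derive l 1 (fun u => phi i j b u) (phi i j.+1 b l) &
  forall i j, exists C, forall b l, box b l -> `|phi i j b l| <= C].

Definition jet_beta phi i j := phi i.+1 j.

(* The jet of [l d/dl phi - k phi], which is what the mu-derivative of
   [phi / l^k] divides by [l^(k+2)] when [mu = l^2 / 2]. *)
Definition jet_euler k phi i j b l : R :=
  l * phi i j.+1 b l + (j%:R - k%:R) * phi i j b l.

(** This makes [phi / l^k] differentiable in mu up to the boundary. Orders up to 3 suffice because
    quotients are differentiated with [k <= 2] only, so the odd moments of the process that must
    vanish have order at most three. *)
Definition even_jet k phi := forall i j b, `|b - b0| < 1 -> (j <= 3)%N ->
  (j < k)%N || odd (j + k) -> phi i j b 0 = 0.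

(** The value at mu = 0 is the limit of the quotient [phi / l^k] when the lower Taylor coefficients
    vanish. *)
Definition jet_div k phi (t : R * R) : R :=
  if t.2 == 0 then phi 0 k t.1 0 / k`!%:R
  else phi 0 0 t.1 (Num.sqrt (2 * t.2)) / Num.sqrt (2 * t.2) ^+ k.

Definition half_box (t : R * R) : bool :=
  (`|t.1 - b0| < 1) && (0 <= t.2 < 2^-1).

Lemma half_box_half_plane t : half_box t -> half_plane t.
Proof. by case/and3P. Qed.

Lemma half_box_param t : half_box t -> box t.1 (Num.sqrt (2 * t.2)).
Proof.
case/and3P => h1 h2 h3; apply/andP; split=> //.
rewrite ger0_norm ?sqrtr_ge0 // -[ltRHS]sqrtr1 ltr_sqrt //.
by rewrite mulrC -ltr_pdivlMr // div1r.
Qed.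

Lemma param_box0 b l : box b l -> box b 0.
Proof. by move=> /andP[h _]; rewrite /param_box h normr0 ltr01. Qed.

Lemma smooth_jetW phi : smooth_jet phi -> derive_jet phi.
Proof. by case. Qed.

Lemma smooth_jet_beta phi : smooth_jet phi -> smooth_jet (jet_beta phi).
Proof. by case=> h1 h2 h3; split=> i j *; [exact: h1|exact: h2|exact: h3]. Qed.

Lemma smooth_jet_euler k phi : smooth_jet phi -> smooth_jet (jet_euler k phi).
Proof.
case=> h1 h2 h3; split=> [i j b l bx|i j b l bx|i j].
- apply: (is_derive_eq (is_deriveD
    (is_deriveM (is_derive_cst l _ _) (h1 i j.+1 b l bx))
    (is_deriveM (is_derive_cst (j%:R - k%:R : R) _ _) (h1 i j b l bx)))).
  by rewrite /jet_euler /GRing.scale /=; ring.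
- apply: (is_derive_eq (is_deriveD
    (is_deriveM (is_derive_id l (1 : R)) (h2 i j.+1 b l bx))
    (is_deriveM (is_derive_cst (j%:R - k%:R : R) _ _) (h2 i j b l bx)))).
  by rewrite /jet_euler /GRing.scale /= -natr1; ring.
- have [C hC] := h3 i j.+1; have [C' hC'] := h3 i j.
  exists (C + `|j%:R - k%:R| * C') => b l bx.
  rewrite (le_trans (ler_normD _ _)) // lerD // normrM.
    rewrite (le_trans _ (hC b l bx)) // ler_piMl //.
    by case/andP: bx => _ /ltW.
  by rewrite ler_wpM2l // hC'.
Qed.

Lemma even_jet_beta k phi : even_jet k phi -> even_jet k (jet_beta phi).
Proof. by move=> h i j b; exact: h. Qed.

(** The operator l d/dl - k kills the monomial of degree [k]; by parity the order of vanishing then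
    rises to [k.+2]. *)
Lemma even_jet_euler k phi : even_jet k phi -> even_jet k.+2 (jet_euler k phi).
Proof.
move=> h i j b bb j3 hj; rewrite /jet_euler mul0r add0r.
have [->|jk] := eqVneq j k; first by rewrite subrr mul0r.
rewrite h ?mulr0 //; move: hj; rewrite !addnS /= negbK.
case/orP => [|->]; last by rewrite orbT.
rewrite ltnS leq_eqVlt => /orP[/eqP ->|]; first by rewrite addSn /= oddD addbb orbT.
by rewrite ltnS leq_eqVlt (negbTE jk) /= => ->.
Qed.

(** A function of beta that is zero on an interval has zero derivatives there, so only [i = 0] has
    to be checked. *)
Lemma even_jetP k phi : derive_jet phi ->
  (forall j b, `|b - b0| < 1 -> (j <= 3)%N -> (j < k)%N || odd (j + k) ->
     phi 0 j b 0 = 0) -> even_jet k phi.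
Proof.
move=> [h1 _] h0 i j b bb j3 jk; elim: i b bb => [|i IH] b bb; first exact: h0.
have bx : box b 0 by rewrite /param_box bb normr0 ltr01.
have n : \forall u \near b, cst (0 : R) u = phi i j u 0.
  have e0 : 0 < 1 - `|b - b0| by rewrite subr_gt0.
  exists (1 - `|b - b0|) => //= u; rewrite /ball_ /= => ub.
  rewrite IH // (le_lt_trans (ler_distD b _ _)) // -ltrBrDr distrC.
  by rewrite (lt_le_trans ub).
have d := near_eq_is_derive n (is_derive_cst (0 : R) b (1 : R)).
have := @derive_val _ _ _ _ _ _ _ (h1 i j b 0 bx).
by rewrite (@derive_val _ _ _ _ _ _ _ d) => <-.
Qed.

Section division.
Variable phi : nat -> nat -> R -> R -> R.
Hypothesis dphi : derive_jet phi.

Let l1_box b l : `|b - b0| < 1 -> -1 < l < 1 -> box b l.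
Proof. by move=> bb l1; rewrite /param_box bb ltr_norml. Qed.

(* [phi] minus its Taylor monomial of order [k], with its l-derivatives. *)
Let remainder k b j l : R :=
  phi 0 j b l - (if (j <= k)%N then phi 0 k b 0 / (k - j)`!%:R * l ^+ (k - j) else 0).

Let remainder_derive k b : `|b - b0| < 1 -> forall j l, -1 < l < 1 ->
  is_derive l 1 (remainder k b j) (remainder k b j.+1 l).
Proof.
move=> bb j l l1; have [_ h2] := dphi; have d := h2 0%N j b l (l1_box bb l1).
rewrite /remainder; have [kj|jk|jk] := ltngtP j k.
- have [n kE] : exists n, (k - j = n.+1)%N.
    by exists (k - j).-1; rewrite prednK // subn_gt0.
  rewrite subnS kE /=.
  apply: (is_derive_eq (is_deriveB d (is_deriveM
    (is_derive_cst (phi 0 k b 0 / n.+1`!%:R) _ _) (is_derive_pow n l)))).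
  have F : n`!%:R != 0 :> R by rewrite pnatr_eq0 -lt0n fact_gt0.
  have N : n.+1%:R != 0 :> R by rewrite pnatr_eq0.
  rewrite /GRing.scale /= factS natrM; move: F N.
  move: (n`!%:R) (n.+1%:R) => F N F0 N0; field.
  by rewrite F0 N0.
- by apply: (is_derive_eq (is_deriveB d (is_derive_cst (0 : R) _ _))).
- move: d; rewrite jk subnn => d; under eq_fun do rewrite expr0 mulr1.
  by apply: (is_derive_eq (is_deriveB d (is_derive_cst (phi 0 k b 0 / 0`!%:R) _ _))).
Qed.

Lemma jet_div_limit k b : even_jet k phi -> (k <= 2)%N -> `|b - b0| < 1 ->
  (phi 0 0 b l / l ^+ k - phi 0 k b 0 / k`!%:R) / (l ^+ 2 / 2) @[l --> 0^'+] -->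
  jet_euler k phi 0 k.+2 b 0 / k.+2`!%:R.
Proof.
move=> ephi k2 bb.
have r0 i : (i < k.+2)%N -> remainder k b (0 + i) 0 = 0.
  rewrite add0n /remainder ltnS => ik.
  have [ik'|ki|->] := ltngtP i k.
  - have i3 : (i <= 3)%N by rewrite (leq_trans (ltnW ik')) // (leq_trans k2).
    have z : phi 0 i b 0 = 0 by apply: ephi => //; rewrite ik'.
    by rewrite z expr0n subn_eq0 leqNgt ik' mulr0 subr0.
  - have -> : i = k.+1 by apply/eqP; rewrite eqn_leq ik ki.
    by rewrite subr0; apply: ephi => //; rewrite addSn /= oddD addbb orbT.
  - by rewrite subnn expr0 divr1 mulr1 subrr.
have := taylor_limit (remainder_derive k bb) r0.
rewrite add0n {2}/remainder ltnNge leqnSn /= subr0 => h.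
(* At 0 the Euler operator multiplies the coefficient of order [k + 2] by 2, which matches the
   division by [l ^+ 2 / 2]. *)
have -> : jet_euler k phi 0 k.+2 b 0 / k.+2`!%:R =
    2 * (phi 0 k.+2 b 0 / k.+2`!%:R).
  by rewrite /jet_euler mul0r add0r -!natr1; ring.
apply: cvg_trans (cvgM (cvg_cst (2 : R)) h).
apply: near_eq_cvg; near=> l.
have l0 : l != 0 by rewrite gt_eqF //; near: l; exact: nbhs_right_gt.
rewrite /GRing.mul_fun /= /remainder leq0n subn0 !exprS; field.
by rewrite l0 expf_neq0 // pnatr_eq0 -lt0n fact_gt0.
Unshelve. all: by end_near. Qed.

Let sqrt2_right : (fun h : R => Num.sqrt (2 * h)) @ 0^'+ --> (0 : R)^'+.
Proof.
move=> A [e /= e0 hA]; exists (e ^+ 2 / 2) => /=; first by rewrite divr_gt0 ?exprn_gt0.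
move=> h /=; rewrite sub0r normrN => he h0; apply: hA => /=.
  rewrite sub0r normrN ger0_norm ?sqrtr_ge0 //.
  have -> : e = Num.sqrt (e ^+ 2) by rewrite sqrtr_sqr gtr0_norm.
  rewrite ltr_sqrt ?exprn_gt0 // mulrC -ltr_pdivlMr //.
  by rewrite -(gtr0_norm h0).
by rewrite sqrtr_gt0 mulr_gt0.
Qed.

Lemma is_partial1_jet_div_boundary k b : even_jet k phi -> (k <= 2)%N ->
  `|b - b0| < 1 ->
  is_partial 1 (jet_div k phi) (b, 0) (jet_div k.+2 (jet_euler k phi) (b, 0)).
Proof.
move=> ephi k2 bb; apply: is_partial1_boundary.
rewrite {2 3}/jet_div /= eqxx.
have := cvg_comp _ _ sqrt2_right (jet_div_limit ephi k2 bb).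
apply: cvg_trans; apply: near_eq_cvg; near=> h.
have h0 : 0 < h by near: h; exact: nbhs_right_gt.
rewrite /= /jet_div /= gt_eqF // sqr_sqrtr ?mulr_ge0 ?(ltW h0) //.
by rewrite [2 * h]mulrC mulfK.
Unshelve. all: by end_near. Qed.

Let is_derive_powN (n : nat) (x : R) : x != 0 ->
  is_derive x 1 (fun l => (l ^+ n)^-1) (- n%:R / x ^+ n.+1).
Proof.
move=> x0; case: n => [|n].
  rewrite oppr0 mul0r; under eq_fun do rewrite expr0 invr1.
  exact: is_derive_cst.
have xn : x ^+ n.+1 != 0 by rewrite expf_neq0.
apply: (is_derive_eq (is_derive_inv (is_derive_pow n x) xn)).
rewrite !exprS; field; by rewrite x0 expf_neq0.
Qed.

Let is_derive_sqrt2 m : 0 < m ->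
  is_derive m 1 (fun u => Num.sqrt (2 * u)) (Num.sqrt (2 * m))^-1.
Proof.
move=> m0; have m2 : 0 < 2 * m by rewrite mulr_gt0.
apply: (is_derive_eq (is_derive_comp1 (is_derive1_sqrt m2)
  (is_deriveM (is_derive_cst (2 : R) m (1 : R)) (is_derive_id m (1 : R))))).
rewrite /GRing.scale /= mulr1 mulr0 addr0 invfM; field.
by rewrite sqrtr_eq0 -ltNge.
Qed.

(** As dl/dmu = 1/l, the derivative is again a jet divided by a power of [l], so second derivatives
    come from the same lemma. *)
Lemma is_partial1_jet_div k t : even_jet k phi -> (k <= 2)%N -> half_box t ->
  is_partial 1 (jet_div k phi) t (jet_div k.+2 (jet_euler k phi) t).
Proof.
case: t => b m ephi k2 bm; case/and3P: (bm) => /= bb; rewrite le_eqVlt.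
case/orP => [/eqP <- _|m0 m2]; first exact: is_partial1_jet_div_boundary.
have bx := half_box_param bm.
apply: is_partial1; set l := Num.sqrt (2 * m).
have l0 : l != 0 by rewrite sqrtr_eq0 -ltNge mulr_gt0.
have [_ h2] := dphi.
have d := @is_derive_comp1 R _ (fun u => Num.sqrt (2 * u)) m _ _ (is_deriveM (h2 0%N 0%N b l bx) (is_derive_powN k l0))
  (is_derive_sqrt2 m0).
have n : \forall u \near m, phi 0 0 b (Num.sqrt (2 * u)) *
    (Num.sqrt (2 * u) ^+ k)^-1 = jet_div k phi (b, u).
  by near=> u; rewrite /jet_div /= gt_eqF //; near: u; exact: lt_nbhsr.
apply: (is_derive_eq (near_eq_is_derive n d)).
rewrite /jet_div /= gt_eqF // -/l /jet_euler /GRing.scale /= !exprS; field.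
by rewrite l0 expf_neq0.
Unshelve. all: by end_near. Qed.

Lemma is_partial0_jet_div k t : half_box t ->
  is_partial 0 (jet_div k phi) t (jet_div k (jet_beta phi) t).
Proof.
case: t => b m bm; have bx := half_box_param bm; have [h1 _] := dphi.
apply: is_partial0; rewrite /jet_div /=; case: ifPn => m0.
  apply: (is_derive_eq (is_deriveM (h1 0%N k b 0 (param_box0 bx))
    (is_derive_cst (k`!%:R^-1 : R) _ _))).
  by rewrite /GRing.scale /= mulr0 add0r mulrC.
apply: (is_derive_eq (is_deriveM (h1 0%N 0%N b _ bx)
  (is_derive_cst ((Num.sqrt (2 * m) ^+ k)^-1 : R) _ _))).
by rewrite /GRing.scale /= mulr0 add0r mulrC.
Qed.

(** A Taylor remainder uniform in beta. Limits along the lines of constant beta would not give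
    continuity in both variables, from which nondegeneracy on a whole neighbourhood is deduced. *)
Lemma jet_div_bound k : smooth_jet phi -> even_jet k phi -> (k <= 2)%N ->
  exists K, forall t, half_box t ->
  `|jet_div k phi t - phi 0 k t.1 0 / k`!%:R| <= K * Num.sqrt (2 * t.2).
Proof.
move=> [_ _ h3] ephi k2; have [K hK] := h3 0%N k.+1.
exists K => -[b m] bm; have /and3P[/= bb m0 _] := bm.
have bx := half_box_param bm.
rewrite /jet_div /=; case: ifPn => [/eqP ->|m0'].
  by rewrite subrr normr0 mulr0 sqrtr0 mulr0.
set l := Num.sqrt (2 * m).
have l0 : 0 < l by rewrite sqrtr_gt0 mulr_gt0 // lt_neqAle eq_sym m0'.
have l1 : l < 1 by case/andP: bx => _; rewrite gtr0_norm.
have r0 i : (i < k.+1)%N -> remainder k b (0 + i) 0 = 0.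
  rewrite add0n /remainder ltnS => ik.
  have [ik'|ki|->] := ltngtP i k; last by rewrite subnn expr0 divr1 mulr1 subrr.
    have i3 : (i <= 3)%N by rewrite (leq_trans ik) // (leq_trans k2).
    have z : phi 0 i b 0 = 0 by apply: ephi => //; rewrite ik'.
    by rewrite z expr0n subn_eq0 leqNgt ik' mulr0 subr0.
  by move: ki; rewrite ltnNge ik.
have rK x : 0 <= x < 1 -> `|remainder k b (0 + k.+1) x| <= K.
  move=> /andP[x0 x1]; rewrite add0n /remainder ltnn subr0 hK //.
  by rewrite /param_box bb ger0_norm.
have ll : 0 <= l < 1 by rewrite (ltW l0).
have := taylor_bound (remainder_derive k bb) ll r0 rK.
rewrite {1}/remainder leq0n subn0 => H.
have -> : phi 0 0 b l / l ^+ k - phi 0 k b 0 / k`!%:R =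
    (phi 0 0 b l - phi 0 k b 0 / k`!%:R * l ^+ k) / l ^+ k.
  by rewrite mulrBl mulfK // expf_neq0 // gt_eqF.
rewrite normrM normfV [`|l ^+ k|]gtr0_norm ?exprn_gt0 // ler_pdivrMr ?exprn_gt0 //.
by rewrite (_ : K * l * l ^+ k = K * l ^+ k.+1) // exprS mulrA.
Qed.

End division.

Let cvg_half_plane_fst :
  (fun t : R * R => t.1) @ within half_plane (nbhs (b0, 0 : R)) --> b0.
Proof. by apply: cvg_within_filter; exact: cvg_fst. Qed.

Let cvg_half_plane_snd :
  (fun t : R * R => t.2) @ within half_plane (nbhs (b0, 0 : R)) --> (0 : R).
Proof. by apply: cvg_within_filter; exact: cvg_snd. Qed.

Lemma half_box_near : \forall t \near within half_plane (nbhs (b0, 0 : R)), half_box t.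
Proof.
near=> t; apply/and3P; split.
- rewrite distrC; near: t; move/cvgrPdist_lt: cvg_half_plane_fst; apply.
  exact: ltr01.
- by near: t; apply: withinT.
- have : `|0 - t.2| < 2^-1.
    by near: t; move/cvgrPdist_lt: cvg_half_plane_snd; apply; rewrite invr_gt0.
  by rewrite sub0r normrN => /(le_lt_trans (ler_norm _)).
Unshelve. all: by end_near. Qed.

Lemma jet_div_cvg k phi : smooth_jet phi -> even_jet k phi -> (k <= 2)%N ->
  jet_div k phi @ within half_plane (nbhs (b0, 0 : R)) --> jet_div k phi (b0, 0).
Proof.
move=> sphi ephi k2; have [K hK] := jet_div_bound (smooth_jetW sphi) sphi ephi k2.
have [h1 _ _] := sphi.
have bx : box b0 0 by rewrite /param_box subrr normr0 ltr01.
have c1 : phi 0 k t.1 0 / k`!%:R @[t --> within half_plane (nbhs (b0, 0 : R))]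
    --> phi 0 k b0 0 / k`!%:R.
  have c0 : phi 0 k u 0 @[u --> b0] --> phi 0 k b0 0.
    exact: (is_derive_continuous (h1 0%N k b0 0 bx)).
  by apply: cvgM; [exact: (cvg_comp _ _ cvg_half_plane_fst c0)|exact: cvg_cst].
have c2 : K * Num.sqrt (2 * t.2) @[t --> within half_plane (nbhs (b0, 0 : R))]
    --> K * Num.sqrt (2 * 0).
  have c3 : 2 * t.2 @[t --> within half_plane (nbhs (b0, 0 : R))] --> 2 * (0 : R).
    by apply: cvgM; [exact: cvg_cst|exact: cvg_half_plane_snd].
  apply: cvgM; first exact: cvg_cst.
  exact: (cvg_comp _ _ c3 (@sqrt_continuous R _)).
rewrite {2}/jet_div /= eqxx; apply/cvgrPdist_lt => e e0.
have e2 : 0 < e / 2 by rewrite divr_gt0.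
near=> t.
have h : half_box t by near: t; exact: half_box_near.
have n1 : `|phi 0 k b0 0 / k`!%:R - phi 0 k t.1 0 / k`!%:R| < e / 2.
  by near: t; move/cvgrPdist_lt: c1; apply.
have n2 : K * Num.sqrt (2 * t.2) < e / 2.
  have : `|K * Num.sqrt (2 * 0) - K * Num.sqrt (2 * t.2)| < e / 2.
    by near: t; move/cvgrPdist_lt: c2; apply.
  rewrite mulr0 sqrtr0 mulr0 sub0r normrN; apply: le_lt_trans; exact: ler_norm.
rewrite (le_lt_trans (ler_distD (phi 0 k t.1 0 / k`!%:R) _ _)) //.
rewrite [ltRHS](splitr e) ltrD // distrC (le_lt_trans (hK t h)) //.
Unshelve. all: by end_near. Qed.

End half_line_division.

(** * Curvature of a metric given by jets *)

Lemma sum_ord2 (V : nmodType) (F : 'I_2 -> V) : \sum_(l < 2) F l = F 0 + F 1.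
Proof.
rewrite big_ord_recl big_ord_recl big_ord0 addr0; congr (F _ + F _).
exact: val_inj.
Qed.

Section two_by_two.
Context {K : comUnitRingType}.
Implicit Types A : 'M[K]_2.

Lemma cofactor2 A (i j : 'I_2) :
  cofactor A i j = (-1) ^+ (i + j) * A (lift i 0) (lift j 0).
Proof. by rewrite /cofactor det_mx11 !mxE. Qed.

Lemma det2 A : \det A = A 0 0 * A 1 1 - A 0 1 * A 1 0.
Proof.
rewrite (expand_det_row A 0) sum_ord2 !cofactor2 /=.
have -> : lift (0 : 'I_2) 0 = 1 by exact: val_inj.
have -> : lift (1 : 'I_2) 0 = 0 by exact: val_inj.
by rewrite addn0 add0n expr0 expr1; ring.
Qed.

Lemma invmx2 A (i j : 'I_2) : A \in unitmx ->
  invmx A i j = (\det A)^-1 * ((-1) ^+ (j + i) * A (lift j 0) (lift i 0)).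
Proof. by move=> uA; rewrite /invmx uA !mxE cofactor2. Qed.

End two_by_two.

Section boundary_curvature_formula.
Context {R : realType}.
Variables (b0 : R) (phi : nat -> nat -> nat -> R -> R -> R).
Variable g : R * R -> 'M[R]_2.
Hypothesis sphi : forall n, (n <= 2)%N -> smooth_jet b0 (phi n).
Hypothesis ephi : forall n, (n <= 2)%N -> even_jet b0 n (phi n).
Hypothesis gE : forall t, half_box b0 t -> forall i j : 'I_2,
  g t i j = jet_div (i + j) (phi (i + j)%N) t.
Implicit Types (t : R * R) (i j k : 'I_2) (l : R).

Let ent n t := jet_div n (phi n) t.

Let dent (i : 'I_2) n t := if i == 0 then jet_div n (jet_beta (phi n)) t
  else jet_div n.+2 (jet_euler n (phi n)) t.

Let t0 : R * R := (b0, 0).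

Let t0_box : half_box b0 t0.
Proof. by rewrite /half_box /= subrr normr0 ltr01 lexx invr_gt0 ltr0n. Qed.

Let det t := ent 0 t * ent 2 t - ent 1 t ^+ 2.

Hypothesis det0 : det t0 != 0.

Lemma near_half_box i t : half_box b0 t ->
  \forall h \near increments i t, half_box b0 (t + h *: coord_dir i).
Proof.
case: t => b m bm; have /and3P[/= bb m0 m2] := bm.
pose e := Num.min (1 - `|b - b0|) (2^-1 - m).
have e0 : 0 < e by rewrite lt_min !subr_gt0 bb m2.
apply: (near_increments e0) => h h0; rewrite lt_min => /andP[he1 he2].
rewrite /half_plane /half_box /= => hp; rewrite hp /=.
have [i0|i1] := eqVneq i 0.
  rewrite i0 /coord_dir /= /GRing.scale /= mulr1 mulr0 addr0 m2 andbT.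
  by rewrite addrAC (le_lt_trans (ler_normD _ _)) // -ltrBrDl.
rewrite /coord_dir (negbTE i1) /= /GRing.scale /= mulr1 mulr0 addr0 bb /=.
by rewrite -ltrBrDl (le_lt_trans (ler_norm _)).
Qed.

Let is_partial_box i (f f' : R * R -> R) t l : half_box b0 t ->
  (forall u, half_box b0 u -> f u = f' u) -> is_partial i f' t l -> is_partial i f t l.
Proof.
move=> ht ff'; apply: is_partial_near; last exact: ff'.
by apply: filterS (near_half_box i ht) => h; exact: ff'.
Qed.

Let is_partial_ent i n t : half_box b0 t -> (n <= 2)%N ->
  is_partial i (ent n) t (dent i n t).
Proof.
move=> ht n2; rewrite /dent; have [->|i1] := eqVneq i 0.
  by apply: is_partial0_jet_div ht; exact/smooth_jetW/sphi.
have -> : i = 1 by apply: val_inj; case: i i1 => -[|[|//]].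
by apply: is_partial1_jet_div ht => //; [exact/smooth_jetW/sphi|exact: ephi].
Qed.

Let ord2_sum (i j : 'I_2) : (i + j <= 2)%N.
Proof. by case: i j => -[|[|//]] ? [[|[|//]] ?]. Qed.

Lemma is_partial_metric i j k t : half_box b0 t ->
  is_partial i (fun u => g u j k) t (dent i (j + k) t).
Proof.
move=> ht; have h := @is_partial_ent i (j + k)%N t ht (ord2_sum j k).
by apply: (@is_partial_box i _ (ent (j + k)%N) t _ ht _ h) => u hu; rewrite gE.
Qed.

Let partial_metric i j k t : half_box b0 t ->
  partial i (fun u => g u j k) t = dent i (j + k) t.
Proof.
move=> ht; have hp := half_box_half_plane ht.
by have [_ ->] := is_partialE hp (@is_partial_metric i j k t ht).
Qed.

Let detE t : half_box b0 t -> \det (g t) = det t.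
Proof. by move=> ht; rewrite det2 !gE // /det expr2. Qed.

Let unitE t : half_box b0 t -> (g t \in unitmx) = (det t != 0).
Proof. by move=> ht; rewrite unitmxE detE // unitfE. Qed.

Let inv00 t : half_box b0 t -> det t != 0 -> invmx (g t) 0 0 = ent 2 t / det t.
Proof.
move=> ht d0; rewrite invmx2 ?unitE // detE // gE //=; rewrite /ent mulrC; congr (_ * _).
by rewrite expr0 mul1r.
Qed.

Let inv01 t : half_box b0 t -> det t != 0 -> invmx (g t) 0 1 = - ent 1 t / det t.
Proof.
move=> ht d0; rewrite invmx2 ?unitE // detE // gE //=; rewrite /ent mulrC; congr (_ * _).
by rewrite expr1 mulN1r.
Qed.

Let inv10 t : half_box b0 t -> det t != 0 -> invmx (g t) 1 0 = - ent 1 t / det t.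
Proof.
move=> ht d0; rewrite invmx2 ?unitE // detE // gE //=; rewrite /ent mulrC; congr (_ * _).
by rewrite expr1 mulN1r.
Qed.

Let inv11 t : half_box b0 t -> det t != 0 -> invmx (g t) 1 1 = ent 0 t / det t.
Proof.
move=> ht d0; rewrite invmx2 ?unitE // detE // gE //=; rewrite /ent mulrC; congr (_ * _).
by rewrite expr2 mulrN1 opprK mul1r.
Qed.

(* Christoffel symbols of the second kind from those of the first kind. *)
Let raise0 (x y : R * R -> R) t := (ent 2 t * x t - ent 1 t * y t) / det t.
Let raise1 (x y : R * R -> R) t := (ent 0 t * y t - ent 1 t * x t) / det t.

Let first00_0 t := dent 0 0 t / 2.
Let first00_1 t := dent 0 1 t - dent 1 0 t / 2.
Let first01_0 t := dent 1 0 t / 2.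
Let first01_1 t := dent 0 2 t / 2.
Let first11_0 t := dent 1 1 t - dent 0 2 t / 2.
Let first11_1 t := dent 1 2 t / 2.

Let christ0 i j t x y : half_box b0 t -> det t != 0 ->
  2^-1 * (dent i (j + 0) t + dent j (i + 0) t - dent 0 (i + j) t) = x t ->
  2^-1 * (dent i (j + 1) t + dent j (i + 1) t - dent 1 (i + j) t) = y t ->
  christoffel g 0 i j t = raise0 x y t.
Proof.
move=> ht d0 hx hy.
by rewrite /christoffel sum_ord2 !partial_metric // inv00 // inv01 // /raise0 -hx -hy /=; ring.
Qed.

Let christ1 i j t x y : half_box b0 t -> det t != 0 ->
  2^-1 * (dent i (j + 0) t + dent j (i + 0) t - dent 0 (i + j) t) = x t ->
  2^-1 * (dent i (j + 1) t + dent j (i + 1) t - dent 1 (i + j) t) = y t ->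
  christoffel g 1 i j t = raise1 x y t.
Proof.
move=> ht d0 hx hy.
by rewrite /christoffel sum_ord2 !partial_metric // inv10 // inv11 // /raise1 -hx -hy /=; ring.
Qed.

Let is_partial_det i t : half_box b0 t -> is_partial i det t
  (dent i 0 t * ent 2 t + ent 0 t * dent i 2 t - 2 * ent 1 t * dent i 1 t).
Proof.
move=> ht; have p0 := @is_partial_ent i 0 t ht isT.
have p1 := @is_partial_ent i 1 t ht isT.
have p2 := @is_partial_ent i 2 t ht isT.
have := is_partialB (is_partialM p0 p2) (is_partialM p1 p1).
by rewrite (_ : dent i 1 t * ent 1 t + _ = 2 * ent 1 t * dent i 1 t) //; ring.
Qed.

Let is_partial_raise0 i x y t x' y' : half_box b0 t -> det t != 0 ->
  is_partial i x t x' -> is_partial i y t y' -> is_partial i (raise0 x y) t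
  ((dent i 2 t * x t + ent 2 t * x' - dent i 1 t * y t - ent 1 t * y') / det t -
   (ent 2 t * x t - ent 1 t * y t) *
   (dent i 0 t * ent 2 t + ent 0 t * dent i 2 t - 2 * ent 1 t * dent i 1 t)
   / det t ^+ 2).
Proof.
move=> ht d0 px py.
have p1 := @is_partial_ent i 1 t ht isT.
have p2 := @is_partial_ent i 2 t ht isT.
have := is_partialM (is_partialB (is_partialM p2 px) (is_partialM p1 py))
  (is_partialV d0 (@is_partial_det i t ht)).
by congr (is_partial _ _ _ _); field.
Qed.

Let is_partial_raise1 i x y t x' y' : half_box b0 t -> det t != 0 ->
  is_partial i x t x' -> is_partial i y t y' -> is_partial i (raise1 x y) t
  ((dent i 0 t * y t + ent 0 t * y' - dent i 1 t * x t - ent 1 t * x') / det t -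
   (ent 0 t * y t - ent 1 t * x t) *
   (dent i 0 t * ent 2 t + ent 0 t * dent i 2 t - 2 * ent 1 t * dent i 1 t)
   / det t ^+ 2).
Proof.
move=> ht d0 px py.
have p1 := @is_partial_ent i 1 t ht isT.
have p0 := @is_partial_ent i 0 t ht isT.
have := is_partialM (is_partialB (is_partialM p0 py) (is_partialM p1 px))
  (is_partialV d0 (@is_partial_det i t ht)).
by congr (is_partial _ _ _ _); field.
Qed.

Let near_det i : \forall h \near increments i t0, det (t0 + h *: coord_dir i) != 0.
Proof. exact: (cvgr_neq0 _ (is_partial_shift (@is_partial_det i t0 t0_box)) det0). Qed.

Let is_partial_christ i (f f' : R * R -> R) l :
  (forall t, half_box b0 t -> det t != 0 -> f t = f' t) ->
  is_partial i f' t0 l -> is_partial i f t0 l.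
Proof.
move=> ff'; apply: is_partial_near; last exact: ff'.
near=> h; apply: ff'; first by near: h; exact: near_half_box.
by near: h; exact: near_det.
Unshelve. all: by end_near. Qed.

Let smooth0 := sphi (isT : (0 <= 2)%N).
Let smooth1 := sphi (isT : (1 <= 2)%N).
Let smooth2 := sphi (isT : (2 <= 2)%N).

Let F01 := jet_div 3 (jet_beta (jet_euler 1 (phi 1))) t0.
Let G00 := jet_div 2 (jet_beta (jet_beta (phi 2))) t0.
(** [G01] and [G10] are the mixed derivatives of g_11 that enter through the Christoffel symbols.
    Lowering the index with row 0 of the metric leaves derivatives of first-kind symbols with last
    index 0 only, so both drop out of the curvature. *)
Let G01 := jet_div 4 (jet_beta (jet_euler 2 (phi 2))) t0.
Let G10 := jet_div 4 (jet_euler 2 (jet_beta (phi 2))) t0.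
Let E11 := jet_div 4 (jet_euler 2 (jet_euler 0 (phi 0))) t0.

Let is_partial_half i x t l : is_partial i x t l -> is_partial i (fun u => x u / 2) t (l / 2).
Proof.
move=> h; have := @is_partialZ _ i 2^-1 x t l h; rewrite mulrC.
rewrite (_ : (fun u => 2^-1 * x u) = (fun u => x u / 2)) //.
by apply/funext => u; rewrite mulrC.
Qed.

Let p_first11_0 : is_partial 0 first11_0 t0 (F01 - G00 / 2).
Proof.
apply: is_partialB.
  by apply: is_partial0_jet_div t0_box; exact/smooth_jetW/(smooth_jet_euler 1 smooth1).
apply: is_partial_half.
by apply: is_partial0_jet_div t0_box; exact/smooth_jetW/(smooth_jet_beta smooth2).
Qed.

Let p_first11_1 : is_partial 0 first11_1 t0 (G01 / 2).
Proof.
apply: is_partial_half.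
by apply: is_partial0_jet_div t0_box; exact/smooth_jetW/(smooth_jet_euler 2 smooth2).
Qed.

Let p_first01_0 : is_partial 1 first01_0 t0 (E11 / 2).
Proof.
apply: is_partial_half.
apply: is_partial1_jet_div t0_box => //; first exact/smooth_jetW/(smooth_jet_euler 0 smooth0).
by apply: even_jet_euler; exact: ephi.
Qed.

Let p_first01_1 : is_partial 1 first01_1 t0 (G10 / 2).
Proof.
apply: is_partial_half.
apply: is_partial1_jet_div t0_box => //; first exact/smooth_jetW/(smooth_jet_beta smooth2).
by apply: even_jet_beta; exact: ephi.
Qed.

Let chr0 i j x y : (forall t, x t = 2^-1 * (dent i (j + 0) t + dent j (i + 0) t - dent 0 (i + j) t)) ->
  (forall t, y t = 2^-1 * (dent i (j + 1) t + dent j (i + 1) t - dent 1 (i + j) t)) ->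
  forall t, half_box b0 t -> det t != 0 -> christoffel g 0 i j t = raise0 x y t.
Proof. by move=> hx hy t ht d0; apply: christ0. Qed.

Let chr1 i j x y : (forall t, x t = 2^-1 * (dent i (j + 0) t + dent j (i + 0) t - dent 0 (i + j) t)) ->
  (forall t, y t = 2^-1 * (dent i (j + 1) t + dent j (i + 1) t - dent 1 (i + j) t)) ->
  forall t, half_box b0 t -> det t != 0 -> christoffel g 1 i j t = raise1 x y t.
Proof. by move=> hx hy t ht d0; apply: christ1. Qed.


Let christ11_0 t : half_box b0 t -> det t != 0 ->
  christoffel g 0 1 1 t = raise0 first11_0 first11_1 t.
Proof. by apply: chr0 => u; rewrite /first11_0 /first11_1 /=; field. Qed.

Let christ11_1 t : half_box b0 t -> det t != 0 ->
  christoffel g 1 1 1 t = raise1 first11_0 first11_1 t.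
Proof. by apply: chr1 => u; rewrite /first11_0 /first11_1 /=; field. Qed.

Let christ01_0 t : half_box b0 t -> det t != 0 ->
  christoffel g 0 0 1 t = raise0 first01_0 first01_1 t.
Proof. by apply: chr0 => u; rewrite /first01_0 /first01_1 /=; field. Qed.

Let christ01_1 t : half_box b0 t -> det t != 0 ->
  christoffel g 1 0 1 t = raise1 first01_0 first01_1 t.
Proof. by apply: chr1 => u; rewrite /first01_0 /first01_1 /=; field. Qed.

Let christ10_0 t : half_box b0 t -> det t != 0 ->
  christoffel g 0 1 0 t = raise0 first01_0 first01_1 t.
Proof. by apply: chr0 => u; rewrite /first01_0 /first01_1 /=; field. Qed.

Let christ10_1 t : half_box b0 t -> det t != 0 ->
  christoffel g 1 1 0 t = raise1 first01_0 first01_1 t.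
Proof. by apply: chr1 => u; rewrite /first01_0 /first01_1 /=; field. Qed.

Let christ00_0 t : half_box b0 t -> det t != 0 ->
  christoffel g 0 0 0 t = raise0 first00_0 first00_1 t.
Proof. by apply: chr0 => u; rewrite /first00_0 /first00_1 /=; field. Qed.

Let christ00_1 t : half_box b0 t -> det t != 0 ->
  christoffel g 1 0 0 t = raise1 first00_0 first00_1 t.
Proof. by apply: chr1 => u; rewrite /first00_0 /first00_1 /=; field. Qed.

Let p_christ11_0 := @is_partial_christ 0 _ _ _ christ11_0
  (@is_partial_raise0 0 _ _ _ _ _ t0_box det0 p_first11_0 p_first11_1).
Let p_christ11_1 := @is_partial_christ 0 _ _ _ christ11_1
  (@is_partial_raise1 0 _ _ _ _ _ t0_box det0 p_first11_0 p_first11_1).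
Let p_christ01_0 := @is_partial_christ 1 _ _ _ christ01_0
  (@is_partial_raise0 1 _ _ _ _ _ t0_box det0 p_first01_0 p_first01_1).
Let p_christ01_1 := @is_partial_christ 1 _ _ _ christ01_1
  (@is_partial_raise1 1 _ _ _ _ _ t0_box det0 p_first01_0 p_first01_1).

Let t0_half : half_plane t0. Proof. exact: half_box_half_plane t0_box. Qed.

Lemma jet_has_gauss_curvature : has_gauss_curvature g t0.
Proof.
split.
  have c n : (n <= 2)%N -> ent n @ within half_plane (nbhs t0) --> ent n t0.
    by move=> n2; apply: jet_div_cvg => //; [exact: sphi|exact: ephi].
  have cd : det @ within half_plane (nbhs t0) --> det t0.
    by rewrite /det; apply: cvgB; apply: cvgM; apply: c.
  near=> u.
  have hu : half_box b0 u by near: u; exact: half_box_near.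
  split; last first.
    move=> i j k.
    by have [] := is_partialE (half_box_half_plane hu) (@is_partial_metric i j k u hu).
  by rewrite unitE //; near: u; exact: (cvgr_neq0 _ cd det0).
move=> l; have [->|l1] := eqVneq l 0.
  by split; [have [] := is_partialE t0_half p_christ11_0|
             have [] := is_partialE t0_half p_christ01_0].
have -> : l = 1 by apply: val_inj; case: l l1 => -[|[|//]].
by split; [have [] := is_partialE t0_half p_christ11_1|
           have [] := is_partialE t0_half p_christ01_1].
Unshelve. all: by end_near. Qed.

(* Brioschi's formula. *)
Lemma jet_gauss_curvature :
  let E := phi 0 0 0 b0 0 in let E0 := phi 0 1 0 b0 0 in
  let E1 := phi 0 0 2 b0 0 in let E11 := phi 0 0 4 b0 0 / 3 in
  let F := phi 1 0 1 b0 0 in let F0 := phi 1 1 1 b0 0 in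
  let F1 := phi 1 0 3 b0 0 / 3 in let F01 := phi 1 1 3 b0 0 / 3 in
  let G := phi 2 0 2 b0 0 / 2 in let G0 := phi 2 1 2 b0 0 / 2 in
  let G1 := phi 2 0 4 b0 0 / 12 in let G00 := phi 2 2 2 b0 0 / 2 in
  gauss_curvature g t0 =
    ((F01 - E11 / 2 - G00 / 2) * (E * G - F ^+ 2)
     - E0 / 2 * ((F1 - G0 / 2) * G - F * (G1 / 2))
     + (F0 - E1 / 2) * ((F1 - G0 / 2) * F - E * (G1 / 2))
     + E1 / 2 * (E1 / 2 * G - F * (G0 / 2))
     - G0 / 2 * (E1 / 2 * F - E * (G0 / 2))) / (E * G - F ^+ 2) ^+ 2.
Proof.
move=> E E0 E1 E11' F F0 F1 F01' G G0 G1 G00'.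
have [_ r110] := is_partialE t0_half p_christ11_0.
have [_ r111] := is_partialE t0_half p_christ11_1.
have [_ r010] := is_partialE t0_half p_christ01_0.
have [_ r011] := is_partialE t0_half p_christ01_1.
rewrite /gauss_curvature sum_ord2 /riemann !sum_ord2 r110 r111 r010 r011.
rewrite detE // (gE t0_box 0 0) (gE t0_box 0 1).
rewrite christ00_0 // christ00_1 // christ01_0 // christ01_1 // christ10_0 //.
rewrite christ10_1 // christ11_0 // christ11_1 //.
have eE : ent 0 t0 = E by rewrite /ent /jet_div /= eqxx divr1.
have eF : ent 1 t0 = F by rewrite /ent /jet_div /= eqxx divr1.
have eG : ent 2 t0 = G by rewrite /ent /jet_div /= eqxx.
have eE0 : dent 0 0 t0 = E0 by rewrite /dent /jet_div /= eqxx divr1.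
have eF0 : dent 0 1 t0 = F0 by rewrite /dent /jet_div /= eqxx divr1.
have eG0 : dent 0 2 t0 = G0 by rewrite /dent /jet_div /= eqxx.
(* The factors 3 and 12 of the statement arise below: Taylor coefficients in [l] are rewritten with
   [l^2 = 2 mu], as in l^4/24 = mu^2/6. *)
have eE1 : dent 1 0 t0 = E1.
  by rewrite /dent /jet_div /= eqxx /jet_euler (_ : 2`!%N = 2%N) // /E1; field.
have eF1 : dent 1 1 t0 = F1.
  by rewrite /dent /jet_div /= eqxx /jet_euler (_ : 3`!%N = 6%N) // /F1; field.
have eG1 : dent 1 2 t0 = G1.
  by rewrite /dent /jet_div /= eqxx /jet_euler (_ : 4`!%N = 24%N) // /G1; field.
have eE11 : E11 = E11'.
  by rewrite /E11 /jet_div /= eqxx /jet_euler (_ : 4`!%N = 24%N) // /E11'; field.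
have eF01 : F01 = F01'.
  by rewrite /F01 /jet_div /= eqxx /jet_beta /jet_euler (_ : 3`!%N = 6%N) // /F01'; field.
have eG00 : G00 = G00' by rewrite /G00 /jet_div /= eqxx.
have dE : det t0 = E * G - F ^+ 2 by rewrite /det eE eF eG.
have D0 : E * G - F ^+ 2 != 0 by rewrite -dE.
rewrite -/(ent 0 t0) -/(ent 1 t0) /raise0 /raise1 /first00_0 /first00_1 /first01_0
  /first01_1 /first11_0 /first11_1 dE eE eF eG eE0 eF0 eG0 eE1 eF1 eG1 eE11 eF01 eG00.
move: E E0 E1 E11' F F0 F1 F01' G G0 G1 G00' G01 G10 D0 {eE eF eG eE0 eF0 eG0 eE1 eF1 eG1
 eE11 eF01 eG00 dE r110 r111 r010 r011}.
move=> E E0 E1 E11' F F0 F1 F01' G G0 G1 G00' g01 g10 D0.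
by field.
Qed.

End boundary_curvature_formula.

(** * Moments of time averages *)

Section moments_of_averages.
Context dS dO (S : measurableType dS) (Omega : measurableType dO) {R : realType}.
Variables (U : probability S R) (P : probability Omega R) (z : S -> Omega -> R).
Hypothesis mz : measurable_fun setT (fun p : S * Omega => z p.1 p.2).
Hypothesis bz : forall w, exists K : R, forall s, `|z s w| <= K.
Hypothesis ez : forall n : nat, exists C : R, forall s,
  L1 P (fun w => expR (n%:R * `|z s w|)) /\
  \int[P]_w expR (n%:R * `|z s w|) <= C.
Implicit Types (w : Omega) (s t u : S) (n k : nat).

Local Notation M := (fun k w => exp_moment U z k 0 w).
Local Notation W := (exp_abs U z).

(** Bounds uniform in the index are what Fubini over time requires; the index collects the times
    already frozen. *)
Definition all_moments (I : Type) (X : I -> Omega -> R) :=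
  (forall i, measurable_fun setT (X i)) /\
  forall n, exists C : R, forall i,
    L1 P (fun w => `|X i w| ^+ n) /\ \int[P]_w (`|X i w| ^+ n) <= C.

Lemma all_moments_le (I : Type) (X : I -> Omega -> R) (Y : nat -> I -> Omega -> R) :
  (forall i, measurable_fun setT (X i)) ->
  (forall n i w, `|X i w| ^+ n <= Y n i w) ->
  (forall n, exists C : R, forall i, L1 P (Y n i) /\ \int[P]_w Y n i w <= C) ->
  all_moments X.
Proof.
move=> mX XY hY; split=> // n; have [C hC] := hY n; exists C => i.
have [iY YC] := hC i.
have iX : L1 P (fun w => `|X i w| ^+ n).
  apply: (L1_le _ _ iY).
    by apply: measurable_funX; exact: measurableT_comp.
  by move=> w; rewrite ger0_norm ?exprn_ge0.
by split=> //; rewrite (le_trans _ YC) // le_Rintegral.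
Qed.

Lemma all_momentsM (I J : Type) (X : I -> Omega -> R) (Y : J -> Omega -> R) :
  all_moments X -> all_moments Y ->
  all_moments (fun (p : I * J) w => X p.1 w * Y p.2 w).
Proof.
move=> [mX hX] [mY hY].
apply: (all_moments_le (Y := fun n p w =>
  `|X p.1 w| ^+ (n * 2) + `|Y p.2 w| ^+ (n * 2))).
- by move=> p; exact: measurable_funM.
- move=> n p w; rewrite normrM exprMn !exprM.
  set x := _ ^+ n; set y := `|Y _ _| ^+ n.
  have x0 : 0 <= x by rewrite exprn_ge0.
  have y0 : 0 <= y by rewrite exprn_ge0.
  have := sqr_ge0 (x - y); rewrite sqrrB; nra.
- move=> n; have [C hC] := hX (n * 2)%N; have [C' hC'] := hY (n * 2)%N.
  exists (C + C') => p; have [i1 c1] := hC p.1; have [i2 c2] := hC' p.2.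
  by split; [exact: L1D|rewrite RintegralD // lerD].
Qed.

Lemma all_moments_L1 (I : Type) (X : I -> Omega -> R) i :
  all_moments X -> L1 P (X i).
Proof.
move=> [mX /(_ 1%N)[C /(_ i)[h _]]]; apply: (L1_le (mX i) _ h) => w.
by rewrite expr1.
Qed.

Lemma all_moments_cst : all_moments (fun (_ : unit) w => 1).
Proof.
split=> [_|n]; first exact: measurable_cst.
exists 1 => _; rewrite (_ : (fun w => `|1| ^+ n) = cst (1 : R)); last first.
  by apply/funext => w; rewrite normr1 expr1n.
by split; [exact: L1_cst|rewrite Rintegral_prob_cst].
Qed.

Lemma all_moments_z k : all_moments (fun s w => z s w ^+ k).
Proof.
apply: (all_moments_le (Y := fun n s w => expR ((k * n)%:R * `|z s w|))).
- by move=> s; apply: measurable_funX; exact: measurable_z_time.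
- move=> n s w; rewrite normrX -exprM expRM_natl lerXn2r ?nnegrE ?expR_ge0 //.
  by rewrite (le_trans _ (expR_ge1Dx _)) // lerDr.
- by move=> n; exact: ez.
Qed.

Lemma all_moments_average k : all_moments (fun (_ : unit) w => M k w).
Proof.
apply: (all_moments_le (Y := fun n _ w => W (k.+1 * 2 ^ n) w)).
- by move=> _; exact: measurable_exp_moment.
- move=> n _ w.
  have z01 : -1 < (0 : R) < 1 by rewrite ltrN10 ltr01.
  have h := exp_moment_le U mz bz k w z01.
  have W1 := exp_abs_ge1 U mz bz k.+1 w.
  have W0 : 0 <= W k.+1 w by exact: le_trans ler01 W1.
  have h' : `|M k w| ^+ n <= W k.+1 w ^+ n.
    by apply: lerXn2r h; rewrite nnegrE.
  apply: le_trans h' _.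
  (* [exp_abs] is controlled under squaring, so the power [n] is enlarged to [2 ^ n]. *)
  apply: (@le_trans _ _ (W k.+1 w ^+ (2 ^ n))).
    by rewrite ler_weXn2l // ltnW // ltn_expl.
  elim: n => [|n IH]; first by rewrite expr1 muln1.
  rewrite expnSr exprM mulnA (le_trans _ (exp_abs_sqr U mz bz _ _)) //.
  rewrite lerXn2r ?nnegrE ?exprn_ge0 // (le_trans ler01) //.
  exact: exp_abs_ge1.
- move=> n; exists (\int[P]_w W (k.+1 * 2 ^ n) w) => _.
  by split=> //; exact: L1_exp_abs.
Qed.

(** Trades one time average for an integral over a frozen time. Repeated use turns moments of
    averages into averages of moments of the process at fixed times. *)
Lemma average_fubini (I : Type) (X : I -> Omega -> R) i k : all_moments X ->
  \int[P]_w (X i w * M k w) = \int[U]_s \int[P]_w (X i w * z s w ^+ k) /\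
  L1 U (fun s => \int[P]_w (X i w * z s w ^+ k)).
Proof.
move=> hX; have hXz := all_momentsM hX (all_moments_z k).
have [_ /(_ 1%N)[C hC]] := hXz.
have E w : X i w * M k w = \int[U]_s (X i w * z s w ^+ k).
  have [K hK] := bz w.
  rewrite RintegralZl //.
    congr (_ * _); apply: eq_Rintegral => s _.
    by rewrite /exp_path mul0r expr0n mul0r subr0 expR0 mulr1.
  apply: (@L1_bounded _ _ _ _ _ (K ^+ k)).
    by apply: measurable_funX; exact: measurable_z_path.
  by move=> s; rewrite normrX lerXn2r ?nnegrE // (le_trans _ (hK s)).
have mf : measurable_fun setT (fun p : S * Omega => X i p.2 * z p.1 p.2 ^+ k).
  apply: measurable_funM; last exact: measurable_funX.
  by case: hX => mX _; apply: (measurableT_comp (mX i)).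
have if2 s : L1 P (fun w => X i w * z s w ^+ k) by exact: (all_moments_L1 (i, s) hXz).
have hC' s : \int[P]_w `|X i w * z s w ^+ k| <= C.
  by have [_] := hC (i, s); under eq_Rintegral do rewrite expr1.
have if1 w : L1 U (fun s => X i w * z s w ^+ k).
  have [K hK] := bz w; apply: L1Z; apply: (@L1_bounded _ _ _ _ _ (K ^+ k)).
    by apply: measurable_funX; exact: measurable_z_path.
  by move=> s; rewrite normrX lerXn2r ?nnegrE // (le_trans _ (hK s)).
split; last exact: (@L1_Rintegral_param _ _ _ _ _ U P (fun s w => X i w * z s w ^+ k) C mf if2 hC').
rewrite (Rintegral_swap (f := fun s w => X i w * z s w ^+ k) mf if2 hC' if1).
by apply: eq_Rintegral => w _; rewrite E.
Qed.

Hypothesis mean_z : forall s, \int[P]_w z s w = 0.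
Hypothesis mean_z2 : forall s, \int[P]_w (z s w ^+ 2) = 1.
Hypothesis mean_zzz : forall s t u, \int[P]_w (z s w * z t w * z u w) = 0.
Variable r : R.
Hypothesis r0 : 0 < r.
Hypothesis cov_z : forall s t, r <= \int[P]_w (z s w * z t w).

Let Rint0 : \int[U]_s (0 : R) = 0. Proof. exact: Rintegral_prob_cst. Qed.

Let average1 k : \int[P]_w M k w = \int[U]_s \int[P]_w (z s w ^+ k).
Proof.
have [h _] := average_fubini tt k all_moments_cst.
transitivity (\int[P]_w (1 * M k w)); first by apply: eq_Rintegral => w _; rewrite mul1r.
rewrite h; apply: eq_Rintegral => s _; apply: eq_Rintegral => w _.
by rewrite mul1r.
Qed.

Lemma mean_average1 : \int[P]_w M 1 w = 0.
Proof.
rewrite average1 -[RHS]Rint0; apply: eq_Rintegral => s _.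
by rewrite -(mean_z s); apply: eq_Rintegral => w _; rewrite expr1.
Qed.

Lemma mean_average2 : \int[P]_w M 2 w = 1.
Proof.
rewrite average1 -[RHS](Rintegral_prob_cst U); apply: eq_Rintegral => s _.
exact: mean_z2.
Qed.

Lemma mean_average3 : \int[P]_w M 3 w = 0.
Proof.
rewrite average1 -[RHS]Rint0; apply: eq_Rintegral => s _.
rewrite -(mean_zzz s s s); apply: eq_Rintegral => w _.
by rewrite !exprS mulr1 mulrA.
Qed.

Lemma mean_average12 : \int[P]_w (M 1 w * M 2 w) = 0.
Proof.
have [h _] := average_fubini tt 2 (all_moments_average 1).
rewrite h -[RHS]Rint0; apply: eq_Rintegral => s _.
have [h' _] := average_fubini s 1 (all_moments_z 2).
transitivity (\int[P]_w (z s w ^+ 2 * M 1 w)).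
  by apply: eq_Rintegral => w _; rewrite mulrC.
rewrite h' -[RHS]Rint0; apply: eq_Rintegral => t _.
rewrite -(mean_zzz s s t); apply: eq_Rintegral => w _.
by rewrite expr1.
Qed.

Lemma mean_average111 : \int[P]_w (M 1 w ^+ 3) = 0.
Proof.
have h11 := all_momentsM (all_moments_average 1) (all_moments_average 1).
have [h _] := average_fubini (tt, tt) 1 h11.
transitivity (\int[P]_w (M 1 w * M 1 w * M 1 w)).
  by apply: eq_Rintegral => w _; rewrite !exprS expr0 mulr1 mulrA.
rewrite h -[RHS]Rint0; apply: eq_Rintegral => s _.
have [h' _] := average_fubini (tt, s) 1
  (all_momentsM (all_moments_average 1) (all_moments_z 1)).
transitivity (\int[P]_w (M 1 w * z s w ^+ 1 * M 1 w)).
  by apply: eq_Rintegral => w _ /=; rewrite mulrAC.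
rewrite h' -[RHS]Rint0; apply: eq_Rintegral => t _.
have [h'' _] := average_fubini (s, t) 1
  (all_momentsM (all_moments_z 1) (all_moments_z 1)).
transitivity (\int[P]_w (z s w ^+ 1 * z t w ^+ 1 * M 1 w)).
  by apply: eq_Rintegral => w _ /=; ring.
rewrite h'' -[RHS]Rint0; apply: eq_Rintegral => u _.
by rewrite -(mean_zzz s t u); apply: eq_Rintegral => w _; rewrite /= !expr1.
Qed.

(** The second moment of the time average is the covariance averaged over both times, and the
    covariance is at least [r]. *)
Lemma mean_average11_gt0 : 0 < \int[P]_w (M 1 w ^+ 2).
Proof.
have [h i1] := average_fubini tt 1 (all_moments_average 1).
have -> : \int[P]_w (M 1 w ^+ 2) = \int[P]_w (M 1 w * M 1 w).
  by apply: eq_Rintegral => w _; rewrite expr2.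
rewrite h (lt_le_trans r0) // -[leLHS](Rintegral_prob_cst U).
apply: le_Rintegral => //; first exact: L1_cst.
move=> s _; have [h' i2] := average_fubini s 1 (all_moments_z 1).
have -> : \int[P]_w (M 1 w * z s w ^+ 1) = \int[P]_w (z s w ^+ 1 * M 1 w).
  by apply: eq_Rintegral => w _; rewrite mulrC.
rewrite h' -[leLHS](Rintegral_prob_cst U).
apply: le_Rintegral => //; first exact: L1_cst.
by move=> t _; exact: cov_z.
Qed.

End moments_of_averages.

(** * Gaussian variables and the Ornstein-Uhlenbeck process *)

Section normal_mgf.
Context {R : realType}.

(** [normal_pdf] and the Radon-Nikodym derivative have the same integral over every measurable set,
    hence agree almost everywhere. *)
Lemma ge0_integral_normal_prob (m s : R) (f : measurableTypeR R -> \bar R) :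
  measurable_fun setT f -> (forall x, 0 <= f x)%E ->
  (\int[normal_prob m s]_x f x =
   \int[lebesgue_measure]_x (f x * (normal_pdf m s x)%:E))%E.
Proof.
move=> mf f0; have dom := normal_prob_dominates m s.
have iRN := Radon_Nikodym_SigmaFinite.f_integrable dom.
have mp : measurable_fun setT (fun x => (normal_pdf m s x)%:E).
  by apply/measurable_EFinP; exact: measurable_normal_pdf.
rewrite -(Radon_Nikodym_SigmaFinite.change_of_variables dom) //.
apply: ae_eq_integral => //.
- by apply: emeasurable_funM => //; exact: measurable_int iRN.
- exact: emeasurable_funM.
- apply: ae_eqe_mul2l; apply: integral_ae_eq => // E _ mE.
  by rewrite -(Radon_Nikodym_SigmaFinite.f_integral dom).
Qed.

(** Completing the square shifts the mean to [m + s^2 t]; the shifted density has integral 1. *)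
Lemma normal_mgf (m s t : R) : s != 0 ->
  (\int[normal_prob m s]_x (expR (t * x))%:E = (expR (m * t + s ^+ 2 * t ^+ 2 / 2))%:E)%E.
Proof.
move=> s0; rewrite ge0_integral_normal_prob; first last.
- by move=> x; rewrite lee_fin expR_ge0.
- by apply/measurable_EFinP; apply: measurableT_comp => //; exact: measurable_funM.
pose c := expR (m * t + s ^+ 2 * t ^+ 2 / 2).
transitivity (\int[lebesgue_measure]_x
  (c%:E * (normal_pdf (m + s ^+ 2 * t) s x)%:E))%E.
  apply: eq_integral => x _; rewrite -!EFinM; congr EFin.
  rewrite !normal_pdfE // mulrCA [RHS]mulrCA; congr (_ * _).
  rewrite /normal_fun /c -!expRD; congr expR; field.
  by rewrite s0.
rewrite ge0_integralZl //=.
- by rewrite integral_normal_pdf mule1.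
- by apply: measurableT_comp => //; exact: measurable_normal_pdf.
- by move=> x _; rewrite lee_fin normal_pdf_ge0.
- by rewrite lee_fin expR_ge0.
Qed.

End normal_mgf.

(** Two formulas for one function give two for its derivative; moments are read off transforms in
    this way below. *)
Lemma derive_unique_itv {R : realType} (F G F' G' : R -> R) (a b : R) :
  (forall t, a < t < b -> F t = G t) ->
  (forall t, a < t < b -> is_derive t 1 F (F' t)) ->
  (forall t, a < t < b -> is_derive t 1 G (G' t)) ->
  forall t, a < t < b -> F' t = G' t.
Proof.
move=> FG dF dG t tab.
have n : \forall u \near t, F u = G u.
  have : t \in `]a, b[ by rewrite in_itv.
  move=> /near_in_itvoo; apply: filterS => u; rewrite in_itv /=; exact: FG.
have d := near_eq_is_derive n (dF t tab).
rewrite -(@derive_val _ _ _ _ _ _ _ d).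
by rewrite (@derive_val _ _ _ _ _ _ _ (dG t tab)).
Qed.

Section gaussian_variables.
Context d (Omega : measurableType d) {R : realType} (P : probability Omega R).
Variable X : Omega -> R.
Hypothesis mX : measurable_fun setT X.

(** At [s = 0] the formula gives the transform of a Dirac mass, so it fits both cases of
    [gaussian_rv]. *)
Lemma gaussian_mgf : gaussian_rv P X -> exists m s, forall t,
  L1 P (fun w => expR (t * X w)) /\
  \int[P]_w expR (t * X w) = expR (m * t + s ^+ 2 * t ^+ 2 / 2).
Proof.
case=> m [s hX]; exists m, s => t.
suff E : (\int[P]_w (expR (t * X w))%:E = (expR (m * t + s ^+ 2 * t ^+ 2 / 2))%:E)%E.
  split; last by rewrite /Rintegral E.
  apply/integrableP; split.
    apply/measurable_EFinP; apply: measurableT_comp => //; exact: measurable_funM.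
  under eq_integral do rewrite /= ger0_norm ?expR_ge0 //.
  by rewrite E ltry.
have mf : measurable_fun setT (fun x : R => (expR (t * x))%:E).
  by apply/measurable_EFinP; apply: measurableT_comp => //; exact: measurable_funM.
pose mX' := @isMeasurableFun.Build _ _ Omega (measurableTypeR R) X mX.
pose X' : {RV P >-> measurableTypeR R} := HB.pack X mX'.
have := @ge0_integral_distribution _ _ _ (measurableTypeR R) _ P X' _ mf.
move=> <-; last by move=> x; rewrite lee_fin expR_ge0.
have [s0|s0] := eqVneq s 0.
  rewrite (eq_measure_integral (@dirac _ (measurableTypeR R) m R)); last first.
    by move=> A mA _; have := hX A mA; rewrite s0 eqxx.
  rewrite integral_dirac // diracT mul1e s0; congr (expR _)%:E; ring.
rewrite -(normal_mgf m t s0); apply: eq_measure_integral => A mA _.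
by have := hX A mA; rewrite (negbTE s0).
Qed.

Hypothesis iX : forall t, L1 P (fun w => expR (t * X w)).

Lemma L1_expR_norm n : L1 P (fun w => expR (n%:R * `|X w|)) /\
  \int[P]_w expR (n%:R * `|X w|) <=
  \int[P]_w expR (n%:R * X w) + \int[P]_w expR (- n%:R * X w).
Proof.
have le w : expR (n%:R * `|X w|) <= expR (n%:R * X w) + expR (- n%:R * X w).
  have [x0|x0] := leP 0 (X w); first by rewrite ger0_norm // lerDl expR_ge0.
  by rewrite ltr0_norm // mulrN mulNr lerDr expR_ge0.
have i1 : L1 P (fun w => expR (n%:R * `|X w|)).
  apply: (L1_le _ _ (L1D (iX n%:R) (iX (- n%:R)))).
    apply: measurableT_comp => //; apply: measurable_funM => //.
    exact: measurableT_comp.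
  by move=> w; rewrite ger0_norm ?expR_ge0.
by split=> //; rewrite -RintegralD // le_Rintegral //; exact: L1D.
Qed.

Let var (t : R) (w : Omega) (_ : unit) : R := X w.
Let dvar (_ : unit) : expr unit := ECst 0.
Let pow k : expr unit := iter k (EMul (EVar tt)) (ECst 1).

Let ev_pow k t w : ev (var t w) (pow k) = X w ^+ k.
Proof. by elim: k => //= k ->; rewrite exprS. Qed.

Let mgf_dom e : exists2 G : Omega -> R, L1 P G & forall (t : R) w,
  `]-1, 1[%classic t -> `|ev (var t w) e * expR (t * X w)| <= G w.
Proof.
have gs : @growth_scale R Omega setT (fun n w => expR (n%:R * `|X w|)).
  split=> [n w _|m n w _ mn|n].
  - by rewrite -expR0 ler_expR mulr_ge0.
  - by rewrite ler_expR ler_wpM2r // ler_nat.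
  - exists (n * 2)%N => w _; rewrite expr2 -expRD ler_expR natrM; lra.
have bv v : scale_bounded setT (fun n w => expR (n%:R * `|X w|)) (fun w => var 0 w v).
  exists 1, 1%N; split=> // w _; rewrite mul1r mul1r.
  by rewrite (le_trans _ (expR_ge1Dx _)) // lerDr.
have [C [N [C0 hC]]] := scale_bounded_ev gs bv e.
(* One unit beyond [N] pays for [expR (t * X w)] with [|t| < 1]. *)
exists (fun w => C * expR (N.+1%:R * `|X w|)); first exact/L1Z/(L1_expR_norm _).1.
move=> t w; rewrite /= in_itv /= => /andP[t1 t2].
have -> : expR (N.+1%:R * `|X w|) = expR (N%:R * `|X w|) * expR (`|X w|).
  by rewrite -expRD -natr1 mulrDl mul1r.
rewrite normrM mulrA ler_pM //; first exact: hC.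
rewrite ger0_norm ?expR_ge0 // ler_expR (le_trans (ler_norm _)) // normrM.
by rewrite ler_piMl // ler_norml !ltW.
Qed.

Lemma is_derive_mgf k (t : R) : -1 < t < 1 ->
  is_derive t 1 (fun t : R => \int[P]_w (X w ^+ k * expR (t * X w)))
    (\int[P]_w (X w ^+ k.+1 * expR (t * X w))).
Proof.
move=> t1; have It : `]-1, 1[%classic t by rewrite /= in_itv.
have dx (u : R) w : `]-1, 1[%classic u -> forall v,
    is_derive u 1 (fun s : R => var s w v) (ev (var u w) (dvar v)).
  by move=> _ v; exact: is_derive_cst.
have dw (u : R) w : `]-1, 1[%classic u ->
    is_derive u 1 (fun s : R => expR (s * X w)) (ev (var u w) (EVar tt) * expR (u * X w)).
  move=> _; apply: (is_derive_eq (is_derive_expR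
    (is_deriveM (is_derive_id u (1 : R)) (is_derive_cst (X w) _ _)))).
  by rewrite /GRing.scale /= mulr0 add0r mulr1.
have mw (u : R) : `]-1, 1[%classic u -> measurable_fun setT (fun w => expR (u * X w)).
  by move=> _; apply: measurableT_comp => //; exact: measurable_funM.
have := is_derive_integral dx dw (fun _ _ _ => mX) mw mgf_dom (pow k) It.
rewrite (_ : (fun s => _) = (fun s => \int[P]_w (X w ^+ k * expR (s * X w)))); last first.
  by apply/funext => s; apply: eq_Rintegral => w _; rewrite ev_pow.
move=> h; apply: (is_derive_eq h); apply: eq_Rintegral => w _.
have -> : ev (var t w) (wder dvar (EVar tt) (pow k)) =
  ev (var t w) (der dvar (pow k)) + X w * ev (var t w) (pow k) by [].
have -> : ev (var t w) (der dvar (pow k)) = 0.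
  by elim: k {h} => //= k ->; rewrite mulr0 mul0r addr0.
by rewrite ev_pow add0r exprS.
Qed.

Lemma L1_pow k : L1 P (fun w => X w ^+ k).
Proof.
apply: (L1_le _ _ (L1_expR_norm k).1); first exact: measurable_funX.
move=> w; rewrite normrX expRM_natl lerXn2r ?nnegrE ?expR_ge0 //.
by rewrite (le_trans _ (expR_ge1Dx _)) // lerDr.
Qed.

Variables m s : R.
Hypothesis mgfE : forall t, \int[P]_w expR (t * X w) = expR (m * t + s ^+ 2 * t ^+ 2 / 2).

Let gm (t : R) := expR (m * t + s ^+ 2 * t ^+ 2 / 2).

Let dgm (t : R) : is_derive t 1 gm ((m + s ^+ 2 * t) * gm t).
Proof.
have dX := is_deriveM (is_derive_id t (1 : R)) (is_derive_id t (1 : R)).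
have h := is_derive_expR (is_deriveD
  (is_deriveM (is_derive_cst m _ _) (is_derive_id t (1 : R)))
  (is_deriveM (is_deriveM (is_derive_cst (s ^+ 2) _ _) dX) (is_derive_cst (2^-1 : R) _ _))).
apply: (is_derive_eq h); rewrite /gm /GRing.scale /= ?fctE /=.
by field.
Qed.

(** Exponentially weighted moments. Their values are identified on an interval and not just at 0, so
    that the identities can be differentiated again. *)
Let J k (t : R) := \int[P]_w (X w ^+ k * expR (t * X w)).

Let J0 (t : R) : -1 < t < 1 -> J 0 t = gm t.
Proof. by move=> _; rewrite /gm -mgfE; apply: eq_Rintegral => w _; rewrite mul1r. Qed.

Let J1 := derive_unique_itv J0 (is_derive_mgf 0) (fun t _ => dgm t).

Let z01 : -1 < (0 : R) < 1. Proof. by rewrite ltrN10 ltr01. Qed.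

Let Jat0 k : J k 0 = \int[P]_w (X w ^+ k).
Proof. by apply: eq_Rintegral => w _; rewrite mul0r expR0 mulr1. Qed.

Let gm0 : gm 0 = 1. Proof. by rewrite /gm mulr0 expr0n /= mulr0 mul0r addr0 expR0. Qed.

Lemma gaussian_mean : \int[P]_w X w = m.
Proof.
have := J1 z01; rewrite -/(J 1 0) Jat0 gm0 mulr0 addr0 mulr1 => <-.
by apply: eq_Rintegral => w _; rewrite expr1.
Qed.

Hypothesis m0 : m = 0.

Let J2 : forall t : R, -1 < t < 1 -> J 2 t = (s ^+ 2 + s ^+ 4 * t ^+ 2) * gm t.
Proof.
apply: (derive_unique_itv J1 (is_derive_mgf 1)) => t _.
apply: (is_derive_eq (is_deriveM (is_deriveD (is_derive_cst m _ _)
  (is_deriveM (is_derive_cst (s ^+ 2) _ _) (is_derive_id t (1 : R)))) (dgm t))).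
by rewrite /GRing.scale /= ?fctE m0; ring.
Qed.

Lemma gaussian_second_moment : \int[P]_w (X w ^+ 2) = s ^+ 2.
Proof. by rewrite -Jat0 J2 // gm0 expr0n /= mulr0 addr0 mulr1. Qed.

Lemma gaussian_third_moment : \int[P]_w (X w ^+ 3) = 0.
Proof.
have J3 : forall t : R, -1 < t < 1 ->
    J 3 t = (2 * s ^+ 4 * t + (s ^+ 2 + s ^+ 4 * t ^+ 2) * (s ^+ 2 * t)) * gm t.
  apply: (derive_unique_itv J2 (is_derive_mgf 2)) => t _.
  have dX := is_deriveM (is_derive_id t (1 : R)) (is_derive_id t (1 : R)).
  apply: (is_derive_eq (is_deriveM (is_deriveD (is_derive_cst (s ^+ 2) _ _)
    (is_deriveM (is_derive_cst (s ^+ 4) _ _) dX)) (dgm t))).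
  by rewrite /GRing.scale /= ?fctE m0; ring.
by rewrite -Jat0 J3 // !mulr0 addr0 mul0r.
Qed.

End gaussian_variables.

(* Truncation of times to a grid of mesh 1/n exhibits the process as a limit of
   processes whose joint measurability only involves countably many times. *)
Lemma measurable_continuous_process d (Omega : measurableType d) (R : realType)
    (X : R -> Omega -> R) (f : measurableTypeR R -> R) :
  (forall t, measurable_fun setT (X t)) ->
  (forall w, continuous (fun t => X t w)) ->
  measurable_fun setT f -> (forall s, 0 <= f s) ->
  measurable_fun setT (fun p : measurableTypeR R * Omega => X (f p.1) p.2).
Proof.
move=> mX cX mf f0.
pose k (n : nat) (s : R) : nat := Num.truncn (n.+1%:R * f s).
pose q n (s : R) : R := (k n s)%:R / n.+1%:R.
have n0 (n : nat) : 0 < n.+1%:R :> R by [].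
have nf (n : nat) s : 0 <= n.+1%:R * f s by rewrite mulr_ge0.
apply: (measurable_fun_cvg
  (h := fun n (p : measurableTypeR R * Omega) => X (q n p.1) p.2)).
  move=> n _ B mB; rewrite setTI.
  have -> : (fun p : measurableTypeR R * Omega => X (q n p.1) p.2) @^-1` B =
    \bigcup_(i : nat) (((fun s => n.+1%:R * f s) @^-1` `[i%:R, i.+1%:R[) `*`
                (X (i%:R / n.+1%:R) @^-1` B)).
    apply/seteqP; split=> -[s w] /=.
      move=> h; exists (k n s) => //; split=> //=.
      by rewrite in_itv /=; exact: truncn_itv.
    by move=> [i _ [/=]]; rewrite in_itv /= => /truncn_def ki; rewrite /q /k ki.
  apply: bigcupT_measurable => i; apply: measurableX.
    rewrite -[X in measurable X]setTI.
    by apply: (measurable_funM (measurable_cst _) mf).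
  by rewrite -[X in measurable X]setTI; exact: mX.
move=> [s w] _ /=.
apply: (continuous_cvg _ (cX w (f s))).
have h n : `|q n s - f s| <= n.+1%:R^-1.
  have /andP[h1 h2] := truncn_itv (nf n s).
  have -> : q n s - f s = (k n s)%:R / n.+1%:R - n.+1%:R * f s / n.+1%:R.
    by rewrite [n.+1%:R * _]mulrC mulfK ?gt_eqF.
  rewrite -mulrBl normrM [`|_^-1|]ger0_norm ?invr_ge0 //.
  rewrite ler_piMl ?invr_ge0 // ler_norml; apply/andP; split; last first.
    by rewrite lerBlDr (le_trans h1) // lerDr.
  by rewrite lerBrDl lerBlDr natr1 ltW.
apply/cvgrPdist_le => e e0.
near=> n; rewrite distrC (le_trans (h n)) //.
near: n; apply: filterS (near_infty_natSinv_lt (PosNum e0)) => n; exact: ltW.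
Unshelve. all: by end_near.
Qed.

(** * Ornstein-Uhlenbeck paths over the sampling interval *)

Section ornstein_uhlenbeck_paths.
Context d (Omega : measurableType d) {R : realType} (P : probability Omega R).
Variables (A Dt : R) (Z : R -> {RV P >-> R}).
Hypotheses (A0 : 0 < A) (Dt0 : 0 < Dt) (ouZ : stationary_OU A Z).

Let comb (a : 'I_3 -> R) (t : 'I_3 -> R) w := \sum_(k < 3) a k * Z (t k) w.

Let mZ t : measurable_fun setT (Z t : Omega -> R). Proof. exact: measurable_funP. Qed.

Let mcomb a t : measurable_fun setT (comb a t).
Proof. by apply: measurable_sum => k; exact: measurable_funM. Qed.

Let Z_gaussian t : gaussian_rv P (Z t).
Proof.
have [gZ _ _ _] := ouZ; have := gZ 1%N (fun=> t) (fun=> 1).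
by under eq_fun do rewrite big_ord1 mul1r.
Qed.

Let Z_mean t : \int[P]_w Z t w = 0.
Proof. by have [_ /(_ t) + _ _] := ouZ; rewrite unlock /Rintegral => ->. Qed.

Let L1Z' t : L1 P (Z t).
Proof.
have [m [s h]] := gaussian_mgf (mZ t) (Z_gaussian t).
have := L1_pow (mZ t) (fun u => (h u).1) 1.
by under eq_fun do rewrite expr1.
Qed.

Lemma comb_mgf a t : exists s, forall u,
  L1 P (fun w => expR (u * comb a t w)) /\
  \int[P]_w expR (u * comb a t w) = expR (0 * u + s ^+ 2 * u ^+ 2 / 2).
Proof.
have [gZ _ _ _] := ouZ.
have [m [s h]] := gaussian_mgf (mcomb a t) (gZ _ t a).
exists s => u; have := h u; suff -> : m = 0 by [].
rewrite -(gaussian_mean (mcomb a t) (fun u => (h u).1) (fun u => (h u).2)).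
rewrite /comb; under eq_Rintegral do rewrite !big_ord_recl big_ord0 addr0.
by rewrite !RintegralD ?RintegralZl ?Z_mean ?mulr0 ?addr0 //;
  repeat (apply: L1D || exact: L1Z).
Qed.

Let comb_L1 a t k : L1 P (fun w => comb a t w ^+ k).
Proof.
have [s h] := comb_mgf a t.
exact: (L1_pow (mcomb a t) (fun u => (h u).1)).
Qed.

Let comb3 a t : \int[P]_w (comb a t w ^+ 3) = 0.
Proof.
have [s h] := comb_mgf a t.
exact: (gaussian_third_moment (mcomb a t) (fun u => (h u).1) (fun u => (h u).2)).
Qed.

Lemma OU_cov s t : \int[P]_w (Z s w * Z t w) = expR (- A * `|t - s|).
Proof. by have [_ _ /(_ s t) + _] := ouZ; rewrite unlock /Rintegral => ->. Qed.

(** By polarisation a triple product is a combination of cubes of four signed sums of the variables;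
    each sum is a centred Gaussian, with zero third moment. *)
Lemma OU_third s t u : \int[P]_w (Z s w * Z t w * Z u w) = 0.
Proof.
pose T (k : 'I_3) : R := if k == 0 then s else if k == 1 then t else u.
pose c e1 e2 e3 (k : 'I_3) : R := if k == 0 then e1 else if k == 1 then e2 else e3.
have cE e1 e2 e3 w : comb (c e1 e2 e3) T w = e1 * Z s w + e2 * Z t w + e3 * Z u w.
  by rewrite /comb !big_ord_recl big_ord0 addr0 addrA.
have E w : Z s w * Z t w * Z u w = 24^-1 * (comb (c 1 1 1) T w ^+ 3)
    + (- 24^-1) * (comb (c 1 1 (-1)) T w ^+ 3)
    + (- 24^-1) * (comb (c 1 (-1) 1) T w ^+ 3)
    + (- 24^-1) * (comb (c (-1) 1 1) T w ^+ 3).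
  by rewrite !cE; field.
under eq_Rintegral do rewrite E.
by rewrite !RintegralD ?RintegralZl ?comb3 ?mulr0 ?addr0 //;
  repeat (apply: L1D || exact: L1Z).
Qed.

Lemma OU_mgf t u : L1 P (fun w => expR (u * Z t w)) /\
  \int[P]_w expR (u * Z t w) = expR (u ^+ 2 / 2).
Proof.
have [m [s h]] := gaussian_mgf (mZ t) (Z_gaussian t).
have h1 u := (h u).1.
have m0 := gaussian_mean (mZ t) h1 (fun u => (h u).2).
have s1 := gaussian_second_moment (mZ t) h1 (fun u => (h u).2) (etrans (esym m0) (Z_mean t)).
rewrite Z_mean in m0; have [i ->] := h u; split=> //.
have := OU_cov t t; rewrite subrr normr0 mulr0 expR0.
under eq_Rintegral do rewrite -expr2.
by rewrite s1 => ->; rewrite -m0 mul0r add0r mul1r.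
Qed.

(** Freezing time outside the sampling interval does not affect averages under the uniform law and
    makes the path bounds hold for every real time. *)
Definition clamp (s : R) : R := Num.max 0 (Num.min s Dt).

Lemma clamp_itv s : 0 <= clamp s <= Dt.
Proof. by rewrite /clamp le_max lexx /= ge_max ltW //= ge_min lexx orbT. Qed.

Lemma clamp_id s : 0 <= s <= Dt -> clamp s = s.
Proof. by move=> /andP[s0 s1]; rewrite /clamp min_l // max_r. Qed.

Definition OU_path (s : measurableTypeR R) (w : Omega) : R := Z (clamp s) w.

Lemma OU_path_measurable :
  measurable_fun setT (fun p : measurableTypeR R * Omega => OU_path p.1 p.2).
Proof.
have [_ _ _ cZ] := ouZ.
apply: (measurable_continuous_process (X := fun t w => Z t w) (f := clamp)) => //.
  by apply: measurable_maxr => //; apply: measurable_minr.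
by move=> s; have /andP[] := clamp_itv s.
Qed.

Lemma OU_path_bounded w : exists K : R, forall s, `|OU_path s w| <= K.
Proof.
have [_ _ _ cZ] := ouZ.
have c : {within `[0, Dt], continuous (fun t => `|Z t w|)}.
  apply: continuous_subspaceT => t.
  by apply: (continuous_comp (cZ w t)); exact: norm_continuous.
have [t _ h] := EVT_max (ltW Dt0) c.
exists (`|Z t w|) => s; apply: h; rewrite in_itv /=; exact: clamp_itv.
Qed.

Lemma OU_path_exp_bounded (n : nat) : exists C : R, forall s,
  L1 P (fun w => expR (n%:R * `|OU_path s w|)) /\
  \int[P]_w expR (n%:R * `|OU_path s w|) <= C.
Proof.
exists (expR (n%:R ^+ 2 / 2) + expR (n%:R ^+ 2 / 2)) => s.
have [i le] := L1_expR_norm (mZ (clamp s)) (fun u => (OU_mgf (clamp s) u).1) n.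
by split=> //; rewrite (le_trans le) // !(OU_mgf (clamp s) _).2 sqrrN.
Qed.

Lemma OU_path_mean s : \int[P]_w OU_path s w = 0.
Proof. exact: Z_mean. Qed.

Lemma OU_path_sqr s : \int[P]_w (OU_path s w ^+ 2) = 1.
Proof.
have := OU_cov (clamp s) (clamp s); rewrite subrr normr0 mulr0 expR0.
by under eq_Rintegral do rewrite -expr2.
Qed.

Lemma OU_path_third s t u : \int[P]_w (OU_path s w * OU_path t w * OU_path u w) = 0.
Proof. exact: OU_third. Qed.

Lemma OU_path_cov s t : expR (- A * Dt) <= \int[P]_w (OU_path s w * OU_path t w).
Proof.
rewrite OU_cov ler_expR !mulNr lerN2 ler_pM2l //.
have /andP[s1 s2] := clamp_itv s; have /andP[t1 t2] := clamp_itv t.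
by rewrite ler_norml; apply/andP; split; lra.
Qed.

Definition clock_prob : probability (measurableTypeR R) R := uniform_prob Dt0.

Lemma clock_average l w :
  Dt^-1 * \int[lebesgue_measure]_(s in `[0, Dt]) expR (l * Z s w - l ^+ 2 / 2) =
  exp_moment clock_prob OU_path 0 l w.
Proof.
have mf : measurable_fun setT (fun s => (exp_path OU_path l s w)%:E).
  by apply/measurable_EFinP; exact: (measurable_exp_path OU_path_measurable).
rewrite /exp_moment /Rintegral.
have -> : (\int[clock_prob]_s (OU_path s w ^+ 0 * exp_path OU_path l s w)%:E =
  \int[clock_prob]_s (exp_path OU_path l s w)%:E)%E.
  by apply: eq_integral => s _; rewrite mul1r.
rewrite integral_uniform //; last by move=> s; rewrite lee_fin expR_ge0.
rewrite subr0.
have -> : (\int[lebesgue_measure]_(s in `[0%R, Dt]) (exp_path OU_path l s w)%:E =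
  \int[lebesgue_measure]_(s in `[0%R, Dt]) (expR (l * Z s w - l ^+ 2 / 2))%:E)%E.
  apply: eq_integral => s; rewrite inE /= in_itv /= => sD.
  by rewrite /exp_path /OU_path clamp_id.
set I := (\int[_]_(_ in _) _)%E.
have I0 : (0 <= I)%E by apply: integral_ge0 => s _; rewrite lee_fin expR_ge0.
(* An infinite integral is covered too: [fine] sends it to 0 on both sides. *)
by case: I I0 => [r||] //= _; rewrite mulry gtr0_sg ?invr_gt0 // mul1e /= mulr0.
Qed.

End ornstein_uhlenbeck_paths.

(** * Gaussian integrals on C^2 *)

Lemma gauss_integral (R : realType) (k m : R) : 0 < k ->
  (\int[lebesgue_measure]_x (expR (- (k * (x - m) ^+ 2)))%:E = (Num.sqrt (pi / k))%:E)%E.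
Proof.
move=> k0; pose s := (Num.sqrt (2 * k))^-1.
have k20 : 0 < 2 * k by rewrite mulr_gt0.
have s0 : s != 0 by rewrite gt_eqF // invr_gt0 sqrtr_gt0.
have s2 : s ^+ 2 = (2 * k)^-1 by rewrite exprVn sqr_sqrtr // ltW.
have pk0 : 0 < pi / k by rewrite divr_gt0 // pi_gt0.
have pE : s ^+ 2 * pi *+ 2 = pi / k.
  by rewrite s2; generalize (@pi R) => p; rewrite -mulr_natr; field; rewrite gt_eqF.
transitivity (\int[lebesgue_measure]_x
    ((Num.sqrt (pi / k))%:E * (normal_pdf m s x)%:E))%E.
  apply: eq_integral => x _; rewrite -EFinM normal_pdfE //; congr EFin.
  rewrite /normal_peak /normal_fun pE mulVKf ?gt_eqF ?sqrtr_gt0 //.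
  by congr expR; rewrite s2; field; rewrite gt_eqF.
rewrite ge0_integralZl //=.
- by rewrite integral_normal_pdf mule1.
- by apply: measurableT_comp => //; exact: measurable_normal_pdf.
- by move=> x _; rewrite lee_fin normal_pdf_ge0.
Qed.

Section iterated_integral.
Context d1 d2 (T1 : measurableType d1) (T2 : measurableType d2) {R : realType}.
Variables (m1 : {sigma_finite_measure set T1 -> \bar R})
  (m2 : {sigma_finite_measure set T2 -> \bar R}).

Lemma sigma_finite_product : sigma_finite setT (m1 \x m2)%E.
Proof.
have [F FT Foo] := sigma_finiteT m1; have [G GT Goo] := sigma_finiteT m2.
pose p n : nat * nat := odflt (0%N, 0%N) (unpickle n).
exists (fun n => F (p n).1 `*` G (p n).2).
  apply/seteqP; split=> // -[x y] _.
  have : setT x by []. have : setT y by [].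
  rewrite FT GT => -[j _ Gy] [i _ Fx].
  by exists (pickle (i, j)) => //; rewrite /p pickleK.
move=> n; have [mF oF] := Foo (p n).1; have [mG oG] := Goo (p n).2.
split; first exact: measurableX.
by rewrite product_measure1E // lte_mul_pinfty // ge0_fin_numE.
Qed.

(* The library's sigma-finite structure on [m1 \x m2] is only inferred for
   subprobabilities. *)
Definition sigma_finite_prod : {sigma_finite_measure set (T1 * T2)%type -> \bar R} :=
  HB.pack (m1 \x m2)%E (Measure_isSigmaFinite.Build _ _ _ _ sigma_finite_product).
End iterated_integral.

Lemma integral_C2 {R : realType} (f : C2 R -> \bar R) :
  measurable_fun setT f -> (forall y, 0 <= f y)%E ->
  (\int[C2_lebesgue]_y f y = \int[lebesgue_measure]_a \int[lebesgue_measure]_b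
    \int[lebesgue_measure]_c \int[lebesgue_measure]_z f (a, b, c, z))%E.
Proof.
move=> mf f0; pose mu := @lebesgue_measure R.
pose mu2 := sigma_finite_prod mu mu; pose mu3 := sigma_finite_prod mu2 mu.
have f03 x : (0 <= fubini_F mu f x)%E by apply: integral_ge0 => z _.
have mf3 : measurable_fun setT (fubini_F mu f) by exact: measurable_fun_fubini_tonelli_F.
have f02 x : (0 <= fubini_F mu (fubini_F mu f) x)%E by apply: integral_ge0 => z _.
have mf2 : measurable_fun setT (fubini_F mu (fubini_F mu f)).
  exact: measurable_fun_fubini_tonelli_F.
transitivity (\int[mu3]_x fubini_F mu f x)%E.
  exact: (@fubini_tonelli1 _ _ _ _ R mu3 mu f mf f0).
transitivity (\int[mu2]_x fubini_F mu (fubini_F mu f) x)%E.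
  exact: (@fubini_tonelli1 _ _ _ _ R mu2 mu _ mf3 f03).
exact: (@fubini_tonelli1 _ _ _ _ R mu mu _ mf2 f02).
Qed.

Section complex_plane.
Context {R : realType}.
Implicit Types (y : C2 R) (a g : R).

(** The squared modulus of (Y_0 + Y_1)/sqrt 2; with [diff_form] it supplies the arguments [S] and
    [D] of [base_density]. *)
Definition sum_form y : R :=
  ((y.1.1.1 + y.1.2) ^+ 2 + (y.1.1.2 + y.2) ^+ 2) / 2.

Definition diff_form y : R :=
  ((y.1.1.1 - y.1.2) ^+ 2 + (y.1.1.2 - y.2) ^+ 2) / 2.

Lemma sum_form_ge0 y : 0 <= sum_form y.
Proof. by rewrite divr_ge0 // addr_ge0 // sqr_ge0. Qed.

Lemma diff_form_ge0 y : 0 <= diff_form y.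
Proof. by rewrite divr_ge0 // addr_ge0 // sqr_ge0. Qed.

Let m1 : measurable_fun setT (fun y : C2 R => y.1.1.1 : R).
Proof. by do 3 apply: measurableT_comp => //. Qed.

Let m2 : measurable_fun setT (fun y : C2 R => y.1.1.2 : R).
Proof. by do 3 apply: measurableT_comp => //. Qed.

Let m3 : measurable_fun setT (fun y : C2 R => y.1.2 : R).
Proof. by do 2 apply: measurableT_comp => //. Qed.

Let m4 : measurable_fun setT (fun y : C2 R => y.2 : R).
Proof. exact: measurable_snd. Qed.

Lemma measurable_sum_form : measurable_fun setT sum_form.
Proof.
by apply: measurable_funM => //; apply: measurable_funD; apply: measurable_funX;
  apply: measurable_funD.
Qed.

Lemma measurable_diff_form : measurable_fun setT diff_form.
Proof.
by apply: measurable_funM => //; apply: measurable_funD; apply: measurable_funX;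
  apply: measurable_funB.
Qed.

Lemma base_pdfE (Dt b : R) y : 0 < Dt ->
  base_pdf Dt b y = base_density (rate Dt b) (sum_form y) (diff_form y).
Proof.
move=> Dt0; have c0 : 0 < rate Dt b by rewrite /rate !mulr_gt0 // expR_gt0.
rewrite /base_pdf /base_density /circular_gaussian_pdf.
set r := expR (- rate Dt b).
have r1 : 0 < 1 - r by exact: onem_expR_gt0.
have r2 : 0 < 1 + r by rewrite addr_gt0 // expR_gt0.
have dE : \det (pair_covariance r) = Complex (1 - r ^+ 2) 0.
  rewrite det2 !mxE /=; apply/eqP; rewrite eq_complex /=; apply/andP; split; apply/eqP; ring.
have r12 : 1 - r ^+ 2 = (1 - r) * (1 + r) by ring.
pose W : 'M[R[i]]_2 := \matrix_(i, j)
  (if i == j then Complex (1 - r ^+ 2)^-1 0 else Complex (- r / (1 - r ^+ 2)) 0).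
have MW : pair_covariance r *m W = 1%:M.
  have n0 : 1 - r ^+ 2 != 0 by rewrite r12 mulf_neq0 // gt_eqF.
  apply/matrixP => i j; rewrite !mxE sum_ord2 !mxE.
  case: i => [[|[|i]] hi] //; case: j => [[|[|j]] hj] //=;
    by apply/eqP; rewrite eq_complex /=; apply/andP; split; apply/eqP; field.
have vE : invmx (pair_covariance r) = W.
  have [uM _] := mulmx1_unit MW.
  by rewrite -[RHS](mulKmx uM) MW mulmx1.
have -> : complex.Re (((map_mx conjc (C2_vec y))^T *m invmx (pair_covariance r)
   *m C2_vec y) 0 0) = sum_form y * (1 + r)^-1 + diff_form y * (1 - r)^-1.
  rewrite vE !mxE sum_ord2 !mxE !sum_ord2 !mxE /=.
  rewrite /sum_form /diff_form r12.
  by field; rewrite !gt_eqF.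
rewrite dE /= r12 !invfM.
rewrite [LHS]mulrC; congr (_ * _).
by rewrite mulrC; congr (_ * _); exact: mulrC.
Qed.

Let form_exp a g (x z : R) : R :=
  expR (- ((a * (x + z) ^+ 2 + g * (x - z) ^+ 2) / 2)).

(** The coefficient of [x ^+ 2] left when the square in [z] is completed and integrated out. *)
Let kp a g := 2 * a * g / (a + g).

Let form_integral a g x : 0 < a -> 0 < g ->
  (\int[lebesgue_measure]_z (form_exp a g x z)%:E =
   (Num.sqrt (pi / ((a + g) / 2)) * expR (- (kp a g * x ^+ 2)))%:E)%E.
Proof.
move=> a0 g0; have ag : 0 < a + g by exact: addr_gt0.
have ag2 : 0 < (a + g) / 2 by rewrite divr_gt0.
pose m := x * (g - a) / (a + g).
transitivity (\int[lebesgue_measure]_z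
  ((expR (- (kp a g * x ^+ 2)))%:E * (expR (- ((a + g) / 2 * (z - m) ^+ 2)))%:E))%E.
  apply: eq_integral => z _; rewrite -EFinM -expRD; congr (expR _)%:E.
  by rewrite /kp /m; field; rewrite gt_eqF.
rewrite ge0_integralZl ?lee_fin ?expR_ge0 //=.
- by rewrite gauss_integral // -EFinM mulrC.
- apply/measurable_EFinP; apply: measurableT_comp => //; apply: measurableT_comp => //.
  by apply: measurable_funM => //; apply: measurable_funX; exact: measurable_funB.
Qed.

Lemma measurable_exp_forms a g :
  measurable_fun setT (fun y => expR (- (a * sum_form y + g * diff_form y))).
Proof.
apply: measurableT_comp => //; apply: measurableT_comp => //.
apply: measurable_funD; apply: measurable_funM => //.
  exact: measurable_sum_form.
exact: measurable_diff_form.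
Qed.

Let measurable_form_exp a g x : measurable_fun setT (form_exp a g x).
Proof.
apply: measurableT_comp => //; apply: measurableT_comp => //.
by apply: measurable_funM => //; apply: measurable_funD; apply: measurable_funM => //;
  apply: measurable_funX; [exact: measurable_funD|exact: measurable_funB].
Qed.

(** Real and imaginary coordinates decouple into two equal planar integrals, so every square root
    occurs twice. As a function of [a] and [g] the result generates all moments of the two forms by
    differentiation. *)
Lemma integral_exp_forms a g : 0 < a -> 0 < g ->
  (\int[C2_lebesgue]_y (expR (- (a * sum_form y + g * diff_form y)))%:E =
   (pi ^+ 2 / (a * g))%:E)%E.
Proof.
move=> a0 g0; have ag : 0 < a + g by exact: addr_gt0.
have kp0 : 0 < kp a g by rewrite /kp divr_gt0 // !mulr_gt0.
pose c := Num.sqrt (pi / ((a + g) / 2)).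
have c0 : 0 <= c by exact: sqrtr_ge0.
pose h (x : R) := expR (- (kp a g * x ^+ 2)).
have mh : measurable_fun setT (fun x => (h x)%:E).
  apply/measurable_EFinP; apply: measurableT_comp => //; apply: measurableT_comp => //.
  by apply: measurable_funM => //; exact: measurable_funX.
pose k := Num.sqrt (pi / kp a g).
have hI : (\int[lebesgue_measure]_x (h x)%:E = k%:E)%E.
  rewrite -(gauss_integral 0 kp0); apply: eq_integral => x _.
  by rewrite subr0.
rewrite integral_C2; last 2 first.
- by apply/measurable_EFinP; exact: measurable_exp_forms.
- by move=> y; rewrite lee_fin expR_ge0.
have I4 x1 x2 x3 : (\int[lebesgue_measure]_z (expR (- (a * sum_form (x1, x2, x3, z) +
    g * diff_form (x1, x2, x3, z))))%:E = (c * h x2 * form_exp a g x1 x3)%:E)%E.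
  transitivity (\int[lebesgue_measure]_z
    ((form_exp a g x1 x3)%:E * (form_exp a g x2 z)%:E))%E.
    apply: eq_integral => z _; rewrite -EFinM -expRD; congr (expR _)%:E.
    by rewrite /sum_form /diff_form /=; field.
  rewrite ge0_integralZl ?lee_fin ?expR_ge0 //=.
  - by rewrite form_integral // -EFinM mulrC.
  - by apply/measurable_EFinP; exact: measurable_form_exp.
  - by move=> z _; rewrite lee_fin expR_ge0.
have I3 x1 x2 : (\int[lebesgue_measure]_x3 (c * h x2 * form_exp a g x1 x3)%:E =
    (c ^+ 2 * h x1 * h x2)%:E)%E.
  under eq_integral do rewrite EFinM.
  rewrite ge0_integralZl ?lee_fin ?mulr_ge0 ?expR_ge0 //=.
  - by rewrite form_integral // -EFinM -/(h x1) -/c; congr EFin; ring.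
  - by apply/measurable_EFinP; exact: measurable_form_exp.
  - by move=> z _; rewrite lee_fin expR_ge0.
have I2 x1 : (\int[lebesgue_measure]_x2 (c ^+ 2 * h x1 * h x2)%:E =
    (c ^+ 2 * k)%:E * (h x1)%:E)%E.
  under eq_integral do rewrite EFinM.
  rewrite ge0_integralZl ?lee_fin ?mulr_ge0 ?expR_ge0 //=.
  - by rewrite hI -!EFinM mulrAC.
  - by move=> z _; rewrite lee_fin expR_ge0.
transitivity (\int[lebesgue_measure]_x ((c ^+ 2 * k)%:E * (h x)%:E))%E.
  apply: eq_integral => x _; rewrite -I2; apply: eq_integral => x' _.
  by rewrite -I3; apply: eq_integral => x'' _; exact: I4.
rewrite ge0_integralZl ?lee_fin ?mulr_ge0 ?sqrtr_ge0 //=; last first.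
  by move=> z _; rewrite lee_fin expR_ge0.
rewrite hI -EFinM; congr EFin.
rewrite -mulrA -expr2 !sqr_sqrtr ?divr_ge0 ?pi_ge0 // ?(ltW kp0) ?(ltW ag) //.
  generalize (@pi R) => p; rewrite /kp; field.
  by rewrite !gt_eqF // !mulr_gt0.
by rewrite !mulr_ge0 // ltW.
Qed.

End complex_plane.

(** * Moments of two forms under an exponential weight *)

Section exponential_form_derivatives.
Context d (Y : measurableType d) {R : realType} (mu : {measure set Y -> \bar R}).
Variables (sy dy : Y -> R).
Hypotheses (msy : measurable_fun setT sy) (mdy : measurable_fun setT dy).
Hypotheses (sy0 : forall y, 0 <= sy y) (dy0 : forall y, 0 <= dy y).
Hypothesis iexp : forall a g, 0 < a -> 0 < g ->
  L1 mu (fun y => expR (- (a * sy y + g * dy y))).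
Implicit Types (a g t : R).

Let var (t : R) (y : Y) (v : bool) : R := if v then sy y else dy y.

Let dvar (_ : bool) : expr bool := ECst 0.

Let mon m n : expr bool :=
  EMul (iter m (EMul (EVar true)) (ECst 1)) (iter n (EMul (EVar false)) (ECst 1)).

Let ev_pow b k t y : ev (var t y) (iter k (EMul (EVar b)) (ECst 1)) = var t y b ^+ k.
Proof. by elim: k => //= k ->; rewrite exprS. Qed.

Let ev_mon m n t y : ev (var t y) (mon m n) = sy y ^+ m * dy y ^+ n.
Proof.
transitivity (ev (var t y) (iter m (EMul (EVar true)) (ECst 1)) *
  ev (var t y) (iter n (EMul (EVar false)) (ECst 1))) => //.
by rewrite !ev_pow.
Qed.

(** Half of the exponent absorbs polynomial growth and still leaves a quarter, a weight of the form
    covered by [iexp]. *)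
Let dom e a g : 0 < a -> 0 < g -> exists C : R, forall t y,
  `|ev (var t y) e| * expR (- ((a * sy y + g * dy y) / 2)) <=
  C * expR (- (a / 4 * sy y + g / 4 * dy y)).
Proof.
move=> a0 g0; pose x y := a * sy y + g * dy y.
have x0 y : 0 <= x y by rewrite addr_ge0 // mulr_ge0 // ltW.
pose B n y := (1 + x y) ^+ n.
have B1 y : 1 <= 1 + x y by rewrite lerDl.
have gB : growth_scale [set: Y] B.
  split=> [n y _|m n y _ mn|n]; first exact: exprn_ege1.
  - exact: ler_weXn2l mn.
  - by exists (n * 2)%N => y _; rewrite /B exprM.
have bv v : scale_bounded setT B (fun y => var 0 y v).
  case: v.
    exists a^-1, 1%N; split=> [|y _]; first by rewrite invr_ge0 ltW.
    rewrite /B expr1 ger0_norm //= [leRHS]mulrC ler_pdivlMr // mulrC /x.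
    by have := mulr_ge0 (ltW g0) (dy0 y); lra.
  exists g^-1, 1%N; split=> [|y _]; first by rewrite invr_ge0 ltW.
  rewrite /B expr1 ger0_norm //= [leRHS]mulrC ler_pdivlMr // mulrC /x.
  by have := mulr_ge0 (ltW a0) (sy0 y); lra.
have [C [N [C0 hC]]] := scale_bounded_ev gB bv e.
have [C' C'0 hC'] := poly_exp_le R N.
exists (C * C') => t y.
rewrite (le_trans (ler_wpM2r (expR_ge0 _) (hC y I))) // -!mulrA ler_wpM2l //.
rewrite (le_trans (hC' _ (x0 y))) // ler_wpM2l // ler_expR /x; lra.
Qed.

Let mvar t v : measurable_fun setT (fun y => var t y v). Proof. by case: v. Qed.

Let measurable_weight a g :
  measurable_fun setT (fun y => expR (- (a * sy y + g * dy y))).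
Proof.
apply: measurableT_comp => //; apply: measurableT_comp => //.
by apply: measurable_funD; exact: measurable_funM.
Qed.

Lemma L1_exp_form_moment a g m n : 0 < a -> 0 < g ->
  L1 mu (fun y => sy y ^+ m * dy y ^+ n * expR (- (a * sy y + g * dy y))).
Proof.
move=> a0 g0; have [C hC] := dom (mon m n) a0 g0.
have i4 : L1 mu (fun y => C * expR (- (a / 4 * sy y + g / 4 * dy y))).
  by apply: L1Z; apply: iexp; rewrite divr_gt0.
apply: (L1_le _ _ i4).
  by apply: measurable_funM => //; apply: measurable_funM; exact: measurable_funX.
move=> y; apply: le_trans (hC 0 y); rewrite normrM ev_mon ler_wpM2l //.
rewrite ger0_norm ?expR_ge0 // ler_expR.
have := mulr_ge0 (ltW a0) (sy0 y); have := mulr_ge0 (ltW g0) (dy0 y); lra.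
Qed.

Lemma is_derive_exp_form_moment a g m n : 0 < a -> 0 < g ->
  is_derive a 1
    (fun t => \int[mu]_y (sy y ^+ m * dy y ^+ n * expR (- (t * sy y + g * dy y))))
    (- \int[mu]_y (sy y ^+ m.+1 * dy y ^+ n * expR (- (a * sy y + g * dy y)))).
Proof.
move=> a0 g0; pose w (t : R) (y : Y) := expR (- (t * sy y + g * dy y)).
(* The lower end [a / 2] keeps half of the exponent uniformly on the interval, as [dom] requires. *)
have Ia : `]a / 2, a * 2[%classic a by rewrite /= in_itv /=; apply/andP; split; lra.
have dx (t : R) y : `]a / 2, a * 2[%classic t -> forall v,
    is_derive t 1 (fun s : R => var s y v) (ev (var t y) (dvar v)).
  by move=> _ v; exact: is_derive_cst.
have dw (t : R) y : `]a / 2, a * 2[%classic t ->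
    is_derive t 1 (w^~ y) (ev (var t y) (EOpp (EVar true)) * w t y).
  move=> _; apply: (is_derive_eq (is_derive_expR (is_deriveN (is_deriveD
    (is_deriveM (is_derive_id t (1 : R)) (is_derive_cst (sy y) _ _))
    (is_derive_cst (g * dy y) _ _))))).
  by rewrite /GRing.scale /= !mulr0 add0r addr0 mulr1.
have mw (t : R) : `]a / 2, a * 2[%classic t -> measurable_fun setT (w t).
  by move=> _; exact: measurable_weight.
have mx (t : R) v : `]a / 2, a * 2[%classic t -> measurable_fun setT ((var t)^~ v).
  by move=> _; exact: mvar.
have domw e : exists2 G : Y -> R, L1 mu G & forall (t : R) y,
    `]a / 2, a * 2[%classic t -> `|ev (var t y) e * w t y| <= G y.
  have [C hC] := dom e a0 g0.
  exists (fun y => C * expR (- (a / 4 * sy y + g / 4 * dy y))).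
    by apply: L1Z; apply: iexp; rewrite divr_gt0.
  move=> t y; rewrite /= in_itv /= => /andP[t1 t2].
  apply: le_trans (hC t y); rewrite normrM ler_wpM2l //.
  rewrite ger0_norm ?expR_ge0 // ler_expR.
  have := mulr_ge0 (ltW g0) (dy0 y); have := ler_wpM2r (sy0 y) (ltW t1); lra.
have := is_derive_integral dx dw mx mw domw (mon m n) Ia.
rewrite (_ : (fun s => _) = (fun t : R => \int[mu]_y
  (sy y ^+ m * dy y ^+ n * expR (- (t * sy y + g * dy y))))); last first.
  by apply/funext => t; apply: eq_Rintegral => y _; rewrite ev_mon.
move=> h; apply: (is_derive_eq h).
rewrite -mulN1r -RintegralZl //; last exact: L1_exp_form_moment.
apply: eq_Rintegral => y _.
have D0 b k : ev (var a y) (der dvar (iter k (EMul (EVar b)) (ECst 1))) = 0.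
  by elim: k => //= k ->; rewrite mulr0 mul0r addr0.
have -> : ev (var a y) (wder dvar (EOpp (EVar true)) (mon m n)) =
  ev (var a y) (der dvar (mon m n)) + - sy y * ev (var a y) (mon m n) by [].
have -> : ev (var a y) (der dvar (mon m n)) = 0.
  transitivity (ev (var a y) (der dvar (iter m (EMul (EVar true)) (ECst 1))) *
    ev (var a y) (iter n (EMul (EVar false)) (ECst 1)) +
    ev (var a y) (iter m (EMul (EVar true)) (ECst 1)) *
    ev (var a y) (der dvar (iter n (EMul (EVar false)) (ECst 1)))) => //.
  by rewrite !D0 mul0r mulr0 addr0.
by rewrite ev_mon /w exprS; ring.
Qed.

End exponential_form_derivatives.

Section exponential_form_moments.
Context d (Y : measurableType d) {R : realType} (mu : {measure set Y -> \bar R}).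
Variables (vol : R).

Lemma derive_unique_pos (F G F' G' : R -> R) :
  (forall t : R, 0 < t -> F t = G t) ->
  (forall t : R, 0 < t -> is_derive t 1 F (F' t)) ->
  (forall t : R, 0 < t -> is_derive t 1 G (G' t)) ->
  forall t : R, 0 < t -> F' t = G' t.
Proof.
move=> FG dF dG t t0.
apply: (@derive_unique_itv _ F G F' G' (t / 2) (t * 2)); [| | |lra].
- by move=> u /andP[h _]; apply: FG; lra.
- by move=> u /andP[h _]; apply: dF; lra.
- by move=> u /andP[h _]; apply: dG; lra.
Qed.

Lemma is_derive_inv_pow (c t : R) k : 0 < t ->
  is_derive t 1 (fun u : R => c / u ^+ k.+1) (- (c * k.+1%:R / t ^+ k.+2)).
Proof.
move=> t0.
have dp := is_derive_pow k t.
have n0 : t ^+ k.+1 != 0 by rewrite gt_eqF // exprn_gt0.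
apply: (is_derive_eq (is_deriveM (is_derive_cst c _ _) (is_derive_inv dp n0))).
rewrite /GRing.scale /= mulr0 addr0 !exprS; field.
by rewrite ?expf_neq0 ?(gt_eqF t0).
Qed.

Section one_variable.
Variables (sy dy : Y -> R).
Hypotheses (msy : measurable_fun setT sy) (mdy : measurable_fun setT dy).
Hypotheses (sy0 : forall y, 0 <= sy y) (dy0 : forall y, 0 <= dy y).
Hypothesis iexp : forall a g, 0 < a -> 0 < g ->
  L1 mu (fun y => expR (- (a * sy y + g * dy y))).

(** Each derivative in [a] brings down a factor [- sy y] and turns m!/a^(m+1) into minus the next
    such term. It is used for one form and then, with the roles exchanged, for the other. *)
Lemma exp_form_moment_step n (c g : R) : 0 < g ->
  (forall a, 0 < a ->
    \int[mu]_y (dy y ^+ n * expR (- (a * sy y + g * dy y))) = c / a) ->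
  forall m a, 0 < a ->
    \int[mu]_y (sy y ^+ m * dy y ^+ n * expR (- (a * sy y + g * dy y))) =
    c * m`!%:R / a ^+ m.+1.
Proof.
move=> g0 h0; elim=> [|m IH] a a0.
  rewrite fact0 mulr1 expr1 -(h0 a a0); apply: eq_Rintegral => y _.
  by rewrite mul1r.
apply: oppr_inj.
have := derive_unique_pos IH
  (fun t t0 => is_derive_exp_form_moment msy mdy sy0 dy0 iexp m n t0 g0)
  (fun t t0 => is_derive_inv_pow (c * m`!%:R) m t0) a0.
by move=> ->; rewrite factS natrM; congr (- (_ / _)); ring.
Qed.

End one_variable.

Variables (sy dy : Y -> R).
Hypotheses (msy : measurable_fun setT sy) (mdy : measurable_fun setT dy).
Hypotheses (sy0 : forall y, 0 <= sy y) (dy0 : forall y, 0 <= dy y).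
Hypothesis vol_exp : forall a g, 0 < a -> 0 < g ->
  (\int[mu]_y (expR (- (a * sy y + g * dy y)))%:E = (vol / (a * g))%:E)%E.

Lemma L1_exp_form a g : 0 < a -> 0 < g ->
  L1 mu (fun y => expR (- (a * sy y + g * dy y))).
Proof.
move=> a0 g0; apply/integrableP; split.
  apply/measurable_EFinP; apply: measurableT_comp => //; apply: measurableT_comp => //.
  by apply: measurable_funD; exact: measurable_funM.
under eq_integral do rewrite /= ger0_norm ?expR_ge0 //.
by rewrite vol_exp // ltry.
Qed.

Let L1_exp_form' a g : 0 < a -> 0 < g ->
  L1 mu (fun y => expR (- (a * dy y + g * sy y))).
Proof.
by move=> a0 g0; under eq_fun do rewrite addrC; exact: L1_exp_form.
Qed.

Lemma exp_form_moment m n a g : 0 < a -> 0 < g ->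
  \int[mu]_y (sy y ^+ m * dy y ^+ n * expR (- (a * sy y + g * dy y))) =
  vol * m`!%:R * n`!%:R / (a ^+ m.+1 * g ^+ n.+1).
Proof.
move=> a0 g0.
have step0 g' : 0 < g' ->
    \int[mu]_y (sy y ^+ m * expR (- (g' * dy y + a * sy y))) =
    vol * m`!%:R / a ^+ m.+1 / g'.
  move=> g'0.
  have := @exp_form_moment_step sy dy msy mdy sy0 dy0 L1_exp_form 0 (vol / g') g' g'0 _ m a a0.
  move=> h; transitivity (vol / g' * m`!%:R / a ^+ m.+1); last by ring.
  rewrite -h => [|b b0]; first by apply: eq_Rintegral => y _; rewrite mulr1 addrC.
  transitivity (\int[mu]_y expR (- (b * sy y + g' * dy y))).
    by apply: eq_Rintegral => y _; rewrite mul1r.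
  by rewrite /Rintegral vol_exp //= invfM mulrA mulrAC.
have H := exp_form_moment_step mdy msy dy0 sy0 L1_exp_form' a0 step0 n g0.
transitivity (vol * m`!%:R / a ^+ m.+1 * n`!%:R / g ^+ n.+1).
  by rewrite -H; apply: eq_Rintegral => y _; rewrite [_ ^+ m * _]mulrC [a * _ + _]addrC.
by rewrite invfM; ring.
Qed.

End exponential_form_moments.

(** * The Fisher metric of a mixture *)

Section fisher_jets.
Context dY (Y : measurableType dY) {R : realType} (mu : {measure set Y -> \bar R}).
Variables (b0 : R) (q : R -> R -> Y -> R) (s : R -> R -> Y -> nat * nat -> R).
Implicit Types (b l : R) (y : Y) (i j n : nat) (e : expr (nat * nat)).

Local Notation box := (param_box b0).

Hypothesis q0 : forall b l y, box b l -> 0 < q b l y.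
Hypothesis ds_beta : forall b l y v, box b l ->
  is_derive b 1 (fun u => s u l y v) (ev (s b l y) (ratio_der_beta v)).
Hypothesis ds_lambda : forall b l y v, box b l ->
  is_derive l 1 (fun u => s b u y v) (ev (s b l y) (ratio_der_lambda v)).
Hypothesis dq_beta : forall b l y, box b l ->
  is_derive b 1 (fun u => q u l y) (s b l y (1, 0) * q b l y).
Hypothesis dq_lambda : forall b l y, box b l ->
  is_derive l 1 (fun u => q b u y) (s b l y (0, 1) * q b l y).

Definition jet e i j b l : R :=
  \int[mu]_y (ev (s b l y) (iter i wder_beta (iter j wder_lambda e)) * q b l y).

Hypothesis L1_jet : forall e b l, box b l ->
  L1 mu (fun y => ev (s b l y) e * q b l y).
Hypothesis smooth_jets : forall e, smooth_jet b0 (jet e).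
Hypothesis odd1 : forall b y i, `|b - b0| < 1 -> s b 0 y (i, 1) = 0.
Hypothesis odd3 : forall b y i, `|b - b0| < 1 -> s b 0 y (i, 3) = 0.

(* Derivations without weight, written as weighted ones so that their
   commutation is an instance of [iter_wderC]. *)
Let dbeta := wder ratio_der_beta (ECst 0).
Let dlambda := wder ratio_der_lambda (ECst 0).

(** The logarithm is not an expression in the ratios, but its first derivatives are s10 and s01;
    higher ones follow by unweighted derivations, starting from s10 as soon as [i > 0]. *)
Definition log_jet y i j b l : R :=
  match i, j with
  | 0, 0 => ln (q b l y)
  | 0, j.+1 => ev (s b l y) (iter j dlambda (EVar (0, 1)))
  | i.+1, j => ev (s b l y) (iter i dbeta (iter j dlambda (EVar (1, 0))))
  end.

Let dlambdaC n e : @eqv R _ (dlambda (iter n dbeta e)) (iter n dbeta (dlambda e)).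
Proof. by apply: iter_wderC => // v; exact: ratio_der_comm. Qed.

Let dbetaC n e : @eqv R _ (dbeta (iter n dlambda e)) (iter n dlambda (dbeta e)).
Proof.
by apply: iter_wderC => // v x; apply/esym; exact: ratio_der_comm.
Qed.

Let ds_beta_ev e b l y : box b l ->
  is_derive b 1 (fun u => ev (s u l y) e) (ev (s b l y) (dbeta e)).
Proof.
move=> bx; have h v : is_derive b 1 (fun u => s u l y v) (1 * ev (s b l y) (ratio_der_beta v)).
  by rewrite mul1r; exact: ds_beta.
by apply: (is_derive_eq (is_derive_ev h e)); rewrite /= mul0r addr0 mul1r.
Qed.

Let ds_lambda_ev e b l y : box b l ->
  is_derive l 1 (fun u => ev (s b u y) e) (ev (s b l y) (dlambda e)).
Proof.
move=> bx; have h v : is_derive l 1 (fun u => s b u y v) (1 * ev (s b l y) (ratio_der_lambda v)).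
  by rewrite mul1r; exact: ds_lambda.
by apply: (is_derive_eq (is_derive_ev h e)); rewrite /= mul0r addr0 mul1r.
Qed.

Let eqv_iter n dv e1 e2 : @eqv R (nat * nat) e1 e2 ->
  @eqv R (nat * nat) (iter n (wder dv (ECst 0)) e1) (iter n (wder dv (ECst 0)) e2).
Proof. by move=> h; elim: n => //= n IH; exact: eqv_wder. Qed.

Lemma derive_log_jet y : derive_jet b0 (log_jet y).
Proof.
split=> -[|i] j b l bx.
- case: j => [|j].
    apply: (is_derive_eq (is_derive_comp1 (is_derive1_ln (q0 y bx)) (dq_beta y bx))).
    by rewrite /= mulrC mulfK // gt_eqF // q0.
  apply: (is_derive_eq (ds_beta_ev _ _ bx)).
  transitivity (ev (s b l y) (iter j dlambda (dlambda (EVar (1, 0))))).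
    by rewrite dbetaC; apply: eqv_iter => x /=; ring.
  by rewrite -iterSr.
- exact: ds_beta_ev.
- case: j => [|j].
    apply: (is_derive_eq (is_derive_comp1 (is_derive1_ln (q0 y bx)) (dq_lambda y bx))).
    by rewrite /= mulrC mulfK // gt_eqF // q0.
  exact: ds_lambda_ev.
- by apply: (is_derive_eq (ds_lambda_ev _ _ bx)); rewrite dlambdaC.
Qed.

Lemma even_log_jet y : even_jet b0 0 (log_jet y).
Proof.
apply: even_jetP (derive_log_jet y) _ => j b bb j3; rewrite addn0 /=.
case: j j3 => [|[|[|[|]]]] //= _ _; rewrite ?odd1 ?odd3 //.
by ring.
Qed.

Variable p : R * R -> Y -> R.
Hypothesis pE : forall t y, half_box b0 t -> p t y = q t.1 (Num.sqrt (2 * t.2)) y.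

(** The mu-score is s01 over lambda; its limit at the boundary is s02, because s01 vanishes
    there. *)
Let score_var (i : 'I_2) (t : R * R) : nat * nat :=
  if i == 0 then (1, 0) else if t.2 == 0 then (0, 2) else (0, 1).

Let score_coef (i : 'I_2) (t : R * R) : R :=
  if (i == 0) || (t.2 == 0) then 1 else (Num.sqrt (2 * t.2))^-1.

Let is_partial_log (i : 'I_2) t y : half_box b0 t ->
  is_partial i (fun u => ln (p u y)) t
    (score_coef i t * s t.1 (Num.sqrt (2 * t.2)) y (score_var i t)).
Proof.
move=> ht.
have E u : half_box b0 u -> ln (p u y) = jet_div 0 (log_jet y) u.
  move=> hu; rewrite pE // /jet_div; case: ifP => [/eqP ->|_].
    by rewrite mulr0 sqrtr0 divr1.
  by rewrite expr0 divr1.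
apply: (is_partial_near (g := jet_div 0 (log_jet y))); last 1 first.
- have dj := derive_log_jet y; have ej := even_log_jet y.
  have bb : `|t.1 - b0| < 1 by case/andP: ht.
  have [->|i1] := eqVneq i 0.
    have := is_partial0_jet_div (k := 0) dj ht.
    congr is_partial; rewrite /score_coef /score_var /= mul1r /jet_div.
    case: ifP => [/eqP ->|_]; last by rewrite expr0 divr1.
    by rewrite mulr0 sqrtr0 divr1.
  have -> : i = 1 by apply: val_inj; case: i i1 => -[|[|//]].
  have := is_partial1_jet_div dj ej isT ht.
  congr is_partial; rewrite /score_coef /score_var /= /jet_div.
  case: ifPn => [/eqP ->|t0].
    rewrite /jet_euler /= mulr0 sqrtr0 odd1 // (_ : 2`! = 2%N) //.
    by field.
  have l0 : Num.sqrt (2 * t.2) != 0.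
    have /and3P[_ t2 _] := ht.
    by rewrite sqrtr_eq0 -ltNge mulr_gt0 // lt_neqAle eq_sym t0.
  by rewrite /jet_euler /=; field.
- by apply: filterS (near_half_box i ht) => h; exact: E.
- exact: E.
Qed.

Lemma scoreE (i : 'I_2) t y : half_box b0 t -> has_partial i (fun u => ln (p u y)) t /\
  score p i t y = score_coef i t * s t.1 (Num.sqrt (2 * t.2)) y (score_var i t).
Proof.
by move=> ht; exact: (is_partialE (half_box_half_plane ht) (@is_partial_log i t y ht)).
Qed.

Let score_product (i j : 'I_2) t y : half_box b0 t -> score p i t y * score p j t y * p t y =
  score_coef i t * score_coef j t *
  (ev (s t.1 (Num.sqrt (2 * t.2)) y) (EMul (EVar (score_var i t)) (EVar (score_var j t)))
   * q t.1 (Num.sqrt (2 * t.2)) y).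
Proof. by move=> ht; rewrite !(scoreE _ _ ht).2 pE //=; ring. Qed.

Lemma jet_has_fisher_metric t : half_box b0 t -> has_fisher_metric mu p t.
Proof.
move=> ht; have bx := half_box_param ht; split=> [y|i y|i j].
- by rewrite pE // q0.
- exact: (scoreE i y ht).1.
- under eq_fun do rewrite score_product //.
  by apply: L1Z; exact: L1_jet.
Qed.

(** The integrand of the metric coefficient with [i + j = n], multiplied by lambda^n so as to be
    smooth at 0. *)
Definition fisher_expr n : expr (nat * nat) :=
  EMul (EVar (if (n <= 1)%N then (1, 0) else (0, 1)))
       (EVar (if (n == 0)%N then (1, 0) else (0, 1))).

Lemma even_fisher_jet n : (n <= 2)%N -> even_jet b0 n (jet (fisher_expr n)).
Proof.
move=> n2; apply: even_jetP (smooth_jetW (smooth_jets _)) _ => j b bb j3 jn.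
transitivity (\int[mu]_y (0 : R)); last by rewrite /Rintegral integral0.
apply: eq_Rintegral => y _.
set E := ev _ _; suff -> : E = 0 by rewrite mul0r.
rewrite /E; case: n j n2 j3 jn {E} => [|[|[|//]]] [|[|[|[|//]]]] //= _ _ _;
  rewrite ?odd1 ?odd3 //; ring.
Qed.

Lemma fisher_metric_jet t (i j : 'I_2) : half_box b0 t ->
  fisher_metric mu p t i j = jet_div (i + j) (jet (fisher_expr (i + j))) t.
Proof.
move=> ht; have bx := half_box_param ht.
have bb : `|t.1 - b0| < 1 by case/andP: ht.
rewrite mxE.
under eq_Rintegral do rewrite score_product //.
rewrite RintegralZl //; last exact: L1_jet.
rewrite /jet_div; case: ifPn => t0.
  have l0 : Num.sqrt (2 * t.2) = 0 by rewrite (eqP t0) mulr0 sqrtr0.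
  rewrite /score_coef /score_var t0 !orbT !mul1r l0.
  rewrite l0 in bx.
  (* At lambda = 0 the odd ratios vanish from the [i + j] lambda-derivatives of the integrand;
     dividing by the factorial leaves the product of the boundary scores. *)
  rewrite /jet mulrC -RintegralZl //; last exact: L1_jet.
  apply: eq_Rintegral => y _; rewrite mulrA; congr (_ * _).
  have [f00 f01 f10 f11] : [/\ (0 + 0)`! = 1%N, (0 + 1)`! = 1%N, (1 + 0)`! = 1%N &
    (1 + 1)`! = 2%N] by [].
  by case: i j => -[|[|//]] ? [[|[|//]] ?] /=;
    rewrite ?odd1 ?odd3 // ?f00 ?f01 ?f10 ?f11; field.
rewrite /score_coef /score_var (negbTE t0) !orbF.
case: i j => -[|[|//]] ? [[|[|//]] ?]; rewrite /jet /=.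
- by rewrite !mul1r invr1 mulr1.
- by rewrite mul1r mulrC expr1.
- rewrite mulr1 mulrC expr1; congr (_ * _).
  by apply: eq_Rintegral => y _; congr (_ * _); exact: mulrC.
- by rewrite mulrC expr2 invfM.
Qed.

End fisher_jets.

(** * Boundary values by computation *)

From Stdlib Require BinInt Pnat.
From mathcomp Require Import ssrZ.

(* Sparse polynomials with integer coefficients, as lists of exponent vectors
   and coefficients, on which identities are decided by computation. *)
Definition zpoly := seq (seq nat * BinNums.Z).

Fixpoint mono_mul (m n : seq nat) : seq nat :=
  match m, n with
  | i :: m', j :: n' => (i + j)%N :: mono_mul m' n'
  | [::], _ => n
  | _, [::] => m
  end.

Fixpoint mono_cmp (m n : seq nat) : comparison :=
  match m, n with
  | [::], [::] => Eq
  | [::], _ => Lt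
  | _, [::] => Gt
  | i :: m', j :: n' => if Nat.compare i j is Eq then mono_cmp m' n' else Nat.compare i j
  end.

Definition zpoly_cons (m : seq nat) (z : BinNums.Z) (p : zpoly) : zpoly :=
  if z is BinNums.Z0 then p else (m, z) :: p.

(** A merge of lists sorted by [mono_cmp] that drops cancelled terms. Sorting makes equal monomials
    meet; the value is correct for arbitrary lists by [zpoly_val_add]. *)
Fixpoint zpoly_add (p : zpoly) : zpoly -> zpoly :=
  match p with
  | [::] => id
  | t :: p' => fix zpoly_add' (q : zpoly) :=
      match q with
      | [::] => p
      | u :: q' => match mono_cmp t.1 u.1 with
                   | Eq => zpoly_cons t.1 (BinInt.Z.add t.2 u.2) (zpoly_add p' q')
                   | Lt => t :: zpoly_add p' q
                   | Gt => u :: zpoly_add' q'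
                   end
      end
  end.

Definition zpoly_opp (p : zpoly) : zpoly := [seq (t.1, BinInt.Z.opp t.2) | t <- p].

Definition zpoly_mul_term (t : seq nat * BinNums.Z) (p : zpoly) : zpoly :=
  [seq (mono_mul t.1 u.1, BinInt.Z.mul t.2 u.2) | u <- p].

Definition zpoly_mul (p q : zpoly) : zpoly :=
  let mul p q := foldr (fun t => zpoly_add (zpoly_mul_term t q)) [::] p in
  if (size p <= size q)%N then mul p q else mul q p.

Definition zpoly_cst (k n : nat) : zpoly := [:: (nseq k 0%N, BinInt.Z.of_nat n)].

Definition zpoly_var (k i : nat) : zpoly :=
  [:: (set_nth 0%N (nseq k 0%N) i 1%N, (BinNums.Zpos BinNums.xH))].

Fixpoint zpoly_ev (V : Type) (k : nat) (f : V -> zpoly) (e : expr V) : zpoly :=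
  match e with
  | ECst n => zpoly_cst k n
  | EVar v => f v
  | EOpp e => zpoly_opp (zpoly_ev k f e)
  | EAdd e1 e2 => zpoly_add (zpoly_ev k f e1) (zpoly_ev k f e2)
  | EMul e1 e2 => zpoly_mul (zpoly_ev k f e1) (zpoly_ev k f e2)
  end.

Definition zpoly_eqb (p q : zpoly) : bool :=
  all (fun t => BinInt.Z.eqb t.2 BinNums.Z0) (zpoly_add p (zpoly_opp q)).

Section evaluation.
Context {R : realType}.
Implicit Types (xs : seq R) (p q : zpoly) (t u : seq nat * BinNums.Z).

Definition Zr (z : BinNums.Z) : R := (ssrZ.int_of_Z z)%:~R.

Let ZrD z1 z2 : Zr (BinInt.Z.add z1 z2) = Zr z1 + Zr z2.
Proof. by rewrite /Zr -[BinInt.Z.add z1 z2]/(z1 + z2)%R rmorphD intrD. Qed.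

Lemma ZrM z1 z2 : Zr (BinInt.Z.mul z1 z2) = Zr z1 * Zr z2.
Proof. by rewrite /Zr -[(BinInt.Z.mul z1 z2)]/(z1 * z2)%R rmorphM intrM. Qed.

Let ZrN z : Zr (BinInt.Z.opp z) = - Zr z.
Proof. by rewrite /Zr -[(BinInt.Z.opp z)]/(- z)%R rmorphN mulrNz. Qed.

Lemma Zr_nat n : Zr (BinInt.Z.of_nat n) = n%:R.
Proof.
case: n => [|n] //; rewrite /Zr /= Pnat.SuccNat2Pos.id_succ.
by rewrite pmulrn.
Qed.

Fixpoint mono_val xs (m : seq nat) : R :=
  match xs, m with
  | x :: xs', n :: m' => x ^+ n * mono_val xs' m'
  | _, _ => 1
  end.

Lemma mono_val_mul xs m n : mono_val xs (mono_mul m n) = mono_val xs m * mono_val xs n.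
Proof.
elim: xs m n => [|x xs IH] [|i m] [|j n] /=; rewrite ?mulr1 ?mul1r //.
by rewrite IH exprD; ring.
Qed.

Lemma mono_val0 xs k : mono_val xs (nseq k 0%N) = 1.
Proof. by elim: xs k => [|x xs IH] [|k] //=; rewrite IH mul1r. Qed.

Definition zpoly_val xs p : R := \sum_(t <- p) Zr t.2 * mono_val xs t.1.

Lemma zpoly_val_cons xs t p :
  zpoly_val xs (t :: p) = Zr t.2 * mono_val xs t.1 + zpoly_val xs p.
Proof. exact: big_cons. Qed.

Lemma zpoly_val_nil xs : zpoly_val xs [::] = 0.
Proof. exact: big_nil. Qed.

Lemma mono_cmp_eq m n : mono_cmp m n = Eq -> m = n.
Proof.
elim: m n => [|i m IH] [|j n] //=.
case E : (Nat.compare i j) => // /IH ->.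
by rewrite (PeanoNat.Nat.compare_eq _ _ E).
Qed.

Lemma zpoly_val_add xs p q :
  zpoly_val xs (zpoly_add p q) = zpoly_val xs p + zpoly_val xs q.
Proof.
elim: p q => [|t p IHp] q; first by rewrite zpoly_val_nil add0r.
elim: q => [|u q IHq]; first by rewrite zpoly_val_nil addr0.
rewrite /=; case E : (mono_cmp t.1 u.1).
- have -> z r : zpoly_val xs (zpoly_cons t.1 z r) = Zr z * mono_val xs t.1 + zpoly_val xs r.
    by case: z => [|z|z]; rewrite /= ?zpoly_val_cons // mul0r add0r.
  by rewrite ZrD IHp !zpoly_val_cons (mono_cmp_eq E); ring.
- by rewrite !zpoly_val_cons IHp zpoly_val_cons; ring.
- by rewrite zpoly_val_cons IHq !zpoly_val_cons; ring.
Qed.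

Lemma zpoly_val_opp xs p : zpoly_val xs (zpoly_opp p) = - zpoly_val xs p.
Proof.
rewrite /zpoly_val big_map -sumrN; apply: eq_bigr => t _.
by rewrite /= ZrN mulNr.
Qed.

Lemma zpoly_val_mul_term xs t p :
  zpoly_val xs (zpoly_mul_term t p) = Zr t.2 * mono_val xs t.1 * zpoly_val xs p.
Proof.
elim: p => [|u p IH]; first by rewrite !zpoly_val_nil mulr0.
by rewrite !zpoly_val_cons IH /= ZrM mono_val_mul; ring.
Qed.

Lemma zpoly_val_mul xs p q :
  zpoly_val xs (zpoly_mul p q) = zpoly_val xs p * zpoly_val xs q.
Proof.
have h p' q' : zpoly_val xs (foldr (fun t => zpoly_add (zpoly_mul_term t q')) [::] p') =
    zpoly_val xs p' * zpoly_val xs q'.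
  elim: p' => [|t p' IH] /=; first by rewrite zpoly_val_nil mul0r.
  by rewrite zpoly_val_add IH zpoly_val_mul_term zpoly_val_cons; ring.
by rewrite /zpoly_mul; case: ifP => _; rewrite h // mulrC.
Qed.

Lemma zpoly_val_cst xs k n : zpoly_val xs (zpoly_cst k n) = n%:R.
Proof. by rewrite /zpoly_val big_seq1 /= Zr_nat mono_val0 mulr1. Qed.

Lemma zpoly_val_var xs i : (i < size xs)%N ->
  zpoly_val xs (zpoly_var (size xs) i) = nth 0 xs i.
Proof.
rewrite /zpoly_val big_seq1 /=.
have -> : Zr (BinNums.Zpos BinNums.xH) = 1 by [].
rewrite mul1r; elim: xs i => [|x xs IH] [|i] //= ix.
  by rewrite mono_val0 mulr1 expr1.
by rewrite mul1r IH.
Qed.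

Lemma zpoly_evE (V : Type) xs k (f : V -> zpoly) (x : V -> R) e :
  (forall v, x v = zpoly_val xs (f v)) -> ev x e = zpoly_val xs (zpoly_ev k f e).
Proof.
move=> xf; elim: e => [n|v|e IH|e1 IH1 e2 IH2|e1 IH1 e2 IH2] /=.
- by rewrite zpoly_val_cst.
- exact: xf.
- by rewrite zpoly_val_opp IH.
- by rewrite zpoly_val_add IH1 IH2.
- by rewrite zpoly_val_mul IH1 IH2.
Qed.

Lemma zpoly_eqbP xs p q : zpoly_eqb p q -> zpoly_val xs p = zpoly_val xs q.
Proof.
move=> /allP h; apply/eqP; rewrite -subr_eq0 -zpoly_val_opp -zpoly_val_add.
rewrite /zpoly_val big_seq big1 // => t /h /BinInt.Z.eqb_spec ->.
by rewrite mul0r.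
Qed.

End evaluation.

Definition expr_of_Z (V : Type) (z : BinNums.Z) : expr V :=
  match z with
  | BinNums.Z0 => ECst 0
  | BinNums.Zpos p => ECst (BinPos.Pos.to_nat p)
  | BinNums.Zneg p => EOpp (ECst (BinPos.Pos.to_nat p))
  end.

Fixpoint expr_of_mono (V : Type) (vs : seq V) (m : seq nat) : expr V :=
  match vs, m with
  | v :: vs', n :: m' => EMul (iter n (EMul (EVar v)) (ECst 1)) (expr_of_mono vs' m')
  | _, _ => ECst 1
  end.

Definition expr_of_zpoly (V : Type) (vs : seq V) (p : zpoly) : expr V :=
  foldr (fun t => EAdd (EMul (expr_of_Z V t.2) (expr_of_mono vs t.1))) (ECst 0) p.

Lemma ev_expr_of_zpoly (R : realType) (V : Type) (vs : seq V) (x : V -> R) p :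
  ev x (expr_of_zpoly vs p) = zpoly_val (map x vs) p.
Proof.
have evZ z : ev x (expr_of_Z V z) = Zr z.
  case: z => [|q|q] //; rewrite /Zr /=.
  have [n ->] := Pnat.Pos2Nat.is_succ q.
  by rewrite /= NegzE mulrNz -pmulrn.
have evm m : ev x (expr_of_mono vs m) = mono_val (map x vs) m.
  elim: vs m => [|v vs IH] [|n m] //=; rewrite IH; congr (_ * _).
  by elim: n => //= n ->; rewrite exprS.
elim: p => [|t p IH] /=; first by rewrite zpoly_val_nil.
by rewrite IH evZ evm zpoly_val_cons.
Qed.

Section even_environments.
Context {R : realType} (x : nat * nat -> R).
Hypothesis odd1 : forall i, x (i, 1) = 0.
Hypothesis odd3 : forall i, x (i, 3) = 0.

(* The integrands of the derivatives of the metric coefficients occurring in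
   Brioschi's formula, in terms of the ratios at lambda = 0: [(n, i, j)] stands
   for the derivative of order i in beta and j in lambda of [fisher_expr n]. *)
Definition fisher_jet_expr (v : nat * nat * nat) : expr (nat * nat) :=
  let s i j : expr (nat * nat) := EVar (i, j) in
  let s10 := s 1%N 0%N in let s20 := s 2%N 0%N in let s02 := s 0%N 2%N in
  let s12 := s 1%N 2%N in let s22 := s 2%N 2%N in
  let s04 := s 0%N 4%N in let s14 := s 1%N 4%N in
  let sq02 := EMul s02 s02 in let sq10 := EMul s10 s10 in
  let term n (e f : expr (nat * nat)) := EMul (ECst n) (EMul e f) in
  match v with
  | (0, 0, 0) => sq10
  | (0, 1, 0) => EAdd (term 2 s10 s20) (EOpp (EMul sq10 s10))
  | (0, 0, 2) => EAdd (term 2 s10 s12) (EOpp (EMul s02 sq10))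
  | (0, 0, 4) => EAdd (EAdd (EAdd (term 6 s12 s12) (term 2 s10 s14))
      (EAdd (EOpp (term 12 s02 (EMul s10 s12))) (EOpp (EMul s04 sq10))))
      (term 6 sq02 sq10)
  | (1, 0, 1) => EMul s02 s10
  | (1, 1, 1) => EAdd (EAdd (EMul s10 s12) (EMul s02 s20)) (EOpp (EMul s02 sq10))
  | (1, 0, 3) => EAdd (EAdd (EMul s04 s10) (term 3 s02 s12)) (EOpp (term 3 sq02 s10))
  | (1, 1, 3) => EAdd (EAdd (EAdd (EMul s10 s14) (EMul s04 s20))
      (EAdd (EOpp (EMul s04 sq10)) (term 3 s12 s12)))
      (EAdd (EAdd (term 3 s02 s22) (EOpp (term 9 s02 (EMul s10 s12))))
            (EAdd (term 6 sq02 sq10) (EOpp (term 3 sq02 s20))))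
  | (2, 0, 2) => term 2 s02 s02
  | (2, 1, 2) => EAdd (term 4 s02 s12) (EOpp (term 2 sq02 s10))
  | (2, 0, 4) => EAdd (term 8 s02 s04) (EOpp (term 12 sq02 s02))
  | (2, 2, 2) => EAdd (EAdd (term 4 s12 s12) (term 4 s02 s22))
      (EAdd (EOpp (term 8 s02 (EMul s10 s12)))
            (EAdd (term 4 sq02 sq10) (EOpp (term 2 sq02 s20))))
  | _ => ECst 0
  end.

Definition fisher_jet_index : seq (nat * nat * nat) :=
  [:: (0, 0, 0); (0, 1, 0); (0, 0, 2); (0, 0, 4);
      (1, 0, 1); (1, 1, 1); (1, 0, 3); (1, 1, 3);
      (2, 0, 2); (2, 1, 2); (2, 0, 4); (2, 2, 2)]%N.

Lemma ev_fisher_jet_expr n i j : (n, i, j) \in fisher_jet_index ->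
  ev x (iter i wder_beta (iter j wder_lambda (fisher_expr n))) =
  ev x (fisher_jet_expr (n, i, j)).
Proof.
have : all (fun v => ev x (iter v.1.2 wder_beta (iter v.2 wder_lambda
    (fisher_expr v.1.1))) == ev x (fisher_jet_expr v)) fisher_jet_index.
  rewrite /= !odd1 !odd3 !andbT.
  by repeat (apply/andP; split); apply/eqP; ring.
by move=> /allP h /h /eqP.
Qed.

End even_environments.

(* Variables of the polynomials: a, S, b, D, c, rho, v, w_1, ..., w_4. *)
Definition base_vars : seq base_var := [:: Ba; BS; Bb; BD; Bc; Brho].

Definition base_index (v : base_var) : nat :=
  match v with Ba => 0 | BS => 1 | Bb => 2 | BD => 3 | Bc => 4 | Brho => 5 end.

(** Normalising after each derivation, then returning to [expr] to differentiate again, keeps the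
    higher ratios small enough to compute with. *)
Fixpoint base_ratio_normal (k : nat) : expr base_var :=
  if k is k'.+1 then expr_of_zpoly base_vars
    (zpoly_ev 6 (fun v => zpoly_var 6 (base_index v))
      (wder base_der base_score (base_ratio_normal k')))
  else ECst 1.

Lemma base_ratio_normalE (R : realType) k :
  @eqv R _ (base_ratio_expr k) (base_ratio_normal k).
Proof.
elim: k => [|k IH] x //.
transitivity (ev x (wder base_der base_score (base_ratio_normal k))).
  exact: (eqv_wder _ _ IH).
apply: etrans (esym (ev_expr_of_zpoly base_vars x _)).
by apply: zpoly_evE => v; case: v; rewrite (@zpoly_val_var _ (map x base_vars)).
Qed.

Definition base_ratio_poly (k : nat) : zpoly :=
  zpoly_ev 11 (fun v => zpoly_var 11 (base_index v)) (base_ratio_normal k).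

(** The ratios at lambda = 0. The coefficients of order four are the variables 7 to 10, so their
    cancellation is part of the identity that is checked. *)
Definition score_poly (v : nat * nat) : zpoly :=
  match v.2 with
  | 0 => base_ratio_poly v.1
  | 2 => zpoly_mul (zpoly_var 11 6)
      (zpoly_add (base_ratio_poly v.1.+2) (zpoly_opp (base_ratio_poly v.1.+1)))
  | 4 => foldr (fun k => zpoly_add
      (zpoly_mul (zpoly_var 11 (7 + k)) (base_ratio_poly (v.1 + k.+1)))) [::] (iota 0 4)
  | _ => [::]
  end.

(* Expectation: under the base law, a S and b D are independent exponential
   variables of mean 1. *)
Definition zpoly_mean (p : zpoly) : zpoly :=
  foldr (fun (t : seq nat * BinNums.Z) (q : zpoly) => match t.1 with
    | i :: m :: j :: n :: r => zpoly_add
        [:: ((i - m)%N :: 0%N :: (j - n)%N :: 0%N :: r,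
             BinInt.Z.mul t.2 (BinInt.Z.of_nat (m`! * n`!)))] q
    | _ => q end) [::] p.

(** The mean of S^m is m!/a^m and exponents are natural numbers, so each power of [S] must come with
    at least as many powers of [a], and likewise [D] with [b]. *)
Definition mean_defined (p : zpoly) : bool :=
  all (fun t : seq nat * BinNums.Z => if t.1 is i :: m :: j :: n :: r then (m <= i)%N && (n <= j)%N else false) p.

Definition jet_poly (v : nat * nat * nat) : zpoly :=
  zpoly_mean (zpoly_ev 11 score_poly (fisher_jet_expr v)).

Lemma jet_poly_defined :
  all (fun v => mean_defined (zpoly_ev 11 score_poly (fisher_jet_expr v))) fisher_jet_index.
Proof. by vm_compute. Qed.

(* 48 times the numerator of Brioschi's formula. *)
Definition curvature_num : expr (nat * nat * nat) :=
  let J n i j : expr (nat * nat * nat) := EVar (n, i, j) in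
  let e := J 0 0 0 in let e0 := J 0 1 0 in let e1 := J 0 0 2 in let e11 := J 0 0 4 in
  let f := J 1 0 1 in let f0 := J 1 1 1 in let f1 := J 1 0 3 in let f01 := J 1 1 3 in
  let g := J 2 0 2 in let g0 := J 2 1 2 in let g1 := J 2 0 4 in let g00 := J 2 2 2 in
  let lin m (p : expr (nat * nat * nat)) n q :=
    EAdd (EMul (ECst m) p) (EOpp (EMul (ECst n) q)) in
  EAdd (EAdd (EAdd (EAdd
    (EMul (EAdd (lin 8 f01 4 e11) (EOpp (EMul (ECst 6) g00)))
          (lin 1 (EMul e g) 2 (EMul f f)))
    (EOpp (EMul e0 (lin 1 (EMul (lin 4 f1 3 g0) g) 1 (EMul f g1)))))
    (EMul (lin 2 f0 1 e1) (lin 2 (EMul (lin 4 f1 3 g0) f) 1 (EMul e g1))))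
    (EMul (EMul (ECst 6) e1) (lin 1 (EMul e1 g) 1 (EMul f g0))))
    (EOpp (EMul (EMul (ECst 3) g0) (lin 2 (EMul e1 f) 1 (EMul e g0)))).

(** Twice the determinant, since g_11 is half of [J 2 0 2]. *)
Definition curvature_den : expr (nat * nat * nat) :=
  let J n i j : expr (nat * nat * nat) := EVar (n, i, j) in
  EAdd (EMul (J 0 0 0) (J 2 0 2)) (EOpp (EMul (ECst 2) (EMul (J 1 0 1) (J 1 0 1)))).

Definition expr_pow (n : nat) (e : expr nat) := iter n (EMul e) (ECst 1).

(* With [A = c rho a] and [B = c rho b]; the coefficients [w_k] of the fourth
   lambda-derivative and [c] itself cancel out. *)
Definition binary_form (l : seq (nat * nat * nat)) : expr nat :=
  let u := EMul (EVar 4) (EVar 5) in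
  foldr (fun t => EAdd (EMul (ECst t.1.1)
    (EMul (expr_pow t.1.2 (EMul u (EVar 0))) (expr_pow t.2 (EMul u (EVar 2)))))) (ECst 0) l.

(** The degrees 12 here and 6 in [closed_den] make the common scale of A and B cancel against the
    squared denominator. Symmetry in A and B, which are proportional to 1 - rho and 1 + rho, leaves
    only even powers of rho. *)
Definition closed_num : expr nat := EOpp (EMul (ECst 768) (EMul (expr_pow 4 (EVar 6))
  (EAdd (binary_form [:: (2, 12, 0); (5, 10, 2); (11, 8, 4); (4, 7, 5); (15, 6, 6); (4, 5, 7);
                  (11, 4, 8); (5, 2, 10); (2, 0, 12)])
        (EOpp (binary_form [:: (1, 9, 3); (1, 3, 9)]))))).

Definition closed_den : expr nat := EMul (ECst 8) (EMul (expr_pow 2 (EVar 6))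
  (binary_form [:: (1, 6, 0); (2, 4, 2); (2, 2, 4); (1, 0, 6)])).

Lemma curvature_closed :
  zpoly_eqb (zpoly_ev 11 jet_poly curvature_num) (zpoly_ev 11 (zpoly_var 11) closed_num) &&
  zpoly_eqb (zpoly_ev 11 jet_poly curvature_den) (zpoly_ev 11 (zpoly_var 11) closed_den).
Proof. by vm_compute. Qed.

(** * Values of the polynomial identities at the boundary point *)

Section boundary_curvature_value.
Context {R : realType}.
Variables (a b c rho v : R) (w : nat -> R).

Let env (S D : R) : seq R := [:: a; S; b; D; c; rho; v; w 1; w 2; w 3; w 4].

Section means.
Context d (Y : measurableType d) (mu : {measure set Y -> \bar R}) (S D q : Y -> R).
Hypotheses (a0 : a != 0) (b0 : b != 0).
Hypothesis L1_moment : forall m n, L1 mu (fun y => S y ^+ m * D y ^+ n * q y).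
Hypothesis moment : forall m n,
  \int[mu]_y (S y ^+ m * D y ^+ n * q y) = (m`! * n`!)%:R / (a ^+ m * b ^+ n).

Lemma zpoly_mean_integral p : mean_defined p ->
  L1 mu (fun y => zpoly_val (env (S y) (D y)) p * q y) /\
  \int[mu]_y (zpoly_val (env (S y) (D y)) p * q y) = zpoly_val (env 1 1) (zpoly_mean p).
Proof.
elim: p => [_|[m z] p IH].
  have -> : (fun y => zpoly_val (env (S y) (D y)) [::] * q y) = cst 0.
    by apply/funext => y; rewrite zpoly_val_nil mul0r.
  split; last by rewrite zpoly_val_nil /Rintegral integral0.
  by rewrite (_ : EFin \o _ = cst 0%E) //; exact: integrable0.
case: m => [|i [|m [|j [|n r]]]] // /andP[/andP[mi nj] /IH[iL1 iE]].
pose M := mono_val [:: c; rho; v; w 1; w 2; w 3; w 4] r.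
have ME x y i' m' j' n' : mono_val (env x y) [:: i', m', j', n' & r] =
  a ^+ i' * (x ^+ m' * (b ^+ j' * (y ^+ n' * M))) by [].
pose k := Zr z * (a ^+ i * b ^+ j * M).
have E : (fun y => zpoly_val (env (S y) (D y)) ((i :: m :: j :: n :: r, z) :: p) * q y) =
    (fun y => k * (S y ^+ m * D y ^+ n * q y) + zpoly_val (env (S y) (D y)) p * q y).
  by apply/funext => y; rewrite zpoly_val_cons ME /k; ring.
have i1 : L1 mu (fun y => k * (S y ^+ m * D y ^+ n * q y)) by exact: L1Z.
rewrite E; split; first exact: L1D.
rewrite RintegralD // RintegralZl // iE moment.
rewrite (zpoly_val_add _ [:: (_, BinInt.Z.mul z _)]); congr (_ + _).
rewrite zpoly_val_cons zpoly_val_nil addr0 ME ZrM Zr_nat.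
have ai : a ^+ i = a ^+ (i - m) * a ^+ m by rewrite -exprD subnK.
have bj : b ^+ j = b ^+ (j - n) * b ^+ n by rewrite -exprD subnK.
rewrite /k !expr0 ai bj; field.
by rewrite !expf_neq0.
Qed.

End means.

Lemma closed_curvature : 0 < c -> rho = expR (- c) -> v != 0 ->
  a = (1 + rho)^-1 -> b = (1 - rho)^-1 ->
  let x i := zpoly_val (env 1 1) (zpoly_var 11 i) in
  ev x closed_den != 0 /\
  ev x closed_num / (12 * ev x closed_den ^+ 2) = KF (rho ^+ 2).
Proof.
move=> c0 rhoE v0 aE bE x.
have xE i : (i < 11)%N -> x i = nth 0 (env 1 1) i := @zpoly_val_var _ (env 1 1) i.
have r0 : 0 < rho by rewrite rhoE expR_gt0.
have r1 : 0 < 1 - rho by rewrite rhoE onem_expR_gt0.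
have r2 : 0 < 1 + rho by rewrite addr_gt0.
pose k := c * rho / ((1 - rho) * (1 + rho)).
have k0 : 0 < k by rewrite divr_gt0 // mulr_gt0.
have AE : c * rho * a = k * (1 - rho) by rewrite aE /k; field; rewrite !gt_eqF.
have BE : c * rho * b = k * (1 + rho) by rewrite bE /k; field; rewrite !gt_eqF.
have denE : ev x closed_den = 16 * v ^+ 2 * k ^+ 6 *
    ((1 + rho ^+ 2) * (3 + rho ^+ 2) * (1 + 3 * rho ^+ 2)).
  by rewrite /= !xE //= AE BE; ring.
have numE : ev x closed_num = - (768 * v ^+ 4 * k ^+ 12 *
  (45 * (rho ^+ 2) ^+ 6 + 534 * (rho ^+ 2) ^+ 5 + 1887 * (rho ^+ 2) ^+ 4
   + 3172 * (rho ^+ 2) ^+ 3 + 2075 * (rho ^+ 2) ^+ 2 + 422 * rho ^+ 2 + 57)).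
  by rewrite /= !xE //= AE BE; ring.
have s0 : 0 < rho ^+ 2 by rewrite exprn_gt0.
have s1 : 1 + rho ^+ 2 != 0 by apply: lt0r_neq0; rewrite addr_gt0.
have s2 : 3 + rho ^+ 2 != 0 by apply: lt0r_neq0; rewrite addr_gt0.
have s3 : 1 + 3 * rho ^+ 2 != 0 by apply: lt0r_neq0; rewrite addr_gt0 ?mulr_gt0.
have kn : k != 0 by rewrite gt_eqF.
have v2 : v ^+ 2 != 0 by rewrite expf_neq0.
have k6 : k ^+ 6 != 0 by rewrite expf_neq0.
have n16 : 16 != 0 :> R by rewrite pnatr_eq0.
split.
  rewrite denE; apply: (mulf_neq0 (mulf_neq0 (mulf_neq0 n16 v2) k6)).
  exact: (mulf_neq0 (mulf_neq0 s1 s2) s3).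
by rewrite numE denE /KF; field; rewrite v0 kn s1 s2 s3.
Qed.

End boundary_curvature_value.

Section boundary_curvature.
Context dY (Y : measurableType dY) {R : realType} (mu : {measure set Y -> \bar R}).
Variables (b0 : R) (q : R -> R -> Y -> R) (s : R -> R -> Y -> nat * nat -> R).
Variables (S D : Y -> R) (c v : R) (w : nat -> R).

Local Notation box := (param_box b0).
Local Notation jt := (jet mu q s).

Hypothesis c0 : 0 < c.
Hypothesis v0 : v != 0.

Let rho := expR (- c).
Let a := (1 + rho)^-1.
Let b := (1 - rho)^-1.
Let env (S D : R) : seq R := [:: a; S; b; D; c; rho; v; w 1; w 2; w 3; w 4].

Hypothesis L1_moment : forall m n, L1 mu (fun y => S y ^+ m * D y ^+ n * q b0 0 y).
Hypothesis moment : forall m n,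
  \int[mu]_y (S y ^+ m * D y ^+ n * q b0 0 y) = (m`! * n`!)%:R / (a ^+ m * b ^+ n).
Hypothesis s_at0 : forall i y, s b0 0 y (i, 0) = base_ratio i c (S y) (D y).
Hypothesis s_at1 : forall i y, s b0 0 y (i, 1) = 0.
Hypothesis s_at2 : forall i y, s b0 0 y (i, 2) =
  v * (base_ratio i.+2 c (S y) (D y) - base_ratio i.+1 c (S y) (D y)).
Hypothesis s_at3 : forall i y, s b0 0 y (i, 3) = 0.
Hypothesis s_at4 : forall i y, s b0 0 y (i, 4) =
  \sum_(k < 4) base_ratio (i + k.+1) c (S y) (D y) * w k.+1.

Let base_ratio_val k y :
  base_ratio k c (S y) (D y) = zpoly_val (env (S y) (D y)) (base_ratio_poly k).
Proof.
rewrite /base_ratio base_ratio_normalE; apply: zpoly_evE => u.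
by case: u; rewrite (@zpoly_val_var _ (env (S y) (D y))).
Qed.

Let score_val u y : (u.2 <= 4)%N ->
  s b0 0 y u = zpoly_val (env (S y) (D y)) (score_poly u).
Proof.
case: u => i [|[|[|[|[|//]]]]] _.
- by rewrite s_at0 base_ratio_val.
- by rewrite s_at1 zpoly_val_nil.
- rewrite s_at2 !base_ratio_val zpoly_val_mul zpoly_val_add zpoly_val_opp.
  by rewrite (@zpoly_val_var _ (env (S y) (D y))).
- by rewrite s_at3 zpoly_val_nil.
- rewrite s_at4 /score_poly.
  rewrite !big_ord_recl big_ord0 /= !zpoly_val_add zpoly_val_nil !zpoly_val_mul.
  by rewrite !(@zpoly_val_var _ (env (S y) (D y))) //= !base_ratio_val; ring.
Qed.

Let ev_score u y : ev (s b0 0 y) (fisher_jet_expr u) =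
  zpoly_val (env (S y) (D y)) (zpoly_ev 11 score_poly (fisher_jet_expr u)).
Proof.
rewrite -(zpoly_evE (xs := env (S y) (D y)) 11 (f := score_poly) (x :=
  fun u => zpoly_val (env (S y) (D y)) (score_poly u))) //.
case: u => [[[|[|[|n]]] i] j] //=.
all: case: i => [|[|[|i]]] //=; case: j => [|[|[|[|[|j]]]]] //=.
all: by rewrite !score_val.
Qed.

Lemma jet_value n i j : (n, i, j) \in fisher_jet_index ->
  jt (fisher_expr n) i j b0 0 = zpoly_val (env 1 1) (jet_poly (n, i, j)).
Proof.
move=> nij.
have r1 : 0 < 1 - rho by exact: onem_expR_gt0.
have an : a != 0 by rewrite gt_eqF // invr_gt0 addr_gt0 // expR_gt0.
have bn : b != 0 by rewrite gt_eqF // invr_gt0.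
have def := allP jet_poly_defined _ nij.
rewrite /jet_poly -(@zpoly_mean_integral _ a b c rho v w _ _ _ _ _ _ an bn L1_moment moment _ def).2.
apply: eq_Rintegral => y _; congr (_ * _); rewrite -ev_score.
by apply: ev_fisher_jet_expr => // k.
Qed.

Let jv u := zpoly_val (env 1 1) (jet_poly u).

Let x i := zpoly_val (env 1 1) (zpoly_var 11 i).

Let closedE (e : expr (nat * nat * nat)) (e' : expr nat) :
  zpoly_eqb (zpoly_ev 11 jet_poly e) (zpoly_ev 11 (zpoly_var 11) e') ->
  ev jv e = ev x e'.
Proof.
move=> ee'; rewrite (@zpoly_evE R _ (env 1 1) 11 jet_poly) //.
by rewrite (zpoly_eqbP (env 1 1) ee') -(@zpoly_evE R _ (env 1 1) 11 (zpoly_var 11) x).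
Qed.

Hypothesis q0 : forall b l y, box b l -> 0 < q b l y.
Hypothesis ds_beta : forall b l y v, box b l ->
  is_derive b 1 (fun u => s u l y v) (ev (s b l y) (ratio_der_beta v)).
Hypothesis ds_lambda : forall b l y v, box b l ->
  is_derive l 1 (fun u => s b u y v) (ev (s b l y) (ratio_der_lambda v)).
Hypothesis dq_beta : forall b l y, box b l ->
  is_derive b 1 (fun u => q u l y) (s b l y (1, 0) * q b l y).
Hypothesis dq_lambda : forall b l y, box b l ->
  is_derive l 1 (fun u => q b u y) (s b l y (0, 1) * q b l y).
Hypothesis L1_jet : forall e b l, box b l ->
  L1 mu (fun y => ev (s b l y) e * q b l y).
Hypothesis smooth_jets : forall e, smooth_jet b0 (jt e).
Hypothesis odd1 : forall b y i, `|b - b0| < 1 -> s b 0 y (i, 1) = 0.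
Hypothesis odd3 : forall b y i, `|b - b0| < 1 -> s b 0 y (i, 3) = 0.
Variable p : R * R -> Y -> R.
Hypothesis pE : forall t y, half_box b0 t -> p t y = q t.1 (Num.sqrt (2 * t.2)) y.

Lemma fisher_boundary_curvature :
  has_gauss_curvature (fisher_metric mu p) (b0, 0) /\
  gauss_curvature (fisher_metric mu p) (b0, 0) = KF (rho ^+ 2).
Proof.
have sj n (_ : (n <= 2)%N) := smooth_jets (fisher_expr n).
have ej n (n2 : (n <= 2)%N) := even_fisher_jet smooth_jets odd1 odd3 n2.
have gE t (ht : half_box b0 t) i j := fisher_metric_jet q0 ds_beta ds_lambda
  dq_beta dq_lambda L1_jet odd1 odd3 pE i j ht.
have /andP[/closedE numE /closedE denE] := curvature_closed.
have [den0 KE] := closed_curvature w c0 (erefl rho) v0 (erefl a) (erefl b).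
have den0' : ev jv curvature_den != 0 by rewrite denE.
have det0 : jet_div 0 (jt (fisher_expr 0)) (b0, 0) * jet_div 2 (jt (fisher_expr 2)) (b0, 0)
   - jet_div 1 (jt (fisher_expr 1)) (b0, 0) ^+ 2 != 0.
  rewrite /jet_div /= eqxx !jet_value // -!/(jv _).
  rewrite (_ : _ - _ = ev jv curvature_den / 2) ?mulf_neq0 ?invr_eq0 ?pnatr_eq0 //.
  rewrite (_ : 0`! = 1%N) // (_ : 1`! = 1%N) // (_ : 2`! = 2%N) // [ev _ _]/=.
  by field.
(* Opaque names keep the large polynomials behind the numerator and the determinant from being
   unfolded. *)
have [N NE] : exists N, N = ev jv curvature_num by eexists.
have [d dE] : exists d, d = ev jv curvature_den by eexists.
(* 12 is 48 over 4: [N] carries the factor 48, and [d] is twice the determinant. *)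
have KE' : N / (12 * d ^+ 2) = KF (rho ^+ 2).
  by rewrite NE dE numE denE; exact: KE.
split; first exact: (jet_has_gauss_curvature sj ej gE det0).
have jE (n i j : nat) : (n, i, j) \in fisher_jet_index ->
  jt (fisher_expr n) i j b0 0 = jv (n, i, j) by exact: jet_value.
have := jet_gauss_curvature sj ej gE det0; rewrite -KE'; cbv zeta.
rewrite (jE 0 0 0 isT)%N (jE 0 1 0 isT)%N (jE 0 0 2 isT)%N (jE 0 0 4 isT)%N.
rewrite (jE 1 0 1 isT)%N (jE 1 1 1 isT)%N (jE 1 0 3 isT)%N (jE 1 1 3 isT)%N.
rewrite (jE 2 0 2 isT)%N (jE 2 1 2 isT)%N (jE 2 0 4 isT)%N (jE 2 2 2 isT)%N => ->.
have {}dE : d = jv (0, 0, 0)%N * jv (2, 0, 2)%N - 2 * (jv (1, 0, 1)%N * jv (1, 0, 1)%N).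
  exact: dE.
have : jv (0, 0, 0)%N * jv (2, 0, 2)%N - 2 * (jv (1, 0, 1)%N * jv (1, 0, 1)%N) != 0.
  exact: den0'.
rewrite NE dE [ev _ _]/=.
move: (jv (0, 0, 0)%N) (jv (0, 1, 0)%N) (jv (0, 0, 2)%N) (jv (0, 0, 4)%N)
  (jv (1, 0, 1)%N) (jv (1, 1, 1)%N) (jv (1, 0, 3)%N) (jv (1, 1, 3)%N)
  (jv (2, 0, 2)%N) (jv (2, 1, 2)%N) (jv (2, 0, 4)%N) (jv (2, 2, 2)%N).
move=> e e0 e1 e11 f f0 f1 f01 g g0 g1 g00 h.
by field.
Qed.

End boundary_curvature.

(** * The texture model *)

Section texture_boundary.
Context {R : realType} d (Omega : measurableType d) (P : probability Omega R).
Variables (A Dt beta : R) (Z : R -> {RV P >-> R}).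
Hypotheses (A0 : 0 < A) (Dt0 : 0 < Dt) (ouZ : stationary_OU A Z).

Let U := clock_prob Dt0.
Let z := OU_path Dt Z.
Let kap := Dt / 2.
Let mu := @C2_lebesgue R.
Let q := ypdf U P z kap sum_form diff_form.
Let s := yval U P z kap sum_form diff_form.

Local Notation box := (param_box beta).

Let kap0 : 0 < kap. Proof. by rewrite /kap divr_gt0. Qed.

Let mz : measurable_fun setT (fun p : measurableTypeR R * Omega => z p.1 p.2).
Proof. exact: OU_path_measurable ouZ. Qed.

Let bz w : exists K : R, forall t, `|z t w| <= K.
Proof. exact: OU_path_bounded ouZ w. Qed.

Let ez (n : nat) : exists C : R, forall t, L1 P (fun w => expR (n%:R * `|z t w|)) /\
  \int[P]_w expR (n%:R * `|z t w|) <= C.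
Proof. exact: OU_path_exp_bounded ouZ n. Qed.

Let mean1 := mean_average1 U mz bz ez (OU_path_mean Dt ouZ).
Let mean2 := mean_average2 U mz bz ez (OU_path_sqr Dt ouZ).
Let mean3 := mean_average3 U mz bz ez (OU_path_third Dt ouZ).
Let mean12 := mean_average12 U mz bz ez (OU_path_third Dt ouZ).
Let mean111 := mean_average111 U mz bz ez (OU_path_third Dt ouZ).
Let v := \int[P]_w (exp_moment U z 1 0 w ^+ 2).
Let v_gt0 : 0 < v.
Proof.
exact: (mean_average11_gt0 U mz bz ez (expR_gt0 (- A * Dt)) (OU_path_cov A0 Dt0 ouZ)).
Qed.

Let vol_exp := @integral_exp_forms R.

Let iexp : L1 mu (fun y => expR (- ((sum_form y + diff_form y) / 4))).
Proof.
have := L1_exp_form (@measurable_sum_form R) (@measurable_diff_form R) vol_exp.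
move=> /(_ 4^-1 4^-1); rewrite invr_gt0 => /(_ (ltr0n _ _) (ltr0n _ _)).
by under eq_fun do rewrite -mulrDr mulrC.
Qed.

(** The rate is exponential in beta, so adding the log-clock to beta multiplies the rate by the
    clock. *)
Lemma texture_pdfE b l y : -1 < l < 1 -> texture_pdf Dt Z b l y = q b l y.
Proof.
move=> l1; rewrite /q /ypdf mix_pdf00E /texture_pdf unlock /Rintegral.
congr (fine _); apply: eq_integral => w _; congr EFin.
rewrite base_pdfE //; congr (base_density _ _ _).
have m0 := exp_moment0_gt0 U mz bz w l1.
rewrite /rate /log_clock (clock_average Dt0 ouZ) expRD lnK ?posrE //.
by rewrite /mix_rate /kap; ring.
Qed.

Let pE t y : half_box beta t -> quotient_pdf Dt Z t y = q t.1 (Num.sqrt (2 * t.2)) y.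
Proof.
move=> /half_box_param /andP[_]; rewrite ltr_norml => h.
exact: texture_pdfE.
Qed.

Let c := expR beta * kap.
Let c0 : 0 < c. Proof. by rewrite mulr_gt0 ?expR_gt0. Qed.

Let q_at0 y : q beta 0 y = base_density c (sum_form y) (diff_form y).
Proof.
rewrite /q /ypdf mix_pdf00E -[RHS](Rintegral_prob_cst P).
by apply: eq_Rintegral => w _; rewrite /mix_kernel mix_rate0E.
Qed.

Let a := (1 + expR (- c))^-1.
Let b := (1 - expR (- c))^-1.
Let a0 : 0 < a. Proof. by rewrite invr_gt0 addr_gt0 ?expR_gt0. Qed.
Let b0 : 0 < b. Proof. by rewrite invr_gt0 onem_expR_gt0. Qed.

Let qE m n y : sum_form y ^+ m * diff_form y ^+ n * q beta 0 y =
  (a * b / pi ^+ 2) *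
  (sum_form y ^+ m * diff_form y ^+ n * expR (- (a * sum_form y + b * diff_form y))).
Proof.
rewrite q_at0 /base_density -/a -/b [sum_form y * a]mulrC [diff_form y * b]mulrC.
by move: (expR _) (pi ^+ 2) => e p; ring.
Qed.

Let L1_moment m n : L1 mu (fun y => sum_form y ^+ m * diff_form y ^+ n * q beta 0 y).
Proof.
under eq_fun do rewrite qE; apply: L1Z.
apply: (L1_exp_form_moment _ _ _ _ _ m n a0 b0).
- exact: measurable_sum_form.
- exact: measurable_diff_form.
- exact: sum_form_ge0.
- exact: diff_form_ge0.
- exact: (L1_exp_form (@measurable_sum_form R) (@measurable_diff_form R) vol_exp).
Qed.

Let moment m n : \int[mu]_y (sum_form y ^+ m * diff_form y ^+ n * q beta 0 y) =
  (m`! * n`!)%:R / (a ^+ m * b ^+ n).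
Proof.
have ab2 : 0 < a * b / pi ^+ 2 by rewrite divr_gt0 ?mulr_gt0 ?exprn_gt0 ?pi_gt0.
have i1 : L1 mu (fun y => sum_form y ^+ m * diff_form y ^+ n *
    expR (- (a * sum_form y + b * diff_form y))).
  have := L1Z (a * b / pi ^+ 2)^-1 (L1_moment m n).
  under eq_fun do rewrite qE mulKf ?(gt_eqF ab2) //.
  by [].
under eq_Rintegral do rewrite qE.
rewrite RintegralZl // (exp_form_moment (@measurable_sum_form R) (@measurable_diff_form R)
  (@sum_form_ge0 R) (@diff_form_ge0 R) vol_exp m n a0 b0) natrM !exprS.
have : (pi : R) != 0 by rewrite gt_eqF // pi_gt0.
move: (pi : R) a0 b0 => p; move: a b => a' b' a0' b0' p0.
by field; rewrite p0 !expf_neq0 ?gt_eqF.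
Qed.

Let ds_beta u l y k : box u l ->
  is_derive u 1 (fun t => s t l y k) (ev (s u l y) (ratio_der_beta k)).
Proof.
exact: (is_derive_yval_beta U mz bz ez kap0 (@sum_form_ge0 R) (@diff_form_ge0 R)).
Qed.

Let ds_lambda u l y k : box u l ->
  is_derive l 1 (fun t => s u t y k) (ev (s u l y) (ratio_der_lambda k)).
Proof.
exact: (is_derive_yval_lambda U mz bz ez kap0 (@sum_form_ge0 R) (@diff_form_ge0 R)).
Qed.

Let dq_beta u l y : box u l ->
  is_derive u 1 (fun t => q t l y) (s u l y (1%N, 0%N) * q u l y).
Proof.
exact: (is_derive_ypdf_beta U mz bz ez kap0 (@sum_form_ge0 R) (@diff_form_ge0 R)).
Qed.

Let dq_lambda u l y : box u l ->
  is_derive l 1 (fun t => q u t y) (s u l y (0%N, 1%N) * q u l y).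
Proof.
exact: (is_derive_ypdf_lambda U mz bz ez kap0 (@sum_form_ge0 R) (@diff_form_ge0 R)).
Qed.

Let q_gt0 u l y : box u l -> 0 < q u l y.
Proof.
move=> bx; exact: (mix_pdf00_gt0 U mz bz ez kap0 bx (sum_form_ge0 y) (diff_form_ge0 y)).
Qed.

Let L1_jet e u l : box u l -> L1 mu (fun y => ev (s u l y) e * q u l y).
Proof.
exact: (L1_ratio_integral U mz bz ez kap0 (@measurable_sum_form R)
  (@measurable_diff_form R) (@sum_form_ge0 R) (@diff_form_ge0 R) iexp).
Qed.

Let smooth_jets e : smooth_jet beta (jet mu q s e).
Proof.
split=> [i j u l bx|i j u l bx|i j].
- exact: (is_derive_ratio_jet_beta U mz bz ez kap0 (@measurable_sum_form R)
    (@measurable_diff_form R) (@sum_form_ge0 R) (@diff_form_ge0 R) iexp e i j bx).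
- exact: (is_derive_ratio_jet_lambda U mz bz ez kap0 (@measurable_sum_form R)
    (@measurable_diff_form R) (@sum_form_ge0 R) (@diff_form_ge0 R) iexp e i j bx).
- exact: (ratio_jet_bounded U mz bz ez beta kap0 (@measurable_sum_form R)
    (@measurable_diff_form R) (@sum_form_ge0 R) (@diff_form_ge0 R) iexp e i j).
Qed.

Let odd1 u y i : s u 0 y (i, 1%N) = 0.
Proof. exact: (ratio_at0_1 mz bz ez kap0 mean1). Qed.

Let odd3 u y i : s u 0 y (i, 3%N) = 0.
Proof. exact: (ratio_at0_3 mz bz ez kap0 mean1 mean3 mean12 mean111). Qed.

Lemma texture_has_fisher_metric :
  \forall t \near within half_plane (nbhs (beta, 0 : R)),
    has_fisher_metric C2_lebesgue (quotient_pdf Dt Z) t.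
Proof.
apply: filterS (half_box_near beta) => t ht.
exact: (jet_has_fisher_metric q_gt0 ds_beta ds_lambda dq_beta dq_lambda L1_jet
  (fun u y i _ => odd1 u y i) (fun u y i _ => odd3 u y i) pE ht).
Qed.

Lemma texture_boundary_curvature :
  has_gauss_curvature (texture_metric Dt Z) (beta, 0) /\
  boundary_curvature Dt Z beta = KF (expR (- 2 * rate Dt beta)).
Proof.
have cE : rate Dt beta = c by rewrite /rate /c /kap mulrA.
have -> : expR (- 2 * rate Dt beta) = expR (- c) ^+ 2.
  by rewrite -expRM_natl cE; congr expR; ring.
apply: (fisher_boundary_curvature c0 (lt0r_neq0 v_gt0) L1_moment moment
  (w := fun k => coef_mean U P z 4 k) _ _ _ _ _ q_gt0 ds_beta ds_lambda dq_beta dq_lambda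
  L1_jet smooth_jets (fun u y i _ => odd1 u y i) (fun u y i _ => odd3 u y i) pE).
- by move=> i y; exact: (ratio_at0_0 U mz bz ez kap0).
- by move=> i y.
- by move=> i y; exact: (ratio_at0_2 mz bz ez kap0 mean2 (erefl v)).
- by move=> i y.
- by move=> i y; exact: (ratio_at0_4 U mz bz ez kap0).
Qed.

End texture_boundary.

(** * Sign and limits of the curvature function *)

Section curvature_function.
Context {R : realType}.

Let KF_num (s : R) : R := 45 * s ^+ 6 + 534 * s ^+ 5 + 1887 * s ^+ 4 + 3172 * s ^+ 3
  + 2075 * s ^+ 2 + 422 * s + 57.

Let KF_den (s : R) : R := 4 * (1 + s) ^+ 2 * (3 + s) ^+ 2 * (1 + 3 * s) ^+ 2.

Let KF_den_gt0 s : 0 <= s -> 0 < KF_den s.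
Proof.
move=> s0; have [d1 d2 d3] : [/\ 0 < 1 + s, 0 < 3 + s & 0 < 1 + 3 * s] by split; lra.
rewrite /KF_den; apply: mulr_gt0 (exprn_gt0 2 d3).
apply: mulr_gt0 (exprn_gt0 2 d2); exact: mulr_gt0 (ltr0n _ 4) (exprn_gt0 2 d1).
Qed.

(** All coefficients of the numerator are positive. *)
Lemma KF_lt0 (s : R) : 0 < s -> KF s < 0.
Proof.
move=> s0; rewrite /KF -/(KF_num s) -/(KF_den s) mulNr oppr_lt0.
apply: divr_gt0 (KF_den_gt0 (ltW s0)); rewrite /KF_num.
have p n := exprn_gt0 n s0.
have := p 2%N; have := p 3%N; have := p 4%N; have := p 5%N; have := p 6%N.
by move: (s ^+ 2) (s ^+ 3) (s ^+ 4) (s ^+ 5) (s ^+ 6) => s2 s3 s4 s5 s6 *; lra.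
Qed.

Lemma continuous_KF (s : R) : 0 <= s -> KF u @[u --> s] --> KF s.
Proof.
move=> s0.
have cI : (fun u : R => u) @ s --> s by exact: cvg_id.
have cK (k : R) : (fun=> k) @ s --> k by exact: cvg_cst.
have cE (f : R -> R) n : f @ s --> f s -> (fun u => f u ^+ n) @ s --> f s ^+ n.
  by move=> hf; exact: (cvg_comp _ _ hf (@exprn_continuous R n (f s))).
have cP (k : R) n : (fun u => k * u ^+ n) @ s --> k * s ^+ n.
  exact: (cvgM (cK k) (cE id n cI)).
have cN : KF_num @ s --> KF_num s.
  exact: (cvgD (cvgD (cvgD (cvgD (cvgD (cvgD (cP 45 6%N) (cP 534 5%N)) (cP 1887 4%N))
    (cP 3172 3%N)) (cP 2075 2%N)) (cvgM (cK 422) cI)) (cK 57)).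
have cD : KF_den @ s --> KF_den s.
  have c1 : (fun u => (1 + u) ^+ 2) @ s --> (1 + s) ^+ 2.
    by apply: (cE (fun u => 1 + u)); exact: (cvgD (cK 1) cI).
  have c2 : (fun u => (3 + u) ^+ 2) @ s --> (3 + s) ^+ 2.
    by apply: (cE (fun u => 3 + u)); exact: (cvgD (cK 3) cI).
  have c3 : (fun u => (1 + 3 * u) ^+ 2) @ s --> (1 + 3 * s) ^+ 2.
    by apply: (cE (fun u => 1 + 3 * u)); exact: (cvgD (cK 1) (cvgM (cK 3) cI)).
  exact: (cvgM (cvgM (cvgM (cK 4) c1) c2) c3).
exact: (cvgM (cvgN cN) (cvgV (lt0r_neq0 (KF_den_gt0 s0)) cD)).
Qed.

Lemma cvg_KF_at_right0 : KF (expR (- 2 * c)) @[c --> (0 : R)^'+] --> (- 2 : R).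
Proof.
have e : KF (1 : R) = - 2 by rewrite /KF; field.
have h0 : (- 2 * c) @[c --> (0 : R)^'+] --> (- 2 * 0 : R).
  by apply: cvgM; [exact: cvg_cst|apply: cvg_at_right_filter; exact: cvg_id].
rewrite mulr0 in h0.
have h : expR (- 2 * c) @[c --> (0 : R)^'+] --> expR (0 : R).
  exact: (cvg_comp _ _ h0 (@continuous_expR R 0)).
rewrite expR0 in h.
have : KF (expR (- 2 * c)) @[c --> (0 : R)^'+] --> KF (1 : R).
  exact: (cvg_comp _ _ h (continuous_KF ler01)).
by rewrite e.
Qed.

Lemma cvg_KF_pinfty : KF (expR (- 2 * c)) @[c --> +oo%R] --> (- (19 / 12) : R).
Proof.
have -> : - (19 / 12) = KF (0 : R) by rewrite /KF; field.
have h : expR (- 2 * c) @[c --> +oo%R] --> (0 : R).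
  have h2 : (2 * c : R) @[c --> +oo%R] --> +oo%R.
    by apply: gt0_cvgMry => //; exact: cvg_id.
  have := cvg_comp _ _ h2 (@cvgr_expR R).
  by apply: cvg_trans; apply: near_eq_cvg; near=> c; rewrite /= mulNr.
exact: (cvg_comp _ _ h (continuous_KF (lexx 0))).
Unshelve. all: by end_near. Qed.

End curvature_function.

Theorem theorem8p1 (R : realType) :
  [/\ forall (A Dt beta : R) (disp : measure_display)
        (Omega : measurableType disp) (P : probability Omega R)
        (Z : R -> {RV P >-> R}),
        0 < A -> 0 < Dt -> stationary_OU A Z ->
        [/\ \forall t \near within half_plane (nbhs (beta, 0 : R)),
              has_fisher_metric C2_lebesgue (quotient_pdf Dt Z) t,
            has_gauss_curvature (texture_metric Dt Z) (beta, 0) &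
            boundary_curvature Dt Z beta = KF (expR (- 2 * rate Dt beta))],
      forall s : R, 0 < s < 1 -> KF s < 0,
      KF (expR (- 2 * c)) @[c --> (0 : R)^'+] --> (- 2 : R),
      KF (expR (- 2 * c)) @[c --> +oo%R] --> (- (19 / 12) : R) &
      forall (A1 A2 Dt1 Dt2 beta1 beta2 : R) (disp1 disp2 : measure_display)
        (Omega1 : measurableType disp1) (Omega2 : measurableType disp2)
        (P1 : probability Omega1 R) (P2 : probability Omega2 R)
        (Z1 : R -> {RV P1 >-> R}) (Z2 : R -> {RV P2 >-> R}),
        0 < A1 -> 0 < A2 -> 0 < Dt1 -> 0 < Dt2 ->
        stationary_OU A1 Z1 -> stationary_OU A2 Z2 ->
        rate Dt1 beta1 = rate Dt2 beta2 ->
        boundary_curvature Dt1 Z1 beta1 = boundary_curvature Dt2 Z2 beta2].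
Proof.
split.
- move=> A Dt beta disp Omega P Z A0 Dt0 ouZ.
  have [hK K] := texture_boundary_curvature beta A0 Dt0 ouZ.
  by split=> //; exact: (texture_has_fisher_metric beta Dt0 ouZ).
- by move=> s /andP[s0 _]; exact: KF_lt0.
- exact: cvg_KF_at_right0.
- exact: cvg_KF_pinfty.
- move=> A1 A2 Dt1 Dt2 beta1 beta2 disp1 disp2 Omega1 Omega2 P1 P2 Z1 Z2.
  move=> A10 A20 Dt10 Dt20 ou1 ou2 rE.
  (* Both curvatures are [KF] at the same point, which depends on the rate alone. *)
  rewrite (texture_boundary_curvature beta1 A10 Dt10 ou1).2 rE.
  by rewrite (texture_boundary_curvature beta2 A20 Dt20 ou2).2.
Qed.
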